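(* Let $(W,S)$ be the Coxeter system of type $\widetilde{B}_{n+1}$. The set $\mathrm{I_w}(\widetilde{B}_{n+1})$ of weak star irreducible fully commutative elements is partitioned as $$\mathrm{I_w}(\widetilde{B}_{n+1})=\mathrm{K}(\widetilde{B}_{n+1})\sqcup \mathrm{K_w}(\widetilde{B}_{n+1})\sqcup \mathrm{CZ}(\widetilde{B}_{n+1})\sqcup \mathrm{CC_w}(\widetilde{B}_{n+1}).$$ If $n$ is odd, $\mathrm{K}(\widetilde{B}_{n+1})=\emptyset$; if $n$ is even, $\mathrm{K_w}(\widetilde{B}_{n+1})=\emptyset$.
   Context: Type $\widetilde{B}_{n+1}$: generators $S=\{s_0,\dots,s_{n+1}\}$, $m_{s,t}=3$ for the pairs $\{s_0,s_2\}$, $\{s_1,s_2\}$, $\{s_i,s_{i+1}\}$ ($2\le i\le n-1$), $m_{s_n,s_{n+1}}=4$; all other pairs of distinct generators commute. $\ell$ is the length. An element $w$ is fully commutative (FC) if any reduced expression of $w$ can be obtained from any other by using only commutation relations. $\mathrm{D_L}(w)=\{s\in S:\ell(sw)<\ell(w)\}$, $\mathrm{D_R}(w)=\{s\in S:\ell(ws)<\ell(w)\}$, and $supp(w)$ is the set of generators occurring in a reduced expression of $w$. Weak star reducibility: an FC element $w$ is left (resp. right) weak star reducible by $s$ with respect to $t$ to $sw$ (resp. $ws$) if $m_{s,t}\ge 3$, $s\in \mathrm{D_L}(w)$, $t\in \mathrm{D_L}(sw)$ and $tw$ is not FC (resp. $s\in \mathrm{D_R}(w)$, $t\in \mathrm{D_R}(ws)$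 and $wt$ is not FC). An FC element is weak star irreducible if it is neither left nor right weak star reducible by any $s$ with respect to any $t$; $\mathrm{I_w}(\widetilde{B}_{n+1})$ is the set of these. Let $\mathrm{CC}(\widetilde{B}_{n+1})$ be the set of FC elements that are products of commuting generators (including $e$). The weak completely commutative elements are $$\mathrm{CC_w}(\widetilde{B}_{n+1})=\mathrm{CC}(\widetilde{B}_{n+1})\cup\{s_ns_{n+1}v,\ s_{n+1}s_nv : v\in \mathrm{CC}(\widetilde{B}_{n+1}),\ s_{n-1},s_n,s_{n+1}\notin supp(v)\}.$$ Complete zigzags: let $\mathcal{A}=s_2s_3\cdots s_ns_{n+1}$ and $\mathcal{B}=s_ns_{n-1}\cdots s_2s_1s_0$. $\mathrm{CZ}(\widetilde{B}_{n+1})$ is the set of FC elements having a reduced expression of the form $s_0s_1(\mathcal{A}\mathcal{B})^k\mathcal{A}^h$ or $s_{n+1}(\mathcal{B}\mathcal{A})^k\mathcal{B}^h$, with $k\ge 0$, $h\in\{0,1\}$, $k+h>0$. Cartier–Foata normal form (CFNF): every FC element $w$ factors uniquely as $w=u_0\cdots u_m$ with each $u_i\in\mathrm{CC}(\widetilde{B}_{n+1})$, $supp(u_0)=\mathrm{D_L}(w)$, $\ell(w)=\sum_i\ell(u_i)$, and for every $t\in supp(u_{j+1})$ ($0\le j\le m-1$) there is $s\in supp(u_j)$ with $m_{s,t}\ge 3$. Candies: for $n$ even, $\mathrm{K}(\widetilde{B}_{n+1})$ is the set of FC elements with CFNF $u_0\cdots u_m$, $m\ge 2$ even, such that $supp(u_{2i})=\{s_3,s_5,\dots,s_{n+1}\}\cup\{x_i\}$,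 $x_i\in\{s_0,s_1\}$ for $0\le i\le m/2$, $x_i\ne x_{i+1}$ for consecutive indices, and $supp(u_{2i+1})=\{s_2,s_4,\dots,s_n\}$ for $0\le i<m/2$; for $n$ odd, $\mathrm{K}(\widetilde{B}_{n+1})=\emptyset$. Left candies: for $n$ odd, $\mathrm{K_w}(\widetilde{B}_{n+1})$ is the set of FC elements with CFNF $u_0\cdots u_m$, $m\ge 2$ even, such that $supp(u_{2i})=\{s_3,s_5,\dots,s_n\}\cup\{x_i\}$, $x_i\in\{s_0,s_1\}$ for $0\le i\le m/2$, $x_i\neq x_{i+1}$ for consecutive indices, and $supp(u_{2i+1})=\{s_2,s_4,\dots,s_{n+1}\}$ for $0\le i<m/2$; for $n$ even, $\mathrm{K_w}(\widetilde{B}_{n+1})=\emptyset$.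
   Formalization: Stated for n ≥ 3: for n = 2 the claim is false, since s_2s_3s_0 lies in CC_w but is left weak star reducible by s_2 with respect to s_0, and for n ≤ 1 the diagram is not well defined. *)

(* Defs.v *)
From HB Require Import structures.
From Stdlib Require Import Relations.
From mathcomp Require Import all_boot.
From mathcomp Require Import boolp classical_sets.

Set Implicit Arguments.
Unset Strict Implicit.
Unset Printing Implicit Defensive.

Local Open Scope nat_scope.
Local Open Scope quotient_scope.
Local Open Scope classical_set_scope.
Local Open Scope group_scope.

(* All entries are finite: m_{s,t} = oo is not allowed. *)
Record coxmatrix (S : finType) := CoxMatrix {
  cox_entry :> S -> S -> nat;
  cox_diag : forall s, cox_entry s s = 1%N;
  cox_sym : forall s t, cox_entry s t = cox_entry t s;
  cox_offdiag : forall s t, s != t -> (2 <= cox_entry s t)%N }.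

Section CoxeterGroup.
Variables (S : finType) (M : coxmatrix S).
Implicit Types (a b c : seq S) (s t : S).

(* The group is the set of words modulo the congruence generated by the
   relators (st)^{m_{s,t}}; the case s = t gives s^2 = 1. *)
Definition cox_step a b : Prop := exists a1 a2 s t,
  a = a1 ++ flatten (nseq (M s t) [:: s; t]) ++ a2 /\ b = a1 ++ a2.

Definition cox_cong : seq S -> seq S -> Prop := clos_refl_sym_trans _ cox_step.

Definition cox_congb a b : bool := `[< cox_cong a b >].

Lemma cox_congb_refl : reflexive cox_congb.
Proof. by move=> a; apply/asboolP; apply: rst_refl. Qed.

Lemma cox_congb_sym : symmetric cox_congb.
Proof. by move=> a b; apply/asboolP/asboolP; apply: rst_sym. Qed.

Lemma cox_congb_trans : transitive cox_congb.
Proof.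
by move=> b a c /asboolP ab /asboolP bc; apply/asboolP; apply: rst_trans bc.
Qed.

Canonical cox_equiv :=
  EquivRel cox_congb cox_congb_refl cox_congb_sym cox_congb_trans.

Definition coxgroup := {eq_quot cox_equiv}.

HB.instance Definition _ := Choice.on coxgroup.
HB.instance Definition _ := EqQuotient.on coxgroup.

Definition cox_pi a : coxgroup := \pi_coxgroup a.

Lemma cox_piK (x : coxgroup) : cox_pi (repr x) = x.
Proof. exact: reprK. Qed.

Definition cox_one : coxgroup := cox_pi [::].
Definition cox_mul (x y : coxgroup) : coxgroup := cox_pi (repr x ++ repr y).
Definition cox_inv (x : coxgroup) : coxgroup := cox_pi (rev (repr x)).

Lemma cox_piP a b : cox_pi a = cox_pi b <-> cox_cong a b.
Proof.
by split=> [/eqmodP/asboolP|ab] //; apply/eqmodP/asboolP.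
Qed.

Lemma cox_cong_cat c1 c2 a b :
  cox_cong a b -> cox_cong (c1 ++ a ++ c2) (c1 ++ b ++ c2).
Proof.
elim=> {a b}; last first.
- by move=> a b c _ ab _; apply: rst_trans.
- by move=> a b _; apply: rst_sym.
- by move=> a; apply: rst_refl.
move=> a b [a1 [a2 [s [t [-> ->]]]]]; apply: rst_step.
by exists (c1 ++ a1), (a2 ++ c2), s, t; rewrite -!catA.
Qed.

Lemma cox_repr_pi a : cox_cong (repr (cox_pi a)) a.
Proof. by apply/cox_piP; rewrite cox_piK. Qed.

Lemma cox_mul_pi a b : cox_mul (cox_pi a) (cox_pi b) = cox_pi (a ++ b).
Proof.
apply/cox_piP; apply: (rst_trans _ _ _ (a ++ repr (cox_pi b))).
  exact: (@cox_cong_cat [::] _ _ _ (cox_repr_pi a)).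
by have := @cox_cong_cat a [::] _ _ (cox_repr_pi b); rewrite !cats0.
Qed.

Lemma cox_mulA : associative cox_mul.
Proof.
move=> x y z; rewrite -(cox_piK x) -(cox_piK y) -(cox_piK z).
by rewrite !cox_mul_pi catA.
Qed.

Lemma cox_mul1g : left_id cox_one cox_mul.
Proof. by move=> x; rewrite -(cox_piK x) /cox_one cox_mul_pi. Qed.

Lemma cox_mulg1 : right_id cox_one cox_mul.
Proof. by move=> x; rewrite -(cox_piK x) /cox_one cox_mul_pi cats0. Qed.

Lemma cox_cong_revl a : cox_cong (rev a ++ a) [::].
Proof.
elim: a => [|s a IH]; first exact: rst_refl.
apply: rst_trans IH; apply: rst_step; exists (rev a), a, s, s; split=> //.
by rewrite cox_diag /= rev_cons cat_rcons.
Qed.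

Lemma cox_mulVg : left_inverse cox_one cox_inv cox_mul.
Proof.
move=> x; rewrite -[X in cox_mul _ X](cox_piK x) cox_mul_pi.
exact/cox_piP/cox_cong_revl.
Qed.

Lemma cox_mulgV : right_inverse cox_one cox_inv cox_mul.
Proof.
move=> x; rewrite -[X in cox_mul X _](cox_piK x) cox_mul_pi.
by apply/cox_piP; rewrite -[X in X ++ _]revK; apply: cox_cong_revl.
Qed.

HB.instance Definition _ := isGroup.Build coxgroup
  cox_mulA cox_mul1g cox_mulg1 cox_mulVg cox_mulgV.

Definition cox_gen s : coxgroup := cox_pi [:: s].

Definition word_prod a : coxgroup := \prod_(s <- a) cox_gen s.

Lemma word_prod_pi a : word_prod a = cox_pi a.
Proof.
rewrite /word_prod; elim: a => [|s a IH]; first by rewrite big_nil.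
by rewrite big_cons IH; apply: (cox_mul_pi [:: s] a).
Qed.

Lemma word_prod_onto (w : coxgroup) :
  exists k, `[< exists2 a, size a = k & word_prod a = w >].
Proof.
by exists (size (repr w)); apply/asboolP; exists (repr w);
  rewrite // word_prod_pi cox_piK.
Qed.

Definition cox_length (w : coxgroup) : nat := ex_minn (word_prod_onto w).

Local Notation ell := cox_length.
Implicit Types (w u v : coxgroup).

Definition reduced_expr w a : Prop := word_prod a = w /\ size a = ell w.

Definition comm_step a b : Prop := exists a1 a2 s t,
  [/\ M s t = 2%N, a = a1 ++ [:: s; t] ++ a2 & b = a1 ++ [:: t; s] ++ a2].

Definition fully_commutative w : Prop := forall a b,
  reduced_expr w a -> reduced_expr w b -> clos_refl_trans _ comm_step a b.

Definition left_descents w : set S := [set s | (ell (cox_gen s * w)%g < ell w)%N].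
Definition right_descents w : set S := [set s | (ell (w * cox_gen s)%g < ell w)%N].

Definition supp w : set S := [set s | exists2 a, reduced_expr w a & s \in a].

Definition left_weak_star_reducible w s t : Prop :=
  [/\ (3 <= M s t)%N, left_descents w s,
      left_descents (cox_gen s * w) t & ~ fully_commutative (cox_gen t * w)].

Definition right_weak_star_reducible w s t : Prop :=
  [/\ (3 <= M s t)%N, right_descents w s,
      right_descents (w * cox_gen s) t & ~ fully_commutative (w * cox_gen t)].

Definition weak_star_irreducible : set coxgroup :=
  [set w | fully_commutative w /\
     forall s t, ~ left_weak_star_reducible w s t /\
                 ~ right_weak_star_reducible w s t].

(* Since m_{s,s} = 1, the generators in the product are pairwise distinct. *)
Definition completely_commutative : set coxgroup :=
  [set w | fully_commutative w /\
     exists2 a, pairwise (fun s t => M s t == 2%N) a & w = word_prod a].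

(* w = u_0 ... u_m; the values of u beyond m are irrelevant. *)
Definition is_CFNF w (m : nat) (u : nat -> coxgroup) : Prop :=
  [/\ w = \prod_(i < m.+1) u i,
      forall i, (i <= m)%N -> completely_commutative (u i),
      supp (u 0%N) = left_descents w,
      ell w = (\sum_(i < m.+1) ell (u i))%N
    & forall j t, (j < m)%N -> supp (u j.+1) t ->
        exists2 s, supp (u j) s & (3 <= M s t)%N].

End CoxeterGroup.

Definition Btilde_edge3 (n i j : nat) : bool :=
  [|| (i == 0) && (j == 2), (i == 1) && (j == 2)
    | [&& 2 <= i, i <= n.-1 & j == i.+1]]%N.

Definition Btilde_entry (n : nat) (i j : 'I_n.+2) : nat :=
  if i == j then 1%N
  else if Btilde_edge3 n i j || Btilde_edge3 n j i then 3%N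
  else if ((i == n :> nat) && (j == n.+1 :> nat))
       || ((j == n :> nat) && (i == n.+1 :> nat)) then 4%N
  else 2%N.

Lemma Btilde_diag n (i : 'I_n.+2) : Btilde_entry i i = 1%N.
Proof. by rewrite /Btilde_entry eqxx. Qed.

Lemma Btilde_sym n (i j : 'I_n.+2) : Btilde_entry i j = Btilde_entry j i.
Proof.
rewrite /Btilde_entry eq_sym [Btilde_edge3 n i j || _]orbC.
by rewrite [(i == n :> nat) && _ || _]orbC.
Qed.

Lemma Btilde_offdiag n (i j : 'I_n.+2) : i != j -> (2 <= Btilde_entry i j)%N.
Proof. by rewrite /Btilde_entry => /negPf ->; case: ifP => _ //; case: ifP. Qed.

(* Type \tilde B_{n+1}: the generators s_0, ..., s_{n+1} are the ordinals of
   'I_n.+2. *)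
Definition Btilde_mx (n : nat) : coxmatrix 'I_n.+2 :=
  CoxMatrix (@Btilde_diag n) (@Btilde_sym n) (@Btilde_offdiag n).

Notation Btilde n := (coxgroup (Btilde_mx n)).

Section TypeBtilde.
Variable n : nat.
Local Notation W := (Btilde n).
Local Notation FC := (@fully_commutative _ (Btilde_mx n)).

Definition gen_idx (i : nat) : 'I_n.+2 := inord i.
Local Notation s_ i := (gen_idx i).

Definition Iw : set W := @weak_star_irreducible _ (Btilde_mx n).

Definition CC : set W := @completely_commutative _ (Btilde_mx n).

Definition CCw : set W := CC `|`
  [set w | exists2 v : W,
     [/\ CC v, ~ supp v (s_ n.-1), ~ supp v (s_ n) & ~ supp v (s_ n.+1)]
   & w = cox_gen _ (s_ n) * cox_gen _ (s_ n.+1) * v \/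
     w = cox_gen _ (s_ n.+1) * cox_gen _ (s_ n) * v].

(* s_2 s_3 ... s_{n+1} *)
Definition zigA : seq 'I_n.+2 := [seq s_ i | i <- iota 2 n].
(* s_n s_{n-1} ... s_1 s_0 *)
Definition zigB : seq 'I_n.+2 := [seq s_ i | i <- rev (iota 0 n.+1)].

Definition wpow (a : seq 'I_n.+2) (k : nat) : seq 'I_n.+2 := flatten (nseq k a).

Definition CZ : set W := [set w | FC w /\ exists k h,
  [/\ (h <= 1)%N, (0 < k + h)%N
    & reduced_expr w ([:: s_ 0; s_ 1] ++ wpow (zigA ++ zigB) k ++ wpow zigA h)
   \/ reduced_expr w (s_ n.+1 :: wpow (zigB ++ zigA) k ++ wpow zigB h)]].

(* Alternating elements whose even-indexed CFNF factors have support
   Odd + {x_i}, with x_i alternating in {s_0, s_1}, and whose odd-indexed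
   factors have support Even. *)
Definition candies (Odd Even : set 'I_n.+2) : set W := [set w | FC w /\
  exists (m : nat) (u : nat -> W) (x : nat -> 'I_n.+2),
  [/\ is_CFNF w m u, (2 <= m)%N, ~~ odd m,
      forall i, (i <= m./2)%N ->
        (x i = s_ 0 \/ x i = s_ 1) /\ supp (u i.*2) = Odd `|` [set x i]
    & (forall i, (i < m./2)%N -> x i <> x i.+1) /\
      (forall i, (i < m./2)%N -> supp (u i.*2.+1) = Even)]].

Definition K : set W :=
  if odd n then set0 else
  candies [set i : 'I_n.+2 | odd i && (3 <= i <= n.+1)%N]
          [set i : 'I_n.+2 | ~~ odd i && (2 <= i <= n)%N].

Definition Kw : set W :=
  if odd n then
  candies [set i : 'I_n.+2 | odd i && (3 <= i <= n)%N]
          [set i : 'I_n.+2 | ~~ odd i && (2 <= i <= n.+1)%N]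
  else set0.

End TypeBtilde.

Arguments Iw n : clear implicits.
Arguments CC n : clear implicits.
Arguments CCw n : clear implicits.
Arguments CZ n : clear implicits.
Arguments K n : clear implicits.
Arguments Kw n : clear implicits.

(* Main.v *)
(* A fully commutative element is a commutation class of words containing neither a
   repeated letter nor a braid factor. That such words are reduced follows from the
   exchange property and from the Cartan representation, which separates the alternating
   words that are not braid relations. Since t s t is never fully commutative when
   m_{s,t} = 3, left weak star irreducibility forbids s t at the front of the class when
   m_{s,t} = 3, and allows s t = s_n s_{n+1} or s_{n+1} s_n there only if prepending t
   keeps the class fully commutative.

   For an irreducible class consider the first occurrences of the generators. If 0 and 1
   precede the first 2, which precedes the first 3 (or if n+1 precedes n, which precedes
   n-1), irreducibility propagates this chain to the other end of the diagram; full
   commutativity and irreducibility on the right then force the word to continue letter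
   by letter as a complete zigzag. Otherwise two consecutive occurrences of i, with
   2 <= i <= n, always enclose neighbours of i on both sides. Hence either every generator
   occurs and the projections onto adjacent letters alternate, which gives a candy, or no
   two adjacent generators occur except possibly the top pair n, n+1. *)

From Stdlib Require Import Relations ZArith.
Require Import Defs.
From mathcomp Require Import all_boot zify.
From mathcomp Require Import boolp classical_sets.

Set Implicit Arguments.
Unset Strict Implicit.
Unset Printing Implicit Defensive.

Local Open Scope classical_set_scope.

(** * Words and the exchange property *)

(** What shapes the argument is the double bond. Irreducibility does not forbid the front pairs s_n
    s_{n+1} and s_{n+1} s_n; it only guarantees that the second letter can be prepended without
    losing full commutativity. So where a reducible pair closes a case elsewhere in the diagram, at
    the top the word [n :: a] or [n.+1 :: a] is formed and a braid of length four is found in it.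

    Zigzags must be split off before any alternation can be proved: at a turn, two consecutive
    letters i < n enclose two letters i+1 and nothing below, or lower neighbours and nothing above.
    The remaining case is symmetric because the reverse of a zigzag starts like a zigzag again:
    excluding the two patterns of first occurrences in a word excludes them in its reverse, and left
    and right irreducibility can be used alike.

    The presentation shows only that the order of st divides m. That it equals m is not formal, and
    the uniqueness of reduced words up to commutation depends on it.

    For the converse inclusion the words are explicit, and the question is which pairs can reach the
    front and what happens when a letter is prepended. *)

Section SeqAux.
Variable T : eqType.
Implicit Types (a x y p : seq T) (c : T).

Lemma split_first c a : c \in a -> exists x y, a = x ++ c :: y /\ c \notin x.
Proof.
elim: a => // u a IH; rewrite inE; have [-> _|cu /= /IH] := eqVneq c u.
  by exists [::], a.
by move=> [x [y [-> cx]]]; exists (u :: x), y; rewrite inE negb_or cu.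
Qed.

Lemma split_last c a : c \in a -> exists x y, a = x ++ c :: y /\ c \notin y.
Proof.
rewrite -mem_rev => /split_first[x [y [ea cx]]].
exists (rev y), (rev x); rewrite mem_rev; split=> //.
by rewrite -[LHS]revK ea rev_cat rev_cons cat_rcons.
Qed.

Lemma split_two c a : 1 < count_mem c a ->
  exists x p y, [/\ a = x ++ c :: p ++ c :: y, c \notin x & c \notin p].
Proof.
move=> c2; have /split_first[x [y [ea cx]]] : c \in a by rewrite -has_pred1 has_count; lia.
have /split_first[p [z [ey cp]]] : c \in y.
  rewrite -has_pred1 has_count; move: c2; rewrite ea count_cat /= eqxx.
  by rewrite (count_memPn cx); lia.
by exists x, p, z; rewrite ea ey.
Qed.

(** Translates between the two ways of saying that c comes first: factorisations of the word and
    comparisons of [index]. *)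
Lemma mem_prefix a x c d y : a = x ++ d :: y -> d \notin x ->
  (c \in x) = (index c a < index d a).
Proof.
move=> -> dx; rewrite !index_cat (negPf dx) /= eqxx addn0.
by case: ifP => cx; rewrite ?index_mem ?cx // ltnNge leq_addr.
Qed.

Lemma index_lt_mem a c d : index c a < index d a -> c \in a.
Proof. by move=> cd; rewrite -index_mem; apply: leq_trans cd (index_size _ _). Qed.

Lemma index_mem_lt a c d : c \in a -> d \notin a -> index c a < index d a.
Proof. by move=> ca da; rewrite (memNindex da) index_mem. Qed.

(** In the reversed word [index] sees last occurrences, so the order of two letters is reversed only
    if both occur once. The counts for chains below are used to reach this situation. *)
Lemma index_rev a c d : count_mem c a = 1 -> count_mem d a = 1 ->
  index c a < index d a -> index d (rev a) < index c (rev a).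
Proof.
move=> c1 d1 cd.
have /split_first[x [y [ea dx]]] : d \in a by rewrite -has_pred1 has_count d1.
have cx : c \in x by rewrite (mem_prefix _ ea).
have dc : d != c by apply: contraNneq dx => ->.
have cy : c \notin y.
  apply/count_memPn; move: c1; rewrite ea count_cat /=.
  have := cx; rewrite -has_pred1 has_count; lia.
have er : rev a = rev y ++ d :: rev x by rewrite ea rev_cat rev_cons cat_rcons.
have dy : d \notin y.
  by apply/count_memPn; move: d1; rewrite ea count_cat /= eqxx (count_memPn dx); lia.
rewrite er !index_cat !mem_rev (negPf cy) (negPf dy) /= eqxx.
by rewrite (negPf dc) addn0 addnS ltnS leq_addr.
Qed.

Lemma count1_mem c a : count_mem c a = 1 -> c \in a.
Proof. by rewrite -has_pred1 has_count => ->. Qed.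

End SeqAux.

(** * Parity of reflections, exchange and descents *)

Section Reflections.
Local Open Scope group_scope.
Variables (S : finType) (M : coxmatrix S).
Implicit Types (a b c : seq S) (s t : S).

Local Notation W := (coxgroup M).
Local Notation gen := (cox_gen M).
Local Notation wp := (word_prod M).
Local Notation ell := (@cox_length S M).

Lemma word_prod_cons s a : wp (s :: a) = gen s * wp a.
Proof. by rewrite /word_prod big_cons. Qed.

Lemma word_prod_nil : wp [::] = 1.
Proof. by rewrite /word_prod big_nil. Qed.

Lemma word_prod_cat a b : wp (a ++ b) = wp a * wp b.
Proof. by rewrite /word_prod big_cat. Qed.

Lemma word_prod_rcons a s : wp (rcons a s) = wp a * gen s.
Proof. by rewrite -cats1 word_prod_cat word_prod_cons word_prod_nil mulg1. Qed.

Lemma word_prod_relator s t : (gen s * gen t) ^+ M s t = 1.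
Proof.
have -> : (gen s * gen t) ^+ M s t = wp (flatten (nseq (M s t) [:: s; t])).
  elim: (M s t) => [|k IH]; first by rewrite word_prod_nil.
  by rewrite expgS IH /= !word_prod_cons mulgA.
rewrite -[1]word_prod_nil !word_prod_pi; apply/cox_piP.
apply: rst_step; exists [::], [::], s, t.
by rewrite cats0.
Qed.

Lemma gen_sq s : gen s * gen s = 1.
Proof. by have := word_prod_relator s s; rewrite cox_diag expg1. Qed.

Lemma genK s : cancel (mul (gen s)) (mul (gen s)).
Proof. by move=> w; rewrite mulgA gen_sq mul1g. Qed.

Lemma genKr s (w : W) : w * gen s * gen s = w.
Proof. by rewrite -mulgA gen_sq mulg1. Qed.

Lemma genV s : (gen s)^-1 = gen s.
Proof. by apply: mulg1_eq; apply: gen_sq. Qed.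

Lemma ell_word_le a : (ell (wp a) <= size a)%N.
Proof.
rewrite /cox_length; case: ex_minnP => m _ -> //.
by apply/asboolP; exists a.
Qed.

Lemma reduced_exists (w : W) : exists a, reduced_expr w a.
Proof.
rewrite /reduced_expr /cox_length.
by case: ex_minnP => m /asboolP[a sa wa] _; exists a.
Qed.

(* The parity of the number of positions i at which the reflection
   a_1 ... a_i ... a_1 equals r. *)
Fixpoint refl_parity a (r : W) : bool :=
  if a is s :: a' then (r == gen s) (+) refl_parity a' (gen s * r * gen s)
  else false.

(** The cocycle rule: the positions in b see r conjugated by the product of a. *)
Lemma refl_parity_cat a b r :
  refl_parity (a ++ b) r =
  refl_parity a r (+) refl_parity b ((wp a)^-1 * r * wp a).
Proof.
elim: a r => [|s a IH] r /=.
  by rewrite word_prod_nil invg1 mul1g mulg1.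
by rewrite IH addbA word_prod_cons invgM genV !mulgA.
Qed.

Lemma refl_parity_pow s t k r :
  refl_parity (flatten (nseq k [:: s; t])) r =
  \big[addb/false]_(0 <= i < k.*2) (r == (gen s * gen t) ^+ i * gen s).
Proof.
elim: k r => [|k IH] r; first by rewrite big_nil.
rewrite /= IH doubleS big_nat_recl // big_nat_recl // expg0 mul1g expg1.
congr addb; congr addb.
  by apply/eqP/eqP => [<-|->]; rewrite !mulgA ?gen_sq ?genKr ?mul1g.
apply: eq_bigr => i _.
have -> : (gen s * gen t) ^+ i.+2 * gen s =
          gen s * (gen t * ((gen s * gen t) ^+ i * gen s) * gen t) * gen s.
  by rewrite expgS expgSr !mulgA.
apply/eqP/eqP => [<-|->]; rewrite !mulgA ?gen_sq ?mul1g ?genKr ?gen_sq ?mul1g //.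
Qed.

(** The sum has 2m terms, and the terms i and m + i coincide because the m-th power of st is 1; they
    cancel modulo 2. *)
Lemma refl_parity_relator s t r :
  refl_parity (flatten (nseq (M s t) [:: s; t])) r = false.
Proof.
rewrite refl_parity_pow -addnn (@big_cat_nat _ _ _ (M s t)) ?leq_addr //=.
rewrite -{2}[M s t]addn0 addnC big_addn addnK.
under [X in _ (+) X]eq_bigr => i _ do
  rewrite expgnDr word_prod_relator mulg1.
by rewrite addbb.
Qed.

Lemma refl_parity_cong a b r :
  cox_cong M a b -> refl_parity a r = refl_parity b r.
Proof.
elim=> {a b} [a b|//|a b _ ->|a b c _ -> _ ->] //.
move=> [a1 [a2 [s [t [-> ->]]]]].
rewrite !refl_parity_cat refl_parity_relator; congr addb.
have -> : wp (flatten (nseq (M s t) [:: s; t])) = 1.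
  rewrite -(word_prod_relator s t).
  elim: (M s t) => [|k IH]; first by rewrite word_prod_nil.
  by rewrite expgS /= !word_prod_cons IH mulgA.
by rewrite invg1 mulg1 mul1g.
Qed.

Lemma refl_parityE a b r : wp a = wp b -> refl_parity a r = refl_parity b r.
Proof. by rewrite !word_prod_pi => /cox_piP/refl_parity_cong. Qed.

Lemma refl_parity_split a r : refl_parity a r ->
  exists a1 s a2, a = a1 ++ s :: a2 /\ r * wp a1 = wp a1 * gen s.
Proof.
elim: a r => [//|s a IH] r /=; case: eqP => [-> _|_ /= /IH].
  by exists [::], s, a; rewrite word_prod_nil mulg1 mul1g.
move=> [a1 [t [a2 [-> E]]]]; exists (s :: a1), t, a2; split=> //.
by rewrite word_prod_cons -mulgA -E !mulgA gen_sq mul1g.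
Qed.

Lemma ell_gen_le s (w : W) : (ell (gen s * w)%g <= (ell w).+1)%N.
Proof.
have [a [<- <-]] := reduced_exists w.
by rewrite -word_prod_cons; apply: ell_word_le.
Qed.

(** If s is not counted in [a], its parity in [s :: a] is odd. Parity depends only on the group
    element, so a reduced word of the product also meets the reflection s, and deleting that
    position gives a shorter word for [wp a]. *)
Lemma left_descent_parity s a :
  (ell (gen s * wp a)%g <= ell (wp a))%N -> refl_parity a (gen s).
Proof.
apply: contraLR => ps; rewrite -ltnNge.
have [b [wb sb]] := reduced_exists (gen s * wp a).
have := @refl_parityE b (s :: a) (gen s); rewrite wb word_prod_cons => /(_ erefl).
rewrite /= eqxx gen_sq mul1g (negPf ps) => /refl_parity_split[b1 [t [b2 [eb E]]]].
rewrite -sb.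
have -> : wp a = wp (b1 ++ b2).
  rewrite word_prod_cat -[LHS](genK s) -wb eb word_prod_cat word_prod_cons.
  by rewrite !mulgA E genKr.
apply: leq_ltn_trans (ell_word_le _) _.
by rewrite eb !size_cat /= addnS.
Qed.

Lemma exchange s a : (ell (gen s * wp a)%g <= ell (wp a))%N ->
  exists a1 t a2, a = a1 ++ t :: a2 /\ wp (s :: a1) = wp (rcons a1 t).
Proof.
move=> /left_descent_parity/refl_parity_split[a1 [t [a2 [-> E]]]].
by exists a1, t, a2; rewrite word_prod_cons word_prod_rcons E.
Qed.

(** Multiplication by a generator never preserves the length; exchange is used here in place of the
    sign character. *)
Lemma left_descent_le s w : (ell (gen s * w)%g <= ell w)%N -> left_descents w s.
Proof.
have [a [<- sa]] := reduced_exists w.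
move=> /exchange[a1 [t [a2 [ea E]]]]; rewrite /left_descents /=.
have -> : gen s * wp a = wp (a1 ++ a2).
  by rewrite ea !word_prod_cat mulgA -word_prod_cons E word_prod_rcons
     word_prod_cons mulgA genKr.
by apply: leq_ltn_trans (ell_word_le _) _; rewrite -sa ea !size_cat /= addnS.
Qed.

Lemma left_descent_reduced s w : left_descents w s ->
  exists2 b, reduced_expr (gen s * w) b & reduced_expr w (s :: b).
Proof.
move=> ds; have [b [wb sb]] := reduced_exists (gen s * w).
exists b => //; split; first by rewrite word_prod_cons wb genK.
apply/eqP; rewrite eqn_leq /= sb ds /=.
by have := ell_gen_le s (gen s * w); rewrite genK.
Qed.

Lemma reduced_left_descent s b w : reduced_expr w (s :: b) ->
  left_descents w s /\ reduced_expr (gen s * w) b.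
Proof.
move=> [<- sb]; rewrite word_prod_cons genK.
have lb : (ell (wp b) < ell (gen s * wp b)%g)%N.
  by rewrite -word_prod_cons -sb /= ltnS ell_word_le.
split; first by rewrite /left_descents /= genK.
split=> //; apply/eqP; rewrite eqn_leq ell_word_le andbT -ltnS.
by rewrite -[X in (X <= _)%N]/(size (s :: b)) sb word_prod_cons ell_gen_le.
Qed.

Fixpoint alt s t k : seq S := if k is k'.+1 then s :: alt t s k' else [::].

Lemma size_alt s t k : size (alt s t k) = k.
Proof. by elim: k s t => //= k IH s t; rewrite IH. Qed.

Lemma alt_take s t k j : (j <= k)%N -> take j (alt s t k) = alt s t j.
Proof. by elim: j k s t => [|j IH] [|k] s t //= jk; rewrite IH. Qed.

Lemma alt_relation s t : wp (alt s t (M s t)) = wp (alt t s (M s t)).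
Proof.
(* For every k the quotient of the two alternating words of length k is the k-th power of st; the
   relation enters only at k = m. *)
have E : wp (alt s t (M s t)) * (wp (alt t s (M s t)))^-1 = 1.
  rewrite -(word_prod_relator s t); move: (M s t) => k.
  elim: k s t => [|k IH] s t; first by rewrite /= word_prod_nil mulgV.
  rewrite /= !word_prod_cons invgM genV mulgA -(mulgA (gen s)) IH.
  elim: k {IH} => [|k IH]; first by rewrite mulg1.
  by rewrite expgSr [RHS]expgSr -IH !mulgA.
by rewrite -[LHS]mulg1 -[1](mulVg (wp (alt t s (M s t)))) mulgA E mul1g.
Qed.

End Reflections.

(** * Commutation classes *)

Section CommutationClasses.
Variables (S : finType) (M : coxmatrix S).
Implicit Types (a b c x y z : seq S) (s t u v : S).

Local Notation W := (coxgroup M).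
Local Notation gen := (cox_gen M).
Local Notation wp := (word_prod M).
Local Notation ell := (@cox_length S M).

Definition ceq := clos_refl_trans _ (comm_step M).

Definition commutes s x : bool := all (fun u => M u s == 2) x.

Definition proj s t a : seq S := [seq u <- a | pred2 s t u].

Lemma proj_cat s t a b : proj s t (a ++ b) = proj s t a ++ proj s t b.
Proof. exact: filter_cat. Qed.

Lemma ceq_refl a : ceq a a. Proof. exact: rt_refl. Qed.

Lemma ceq_trans b a c : ceq a b -> ceq b c -> ceq a c.
Proof. exact: rt_trans. Qed.

Lemma ceq_sym a b : ceq a b -> ceq b a.
Proof.
elim=> {a b} [a b [a1 [a2 [s [t [st -> ->]]]]]|//|a b c _ ba _ cb].
- by apply: rt_step; exists a1, a2, t, s; rewrite cox_sym.
- exact: rt_refl.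
- exact: ceq_trans cb ba.
Qed.

Lemma ceq_cat x y a b : ceq a b -> ceq (x ++ a ++ y) (x ++ b ++ y).
Proof.
elim=> {a b} [a b [a1 [a2 [s [t [st -> ->]]]]]|a|a b c _ ab _ bc].
- apply: rt_step; exists (x ++ a1), (a2 ++ y), s, t.
  by rewrite -!catA.
- exact: rt_refl.
- exact: ceq_trans ab bc.
Qed.

Lemma ceq_cons s a b : ceq a b -> ceq (s :: a) (s :: b).
Proof. by move=> /(ceq_cat [:: s] [::]); rewrite !cats0. Qed.

Lemma ceq_catl x a b : ceq a b -> ceq (x ++ a) (x ++ b).
Proof. by move=> /(ceq_cat x [::]); rewrite !cats0. Qed.

Lemma ceq_move s x y : commutes s x -> ceq (x ++ s :: y) (s :: x ++ y).
Proof.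
elim: x => [|u x IH] /=; first by move=> _; apply: ceq_refl.
move=> /andP[/eqP us /IH/(ceq_cons u) E]; apply: ceq_trans E _.
by apply: rt_step; exists [::], (x ++ y), u, s.
Qed.

Lemma ceq_wp a b : ceq a b -> wp a = wp b.
Proof.
elim=> {a b} // [a b [a1 [a2 [s [t [st -> ->]]]]]|a b c _ -> _ ->//].
rewrite !word_prod_cat; congr (_ * (_ * _))%g.
by have := alt_relation M s t; rewrite st.
Qed.

Lemma ceq_proj s t a b : M s t != 2 -> ceq a b -> proj s t a = proj s t b.
Proof.
move=> st; elim=> {a b} // [a b [a1 [a2 [u [v [uv -> ->]]]]]|a b c _ -> _ ->//].
rewrite !proj_cat; congr (_ ++ (_ ++ _)) => /=.
have [/orP[]/eqP eu|_] := boolP ((u == s) || (u == t));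
  have [/orP[]/eqP ev|_] := boolP ((v == s) || (v == t)) => //; subst.
- by rewrite cox_diag in uv.
- by rewrite uv in st.
- by rewrite cox_sym uv in st.
- by rewrite cox_diag in uv.
Qed.

Lemma ceq_perm a b : ceq a b -> perm_eq a b.
Proof.
move=> ab; apply/allP => s _ /=; apply/eqP.
have := @ceq_proj s s a b; rewrite cox_diag => /(_ isT ab)/(congr1 size).
rewrite !size_filter => E.
have pE : pred2 s s =1 pred1 s by move=> u /=; rewrite orbb.
by rewrite -!(eq_count pE).
Qed.

Lemma ceq_size a b : ceq a b -> size a = size b.
Proof. by move=> /ceq_perm/perm_size. Qed.

Lemma ceq_mem a b : ceq a b -> a =i b.
Proof. by move=> /ceq_perm/perm_mem. Qed.

(** A letter before the first s that does not commute with s would come first in the projection onto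
    the two letters. *)
Lemma proj_head s a b :
  (forall t, M s t != 2 -> proj s t (s :: a) = proj s t b) ->
  exists x y, [/\ b = x ++ s :: y, s \notin x & commutes s x].
Proof.
move=> H; have sb : s \in b.
  have : s \in proj s s b by rewrite -H ?cox_diag // /proj /= eqxx inE eqxx.
  by rewrite mem_filter => /andP[].
have [x [y [eb sx]]] := split_first sb; exists x, y; split=> //.
apply/allP => t tx; apply/negPn/negP => ts.
have := H t; rewrite cox_sym => /(_ ts); rewrite eb proj_cat /= eqxx /=.
have : {subset proj s t x <= [:: t]}.
  move=> u; rewrite mem_filter => /andP[/orP[/eqP ->|/eqP ->]]; rewrite ?inE //.
  by rewrite (negPf sx).
have : t \in proj s t x by rewrite mem_filter tx /= eqxx orbT.
case: (proj s t x) => // u r _ /(_ u (mem_head _ _)).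
rewrite inE => /eqP-> [est].
by move: sx; rewrite est tx.
Qed.

(** The projection criterion for partially commutative monoids; the diagonal pairs s = t carry the
    multiplicities. It makes cancellation and reversal of commutation classes immediate. *)
Lemma proj_ceq a b :
  (forall s t, M s t != 2 -> proj s t a = proj s t b) -> ceq a b.
Proof.
elim: a b => [|s a IH] b H.
  case: b H => [|s b] /=; first by move=> _; apply: rt_refl.
  by move=> /(_ s s); rewrite cox_diag /= eqxx => /(_ isT).
have [x [y [eb sx cx]]] := proj_head (H s).
rewrite eb; apply: ceq_trans (ceq_sym (ceq_move _ cx)); apply: ceq_cons.
apply: IH => u v uv; move: (H u v uv).
by rewrite eb (ceq_proj uv (ceq_move y cx)) /=; case: ifP => // _ [].
Qed.

Lemma ceqP a b :
  ceq a b <-> forall s t, M s t != 2 -> proj s t a = proj s t b.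
Proof.
by split=> [ab s t st|]; [apply: ceq_proj | apply: proj_ceq].
Qed.

Lemma ceq_cat2l x a b : ceq (x ++ a) (x ++ b) -> ceq a b.
Proof.
move=> /ceqP H; apply/ceqP => s t /H; rewrite !proj_cat => /eqP.
by rewrite eqseq_cat // eqxx => /eqP.
Qed.

Lemma ceq_rev a b : ceq (rev a) (rev b) <-> ceq a b.
Proof.
suff R a' b' : ceq a' b' -> ceq (rev a') (rev b').
  by split=> /R //; rewrite !revK.
by move=> /ceqP H; apply/ceqP => s t /H; rewrite /proj !filter_rev => ->.
Qed.

Lemma ceq_head s a b : ceq (s :: a) b -> exists x y,
  [/\ b = x ++ s :: y, s \notin x, commutes s x & ceq a (x ++ y)].
Proof.
move=> ab; have /proj_head[x [y [eb sx cx]]] :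
    forall t, M s t != 2 -> proj s t (s :: a) = proj s t b.
  by move=> t st; apply: ceq_proj.
exists x, y; split=> //; apply: (@ceq_cat2l [:: s]).
by apply: (ceq_trans ab); rewrite eb; apply: ceq_move.
Qed.

(* Stembridge's local criterion for full commutativity. *)
Definition fc_word a : Prop :=
  (forall x s y, ~ ceq a (x ++ [:: s; s] ++ y)) /\
  (forall x s t y, (3 <= M s t)%N -> ~ ceq a (x ++ alt s t (M s t) ++ y)).

Lemma fc_word_ceq a b : ceq a b -> fc_word a -> fc_word b.
Proof.
move=> ab [sq br]; split=> [x s y|x s t y st] bE.
  exact: (sq x s y (ceq_trans ab bE)).
exact: (br x s t y st (ceq_trans ab bE)).
Qed.

Lemma fc_word_behead s a : fc_word (s :: a) -> fc_word a.
Proof.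
move=> [sq br]; split=> [x u y|x u t y st] /(ceq_cons s) E.
  exact: (sq (s :: x) u y).
exact: (br (s :: x) u t y).
Qed.

Lemma rev_alt s t k :
  rev (alt s t k) = if odd k then alt s t k else alt t s k.
Proof.
have alt_rcons : forall k s t,
    alt s t k.+1 = rcons (alt s t k) (if odd k then t else s).
  elim=> // {}k IH {}s {}t.
  by rewrite -[LHS]/(s :: alt t s k.+1) IH /= if_neg.
elim: k s t => // k IH s t.
rewrite -[rev _]/(rev (s :: alt t s k)) rev_cons IH oddS if_neg.
by case ok: (odd k); rewrite alt_rcons ok.
Qed.

Lemma fc_word_rev a : fc_word (rev a) <-> fc_word a.
Proof.
suff R b : fc_word b -> fc_word (rev b) by split=> /R //; rewrite revK.
move=> [sq br]; split=> [x u y|x s t y st] /ceq_rev; rewrite revK !rev_cat.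
  by rewrite -catA; apply: sq.
rewrite rev_alt -catA; case: ifP => _; first exact: br.
by rewrite cox_sym; apply: br; rewrite cox_sym.
Qed.

(** A repeated letter would shorten a reduced word, and a braid factor would give a second reduced
    word with another projection onto s and t. *)
Lemma full_comm_fc_word (w : W) a :
  fully_commutative w -> reduced_expr w a -> fc_word a.
Proof.
move=> fcw [wa sa]; split=> [x s y|x s t y st] E.
  have := ell_word_le M (x ++ y); rewrite -(_ : w = wp (x ++ y)).
    by rewrite -sa (ceq_size E) !size_cat /= !addnS -addSn; lia.
  by rewrite -wa (ceq_wp E) /= !word_prod_cat !word_prod_cons genK.
have r1 : reduced_expr w (x ++ alt s t (M s t) ++ y).
  by rewrite /reduced_expr -(ceq_wp E) -(ceq_size E).
have r2 : reduced_expr w (x ++ alt t s (M s t) ++ y).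
  case: r1 => e1 e2; rewrite /reduced_expr -{}e2 -{}e1.
  by rewrite !word_prod_cat alt_relation !size_cat !size_alt.
have st2 : M s t != 2 by case: eqP st => // ->.
have nst : s <> t by move=> est; rewrite est cox_diag in st.
have := ceq_proj st2 (fcw _ _ r1 r2).
rewrite !proj_cat; case: (M s t) st => // k _ /=; rewrite !eqxx orbT /=.
by move=> /eqP; rewrite eqseq_cat // eqxx andTb eqseq_cons => /andP[/eqP/nst].
Qed.

(** * Words without repeated letters and braids are reduced *)

Section Criterion.

(** Says that st has order exactly m. This depends on a representation, so it is assumed for a
    general Coxeter matrix and proved for the matrix at hand. *)
Hypothesis alt_neq : forall s t j, s != t -> (0 < j < M s t)%N ->
  wp (alt s t j) <> wp (alt t s j).

(** The alternating prefix grows by exchanging the other descent into the word. The letter that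
    exchange deletes cannot lie inside the prefix, since two alternating words of equal length below
    m would then have the same product. *)
Lemma dihedral_prefix s t (w : W) : s != t ->
  left_descents w s -> left_descents w t ->
  exists y, reduced_expr w (alt s t (M s t) ++ y).
Proof.
move=> st ds dt.
suff H k : (0 < k <= M s t)%N -> exists s' t' y,
    [/\ pred2 s t s', pred2 s t t', s' != t' & reduced_expr w (alt s' t' k ++ y)].
  have m0 : (0 < M s t)%N by apply: ltnW; apply: cox_offdiag.
  have [|s' [t' [y [/orP[]/eqP-> /orP[]/eqP-> ]]]] := H (M s t);
    rewrite ?eqxx // ?m0 ?leqnn // => _ r; exists y => //.
  case: r => e1 e2; rewrite /reduced_expr -{}e2 -{}e1.
  by rewrite !word_prod_cat alt_relation !size_cat !size_alt.
elim: k => // -[|k] IH km.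
  have [b _ wb] := left_descent_reduced ds.
  by exists s, t, b; rewrite /= !eqxx orbT st.
have [|s' [t' [y [hs ht st' [wr sr]]]]] := IH; first exact: ltnW.
have eM : M s' t' = M s t.
  by move: hs ht st' => /= /orP[]/eqP-> /orP[]/eqP->; rewrite ?eqxx // cox_sym.
have dt' : left_descents w t' by move: ht => /= /orP[]/eqP->.
set p := alt s' t' k.+1 in wr sr.
have [|a1 [r [a2 [ea E]]]] := @exchange _ M t' (p ++ y).
  by rewrite wr; apply: ltnW.
have [ka|ka] := ltnP (size a1) k.+1.
  have ej : rcons a1 r = alt s' t' (size a1).+1.
    have := congr1 (take (size a1).+1) ea.
    rewrite takel_cat ?size_alt // alt_take // => ->.
    by rewrite -cat_rcons take_size_cat ?size_rcons.
  have ej1 : a1 = alt s' t' (size a1).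
    have := congr1 (take (size a1)) ej.
    by rewrite alt_take // -cats1 take_size_cat.
  case: (@alt_neq s' t' (size a1).+1 st').
    by rewrite eM; apply: leq_trans km.
  by rewrite -ej -E {1}ej1.
exists t', s', (drop k.+1 a1 ++ a2); split=> //; first by rewrite eq_sym.
have -> : alt t' s' k.+2 ++ drop k.+1 a1 ++ a2 = t' :: a1 ++ a2.
  rewrite -[alt t' s' k.+2]/(t' :: p) cat_cons catA; congr (_ :: (_ ++ _)).
  have := congr1 (take k.+1) ea; rewrite takel_cat ?size_alt // alt_take //.
  by rewrite takel_cat // -/p => ->; rewrite cat_take_drop.
split; last by rewrite -sr ea /= !size_cat addnS.
by rewrite -wr ea -cat_cons -cat_rcons !word_prod_cat E.
Qed.

(** Two different first letters s and t are both descents, so the class starts with the whole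
    alternating word of length m; braids being excluded, m = 2 and the letters can be swapped.
    Reducedness and uniqueness need each other, hence one induction. *)
Lemma fc_word_reduced a : fc_word a ->
  reduced_expr (wp a) a /\ forall b, reduced_expr (wp a) b -> ceq a b.
Proof.
have [k] := ubnP (size a); elim: k a => // k IH [|s a] ak fca.
  have l0 : ell (wp [::]) = 0.
    by apply/eqP; rewrite -leqn0; apply: (ell_word_le M [::]).
  split=> // b [_]; rewrite l0 => /size0nil ->; exact: ceq_refl.
have fca' := fc_word_behead fca.
have [ra ua] := IH a ak fca'.
have rsa : reduced_expr (wp (s :: a)) (s :: a).
  split=> //; apply/eqP; rewrite eqn_leq ell_word_le andbT /= ltnNge.
  apply/negP; rewrite ra.2 word_prod_cons.
  move=> /left_descent_le/left_descent_reduced[b _ /ua/(ceq_cons s)].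
  by case: fca => sq _ /(sq [::]).
split=> // -[|t b] rb.
  by move: rb.2; rewrite -rsa.2.
have [st|st] := eqVneq s t.
  subst t; apply: ceq_cons; apply: ua.
  by have [_] := reduced_left_descent rb; rewrite word_prod_cons genK.
have [ds _] := reduced_left_descent rsa.
have [dt rb'] := reduced_left_descent rb.
have [y ry] := dihedral_prefix st ds dt.
have ay : ceq (s :: a) (alt s t (M s t) ++ y).
  have := cox_offdiag M st; case: (M s t) ry => // m /= ry _.
  have [_] := reduced_left_descent ry; rewrite word_prod_cons genK => r.
  by apply: ceq_cons; apply: ua.
have [m3|m2] := ltnP 2 (M s t).
  by case: fca => _ br; case: (br [::] s t y m3).
have {m2} m2 : M s t = 2.
  by apply/eqP; rewrite eqn_leq m2 cox_offdiag.
rewrite m2 /= in ay ry.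
have aty : ceq (s :: a) (t :: s :: y).
  by apply: ceq_trans ay _; apply: (@ceq_move t [:: s] y); rewrite /= m2.
have fcy := fc_word_ceq aty fca.
have sy : (size (s :: y) < k)%N by rewrite -ltnS; move: ak (ceq_size aty) => /= + <-.
apply: (ceq_trans aty); apply: ceq_cons.
have [_] := IH (s :: y) sy (fc_word_behead fcy).
apply; have -> : wp (s :: y) = (gen t * wp (s :: a))%g; last exact: rb'.
by rewrite (ceq_wp aty) (word_prod_cons _ t) genK.
Qed.

Lemma fc_word_full_comm a : fc_word a -> fully_commutative (wp a).
Proof.
move=> /fc_word_reduced[_ H] b c /H ab /H ac.
exact: ceq_trans (ceq_sym ab) ac.
Qed.

End Criterion.

End CommutationClasses.

(** * The Cartan representation *)

Section CartanAction.
Variable n : nat.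
Local Notation I := 'I_n.+2.
Implicit Types (s t j : I) (f g : I -> Z).

(* An integral Cartan matrix; its representation on 'I_n.+2 -> Z separates the two
   alternating words in s and t of a common length less than m_{s,t}. *)
Definition cartan s t : Z :=
  if Btilde_entry s t is k.+2 then
    if k is k'.+1 then
      if k' is 0 then (-1)%Z else if s == n :> nat then (-2)%Z else (-1)%Z
    else 0%Z
  else 2%Z.

Lemma cartan_diag s : cartan s s = 2%Z.
Proof. by rewrite /cartan Btilde_diag. Qed.

Variant cartan_spec s t : nat -> Z -> Z -> Prop :=
| CartanDiag of s = t : cartan_spec s t 1 2 2
| Cartan2 of s != t : cartan_spec s t 2 0 0
| Cartan3 of s != t : cartan_spec s t 3 (-1) (-1)
| Cartan4l of s != t : cartan_spec s t 4 (-2) (-1)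
| Cartan4r of s != t : cartan_spec s t 4 (-1) (-2).

Lemma cartanP s t : cartan_spec s t (Btilde_entry s t) (cartan s t) (cartan t s).
Proof.
rewrite /cartan [Btilde_entry t s]Btilde_sym.
have [<-|st] := eqVneq s t; first by rewrite Btilde_diag; constructor.
rewrite /Btilde_entry (negPf st); case: ifP => _; first by constructor.
case: ifP => [/orP[]/andP[/eqP -> /eqP ->]|_]; last by constructor.
all: rewrite eqxx (_ : n.+1 == n = false); last lia.
all: by constructor.
Qed.

(** The simple reflection s in fundamental weight coordinates. *)
Definition cartan_act s f : I -> Z := fun j => (f j - cartan s j * f s)%Z.

Lemma cartan_act_relator s t f :
  foldr cartan_act f (flatten (nseq (Btilde_mx n s t) [:: s; t])) = f.
Proof.
apply/funext => j /=; rewrite /Btilde_mx /=.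
have := cartanP s t; move: (cartan_diag s) (cartan_diag t).
move Ep: (cartan s t) => p; move Eq: (cartan t s) => q.
move=> Es Et sp; case: sp Ep Eq => [<-|_|_|_|_]; rewrite /= /cartan_act.
  by rewrite Es => _ _; ring.
all: rewrite Es Et => -> ->; ring.
Qed.

Definition cartan_rep (a : seq I) f := foldr cartan_act f a.

Lemma cartan_rep_cong a b f :
  cox_cong (Btilde_mx n) a b -> cartan_rep a f = cartan_rep b f.
Proof.
rewrite /cartan_rep.
elim=> {a b} [a b|//|a b _ ->|a b c _ -> _ ->] //.
move=> [a1 [a2 [s [t [-> ->]]]]].
by rewrite !foldr_cat cartan_act_relator.
Qed.

Lemma Btilde_alt_neq s t k : s != t -> (0 < k < Btilde_mx n s t)%N ->
  word_prod (Btilde_mx n) (alt s t k) <> word_prod (Btilde_mx n) (alt t s k).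
Proof.
move=> st kM; rewrite !word_prod_pi => /cox_piP/cartan_rep_cong E.
have ts : t != s by rewrite eq_sym.
(* This vector is fixed by t and moved by s; its images under the two words already differ at s or
   at t. *)
pose f j : Z := if j == s then 1%Z else 0%Z.
have := congr1 (fun g => (g s, g t)) (E f).
have fs : f s = 1%Z by rewrite /f eqxx.
have ft : f t = 0%Z by rewrite /f (negPf ts).
move: kM => /=; have := cartanP s t; move: (cartan_diag s) (cartan_diag t).
move Ep: (cartan s t) => p; move Eq: (cartan t s) => q.
move=> Es Et sp; case: sp st Ep Eq => [->|||| ]; rewrite ?eqxx // => _ _ Ep Eq.
all: case: k {E} => [|[|[|[|k]]]] //= _.
all: rewrite /cartan_act ?Es ?Et ?Ep ?Eq ?fs ?ft; case; lia.
Qed.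

End CartanAction.

(** * Local constraints on words *)

Ltac cat_norm := repeat first
  [rewrite cat_cons | rewrite -catA | rewrite cat_rcons | rewrite -cats1 | rewrite cats0].

(* [lia] is slow in contexts with hypotheses about words, which it does not use. *)
Ltac nlia := repeat match goal with
  | H : context [@cat] |- _ => clear H
  | H : context [@in_mem] |- _ => clear H
  | H : context [@has] |- _ => clear H
  | H : forall _, _ |- _ => clear H
  end; simpl; repeat match goal with
  | H : context [Equality.sort] |- _ => progress simpl in H
  end; lia.

Lemma leq_count_in (T : eqType) (P Q : pred T) (s : seq T) :
  {in s, forall u, P u -> Q u} -> count P s <= count Q s.
Proof.
elim: s => //= u s IH H; apply: leq_add; last first.
  by apply: IH => v vs; apply: H; rewrite inE vs orbT.
by case Pu: (P u) => //; rewrite (H u) ?inE ?eqxx.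
Qed.

Section NatWords.
Variable n : nat.
Implicit Types (a b x y p q : seq nat) (c d i j : nat).

(** Non-commutation of distinct letters, double bond included, written out as arithmetic so that
    [lia] decides it. *)
Definition adj i j : bool :=
  [|| (i == 0) && (j == 2), (i == 1) && (j == 2), [&& 2 <= i, i <= n & j == i.+1],
      (j == 0) && (i == 2), (j == 1) && (i == 2) | [&& 2 <= j, j <= n & i == j.+1]].

(** The neighbours on the side of the fork: i-1 for i >= 3, but both 0 and 1 for i = 2. One notion
    thus covers the chain and the fork. *)
Definition lower i j : bool := adj i j && (j < i).

(* The part of full commutativity used below, for the word of indices of the letters:
   two consecutive letters i enclose two neighbours of i, where a single one is enough
   across the double bond, and there is no braid of s_n and s_(n+1). *)
Record fc_local a : Prop := FcLocal {
  fcl_le : {in a, forall i, i <= n.+1};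
  fcl_two : forall i x p q, a = x ++ i :: p ++ i :: q -> i \notin p -> i < n ->
    1 < count (adj i) p;
  fcl_n : forall x p q, a = x ++ n :: p ++ n :: q -> n \notin p ->
    n.+1 \notin p -> 1 < count_mem n.-1 p;
  fcl_n1 : forall x p q, a = x ++ n.+1 :: p ++ n.+1 :: q -> n \in p;
  fcl_br : forall x y1 y2 y3 z,
    a = x ++ n :: y1 ++ n.+1 :: y2 ++ n :: y3 ++ n.+1 :: z ->
    n \notin y1 ++ y2 ++ y3 -> n.+1 \notin y1 ++ y2 ++ y3 ->
    n.-1 \in y1 ++ y2;
  fcl_br' : forall x y1 y2 y3 z,
    a = x ++ n.+1 :: y1 ++ n :: y2 ++ n.+1 :: y3 ++ n :: z ->
    n \notin y1 ++ y2 ++ y3 -> n.+1 \notin y1 ++ y2 ++ y3 ->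
    n.-1 \in y2 ++ y3 }.

(* The part of left irreducibility used below. The inequalities say that s and then t
   can be moved to the front; [index r a = size a] when r does not occur in a. *)
Record li_local a : Prop := LiLocal {
  lil_three : forall s t, adj s t -> (s < n) || (t < n) -> t \in a ->
    index s a < index t a ->
    (forall r, adj s r -> index s a <= index r a) ->
    (forall r, adj t r -> r != s -> index t a <= index r a) -> False;
  lil_n : n.+1 \in a -> index n a < index n.+1 a -> index n a <= index n.-1 a ->
    fc_local (n.+1 :: a);
  lil_n1 : n \in a -> index n.+1 a < index n a -> index n a <= index n.-1 a ->
    fc_local (n :: a) }.

Lemma fc_local_rev a : fc_local a -> fc_local (rev a).
Proof.
have R b x i p q : rev b = x ++ i :: p ++ i :: q ->
    b = rev q ++ i :: rev p ++ i :: rev x.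
  by move=> e; rewrite -[b]revK e !(rev_cat, rev_cons) !cat_rcons -?catA ?cat_rcons.
case=> H1 H2 H3 H4 H5 H6; split.
- by move=> i; rewrite mem_rev; apply: H1.
- move=> i x p q /R e ip ile; rewrite -count_rev; apply: (H2 _ _ _ _ e) => //.
  by rewrite mem_rev.
- move=> x p q /R e np n1p; rewrite -count_rev; apply: (H3 _ _ _ e);
    by rewrite mem_rev.
- by move=> x p q /R/H4; rewrite mem_rev.
- move=> x y1 y2 y3 z e; rewrite !mem_cat !negb_or => E E'.
  have -> : (n.-1 \in y1) || (n.-1 \in y2) = (n.-1 \in rev y2 ++ rev y1).
    by rewrite mem_cat !mem_rev orbC.
  apply: (H6 (rev z) (rev y3) _ _ (rev x)); rewrite ?mem_cat ?mem_rev ?negb_or.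
  + by rewrite -[a]revK e !(rev_cat, rev_cons, cat_rcons, =^~ catA).
  + by case/and3P: E => -> -> ->.
  + by case/and3P: E' => -> -> ->.
- move=> x y1 y2 y3 z e; rewrite !mem_cat !negb_or => E E'.
  have -> : (n.-1 \in y2) || (n.-1 \in y3) = (n.-1 \in rev y3 ++ rev y2).
    by rewrite mem_cat !mem_rev orbC.
  apply: (H5 (rev z) _ _ (rev y1) (rev x)); rewrite ?mem_cat ?mem_rev ?negb_or.
  + by rewrite -[a]revK e !(rev_cat, rev_cons, cat_rcons, =^~ catA).
  + by case/and3P: E => -> -> ->.
  + by case/and3P: E' => -> -> ->.
Qed.

Lemma adjC i j : adj i j = adj j i.
Proof. rewrite /adj; lia. Qed.

Lemma adjE i j : 2 <= i <= n -> adj i j = lower i j || (j == i.+1).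
Proof. rewrite /lower /adj; lia. Qed.

Lemma lowerE i j : 3 <= i <= n.+1 -> lower i j = (j == i.-1).
Proof. rewrite /lower /adj; lia. Qed.

Lemma lower2 j : lower 2 j = (j < 2).
Proof. rewrite /lower /adj; lia. Qed.

Lemma adj0 i j : i < 2 -> adj i j = (j == 2).
Proof. rewrite /adj; lia. Qed.

Lemma count_adj1 i d p : {in p, forall c, adj i c -> c = d} ->
  count (adj i) p <= count_mem d p.
Proof.
elim: p => //= c p IH H; apply: leq_add; last first.
  by apply: IH => e ep; apply: H; rewrite inE ep orbT.
by case ac: (adj i c) => //; rewrite (H c) ?inE ?eqxx.
Qed.

Section Local.
Hypothesis n3 : 3 <= n.
Variable a : seq nat.
Hypothesis fa : fc_local a.

(** Without n-1 the pair n ... n would enclose exactly one n+1, and together with the n+1 in front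
    it would form the braid n+1, n, n+1, n. *)
Lemma fcl_n_split x y p q : a = x ++ n.+1 :: y ++ n :: p ++ n :: q ->
  n \notin y -> n \notin p -> n.-1 \in p.
Proof.
move=> ea ny np; apply/negPn/negP => n1p.
have n1y : n.+1 \notin y.
  apply/negP => /split_first[y1 [y2 [ey _]]].
  have e : a = x ++ n.+1 :: y1 ++ n.+1 :: (y2 ++ n :: p ++ n :: q).
    by rewrite ea ey; cat_norm.
  by have := fcl_n1 fa e; move: ny; rewrite ey mem_cat negb_or => /andP[/negP].
have /split_first[p0 [p1 [ep n1p0]]] : n.+1 \in p.
  apply/negPn/negP => n1p'.
  have e : a = (x ++ n.+1 :: y) ++ n :: p ++ n :: q by rewrite ea; cat_norm.
  by have := fcl_n fa e np n1p'; rewrite (count_memPn n1p).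
have n1p1 : n.+1 \notin p1.
  apply/negP => /split_first[p2 [p3 [ep1 _]]].
  have e : a = (x ++ n.+1 :: y ++ n :: p0) ++ n.+1 :: p2 ++ n.+1 :: (p3 ++ n :: q).
    by rewrite ea ep ep1; cat_norm.
  by have := fcl_n1 fa e; move=> np2; move: np; rewrite ep ep1 !(mem_cat, inE) np2 !orbT.
have e : a = x ++ n.+1 :: y ++ n :: p0 ++ n.+1 :: p1 ++ n :: q.
  by rewrite ea ep; cat_norm.
have := fcl_br' fa e; move: np n1p.
rewrite ep !mem_cat !inE !negb_or (negPf n1y) (negPf n1p0) (negPf n1p1) ny.
move=> /and3P[-> _ ->] /and3P[/negPf-> _ /negPf->] /=.
by move=> /(_ isT isT).
Qed.

(* The pair i ... i must enclose two letters i+1, so the pattern recurs at i+1 and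
   climbs until it produces a braid of s_n and s_(n+1). *)
Lemma fcl_succ_pair x y i p q : 2 <= i <= n -> a = x ++ i.+1 :: y ++ i :: p ++ i :: q ->
  i \notin y -> i \notin p -> ~~ has (lower i) p -> False.
Proof.
move=> /andP[i2]; have [k] := ubnP (n - i).
elim: k i x y p q i2 => // k IH i x y p q i2 ki; rewrite leq_eqVlt.
move=> /orP[/eqP ein|ltn] ea iy ip /hasPn lp.
  subst i; have /lp := fcl_n_split ea iy ip.
  by rewrite lowerE ?eqxx; nlia.
have e : a = (x ++ i.+1 :: y) ++ i :: p ++ i :: q by rewrite ea; cat_norm.
have lt1 : 1 < count_mem i.+1 p.
  apply: leq_trans (fcl_two fa e ip ltn) _.
  apply: count_adj1 => c /lp; rewrite adjE; last by rewrite i2 ltnW.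
  by move=> /negPf-> /= /eqP.
have [p0 [p1 [p2 [ep ip0 ip1]]]] := split_two lt1.
have [x' [y' [ey ny']]] : exists x' y', i.+1 :: y = x' ++ i.+1 :: y' /\ i.+1 \notin y'.
  by apply: split_last; rewrite inE eqxx.
have iy' : i \notin y'.
  have : i \notin i.+1 :: y by rewrite inE negb_or iy andbT; nlia.
  by rewrite ey mem_cat inE !negb_or => /and3P[].
move: ip; rewrite ep !(mem_cat, inE, negb_or) => /and5P[ii0 _ ii1 _ ii2].
(* The gap from the last i+1 before the pair to the first one inside it contains i exactly once, so
   full commutativity forces an i+2 into it. *)
pose w := y' ++ i :: p0.
have iw : i.+1 \notin w by rewrite mem_cat inE (negPf ny') (negPf ip0) /= orbF; nlia.
have e1 : a = (x ++ x') ++ i.+1 :: w ++ i.+1 :: (p1 ++ i.+1 :: p2 ++ i :: q).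
  have e0 : a = x ++ (i.+1 :: y) ++ i :: p ++ i :: q := ea.
  by rewrite e0 ey ep /w; cat_norm.
have /split_first[w1 [w2 [ew _]]] : i.+2 \in w.
  apply/negPn/negP => i2w.
  have ci : count_mem i w = 1.
    by rewrite /w count_cat /= eqxx (count_memPn iy') (count_memPn ii0).
  have [i1n|i1n] : i.+1 < n \/ i.+1 = n by nlia.
    have := fcl_two fa e1 iw i1n; rewrite ltnNge -ci count_adj1 // => c cw.
    rewrite adjE ?lowerE; [|nlia|nlia] => /orP[/eqP//|/eqP cE].
    by rewrite -cE cw in i2w.
  move: e1 iw i2w; rewrite i1n => e1 iw i2w.
  by have := fcl_n fa e1 iw i2w; rewrite -i1n ci.
move: iw; rewrite ew mem_cat inE !negb_or => /and3P[_ _ iw2].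
apply: (IH i.+1 (x ++ x' ++ i.+1 :: w1) w2 p1 (p2 ++ i :: q)) => //; try nlia.
  by rewrite e1 ew; cat_norm.
apply/hasPn => c cp1; rewrite lowerE; last nlia.
by apply: contraNneq ii1 => /= <-.
Qed.

(* Mirror image of [fcl_succ_pair]: the pattern descends to the fork 0, 1, 2. *)
Lemma fcl_lower_pair x y c i p q : 2 <= i <= n -> lower i c ->
  a = x ++ c :: y ++ i :: p ++ i :: q ->
  i \notin y -> i \notin p -> i.+1 \notin p -> False.
Proof.
elim: i c x y p q => // i IH c x y p q ile lc ea iy ip i1p.
have e : a = (x ++ c :: y) ++ i.+1 :: p ++ i.+1 :: q by rewrite ea; cat_norm.
have [i2|i1] : 2 <= i \/ i.+1 = 2 by nlia.
  rewrite lowerE in lc; last nlia.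
  move/eqP: lc => /= ec; subst c.
  have lt1 : 1 < count_mem i p.
    have [i1n|i1n] : i.+1 < n \/ i.+1 = n by nlia.
      apply: leq_trans (fcl_two fa e ip i1n) _.
      apply: count_adj1 => c cp; rewrite adjE ?lowerE; [|nlia|nlia].
      by move=> /orP[/eqP//|/eqP cE]; rewrite -cE cp in i1p.
    move: e ip i1p; rewrite i1n => e ip i1p.
    by have := fcl_n fa e ip i1p; rewrite -i1n.
  have [p0 [p1 [p2 [ep ip0 ip1]]]] := split_two lt1.
  have [x' [y' [ey ny']]] : exists x' y', i :: y = x' ++ i :: y' /\ i \notin y'.
    by apply: split_last; rewrite inE eqxx.
  have iy' : i.+1 \notin y'.
    have : i.+1 \notin i :: y by rewrite inE negb_or iy andbT; nlia.
    by rewrite ey mem_cat inE !negb_or => /and3P[].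
  move: ip; rewrite ep !(mem_cat, inE, negb_or) => /and5P[ii0 _ ii1 _ ii2].
  pose w := y' ++ i.+1 :: p0.
  have iw : i \notin w by rewrite mem_cat inE (negPf ny') (negPf ip0) /= orbF; nlia.
  have e1 : a = (x ++ x') ++ i :: w ++ i :: (p1 ++ i :: p2 ++ i.+1 :: q).
    have e0 : a = x ++ (i :: y) ++ i.+1 :: p ++ i.+1 :: q := ea.
    by rewrite e0 ey ep /w; cat_norm.
  have /hasP[d dw ld] : has (lower i) w.
    apply/negPn/negP => /hasPn lw.
    have ci : count_mem i.+1 w = 1.
      by rewrite /w count_cat /= eqxx (count_memPn iy') (count_memPn ii0).
    have iltn : i < n by nlia.
    have := fcl_two fa e1 iw iltn; rewrite ltnNge -ci count_adj1 // => d /lw.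
    by rewrite adjE; [move=> /negPf-> /= /eqP | nlia].
  have [w1 [w2 [ew _]]] := split_first dw.
  move: iw; rewrite ew mem_cat inE !negb_or => /and3P[_ _ iw2].
  apply: (IH d (x ++ x' ++ i :: w1) w2 p1 (p2 ++ i.+1 :: q)) => //; try nlia.
  by rewrite e1 ew; cat_norm.
have {i1} i1 : i = 1 by nlia.
subst i; rewrite lower2 in lc.
have lt1 : 1 < count (fun d => d < 2) p.
  apply: leq_trans (fcl_two fa e ip _) _; first nlia.
  apply: leq_count_in => d dp; rewrite adjE ?lower2; last nlia.
  by move=> /orP[//|/eqP dE]; rewrite -dE dp in i1p.
(* If c were missing, 1 - c would occur twice in p without a 2 in between. *)
have cp : c \in p.
  apply/negPn/negP => cp.
  have [d [d2 lt1']] : exists d, d < 2 /\ 1 < count_mem d p.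
    exists (1 - c); split; first nlia.
    apply: leq_trans lt1 _; apply: leq_count_in => d dp /= d2; apply/eqP.
    have : d != c by apply: contraNneq cp => <-.
    by nlia.
  have [p0 [p1 [p2 [ep _ dp1]]]] := split_two lt1'.
  have e1 : a = (x ++ c :: y ++ 2 :: p0) ++ d :: p1 ++ d :: (p2 ++ 2 :: q).
    by rewrite ea ep; cat_norm.
  have dn : d < n by nlia.
  have := fcl_two fa e1 dp1 dn; rewrite ltnNge (leq_trans (@count_adj1 _ 2 _ _)) //.
    by move=> r _; rewrite adj0 // => /eqP.
  by move: ip; rewrite ep !(mem_cat, inE, negb_or) => /and5P[_ _ /count_memPn-> _ _].
(* From the last c before the pair to the first c inside it there is a single 2, while two are
   required. *)
have [p0 [p1 [ep cp0]]] := split_first cp.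
have [x' [y' [ey ny']]] : exists x' y', c :: y = x' ++ c :: y' /\ c \notin y'.
  by apply: split_last; rewrite inE eqxx.
have e1 : a = (x ++ x') ++ c :: (y' ++ 2 :: p0) ++ c :: (p1 ++ 2 :: q).
  have e0 : a = x ++ (c :: y) ++ 2 :: p ++ 2 :: q := ea.
  by rewrite e0 ey ep; cat_norm.
have cn : c < n by nlia.
have := fcl_two fa e1 _ cn; rewrite mem_cat inE (negPf ny') (negPf cp0) orbF /=.
rewrite ltnNge (leq_trans (@count_adj1 _ 2 _ _)) //; first by move=> /(_ _)/implyP; lia.
  by move=> r _; rewrite adj0 // => /eqP.
have y2 : 2 \notin y'.
  have : 2 \notin c :: y by rewrite inE negb_or iy andbT; nlia.
  by rewrite ey mem_cat inE !negb_or => /and3P[].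
move: ip; rewrite ep mem_cat negb_or => /andP[p02 _].
by rewrite count_cat /= (count_memPn y2) (count_memPn p02).
Qed.

End Local.
End NatWords.

(** * Chains of first occurrences *)

Section Chains.
Variable n : nat.
Implicit Types (a b x y p q : seq nat) (c d i j : nat).

Lemma lower_lt i c : lower n i c -> c < i.
Proof. by case/andP. Qed.

Lemma lower_adj i c : lower n i c -> adj n i c.
Proof. by case/andP. Qed.

Definition chain_up a j : Prop :=
  [/\ index 0 a < index 2 a, index 1 a < index 2 a
    & forall k, 2 <= k < j -> index k a < index k.+1 a].

Definition chain_down a j : Prop :=
  forall k, j <= k <= n -> index k.+1 a < index k a.

(* These two patterns of first occurrences detect the words that can be brought to
   start like the zigzags, with 0 1 2 3 ... or n+1 n n-1 .... *)
Definition rises a : Prop :=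
  [/\ 2 \in a, index 0 a < index 2 a, index 1 a < index 2 a
    & index 2 a <= index 3 a].

Definition falls a : Prop :=
  [/\ n.-1 \in a, index n.+1 a < index n a & index n a < index n.-1 a].

Lemma chain_upW a j k : k <= j -> chain_up a j -> chain_up a k.
Proof. by move=> kj [c0 c1 ck]; split=> // i ik; apply: ck; lia. Qed.

Lemma chain_downW a j k : j <= k -> chain_down a j -> chain_down a k.
Proof. by move=> kj ck i ik; apply: ck; nlia. Qed.

Lemma chain_up_lower a j c : 2 <= j <= n -> chain_up a j -> lower n j c ->
  index c a < index j a.
Proof.
move=> jle [c0 c1 ck]; have [->|j3] : j = 2 \/ 3 <= j by nlia.
  by rewrite lower2; case: c => [|[|]].
rewrite lowerE; last nlia.
by move=> /eqP->; have := ck j.-1; rewrite prednK //; [apply; nlia | nlia].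
Qed.

Hypothesis n3 : 3 <= n.

Lemma fcl_no_upper a i x p q : fc_local n a -> 2 <= i <= n ->
  a = x ++ i :: p ++ i :: q -> i \notin p -> i.+1 \notin p ->
  1 < count (lower n i) p.
Proof.
move=> fa ile e ip i1p; have [iltn|en] : i < n \/ i = n by nlia.
  apply: leq_trans (fcl_two fa e ip iltn) _; apply: leq_count_in => c cp.
  by rewrite adjE // => /orP[//|/eqP cE]; rewrite -cE cp in i1p.
subst i; apply: leq_trans (fcl_n fa e ip i1p) _; apply: leq_count_in => c cp /= /eqP ->.
by rewrite lowerE ?eqxx //; nlia.
Qed.

(** The restriction i < n reflects the double bond: between two letters n a single n+1 is enough. *)
Lemma fcl_no_lower a i x p q : fc_local n a -> 2 <= i <= n ->
  a = x ++ i :: p ++ i :: q -> i \notin p -> ~~ has (lower n i) p ->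
  i.+1 \in p /\ (i < n -> 1 < count_mem i.+1 p).
Proof.
move=> fa ile e ip /hasPn lp.
have i1p : i.+1 \in p.
  apply/negPn/negP => i1p; have := fcl_no_upper fa ile e ip i1p.
  by rewrite (@eq_in_count _ _ pred0) ?count_pred0 // => c /lp/negPf.
split=> // iltn; apply: leq_trans (fcl_two fa e ip iltn) _.
apply: count_adj1 => c /lp; rewrite adjE //.
by move=> /negPf-> /= /eqP.
Qed.

(** If i-2 did not precede i-1, the letters i-1 and i could be moved to the front as a reducible
    pair; so the chain continues down to the fork. There both 0 and 1 must precede 2: if exactly one
    does, it forms a reducible pair with 2, and if none does, 2 and 3 form one. *)
Lemma chain_up_first a i : li_local n a -> 3 <= i <= n -> i \in a ->
  index i.-1 a < index i a -> index i a <= index i.+1 a -> chain_up a i /\ rises a.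
Proof.
move=> la; case: i => // i; elim: i => // i IH ile ia /= ilt ige.
have [i3|i2] : 3 <= i.+1 \/ i = 1 by nlia.
  have i1a := index_lt_mem ilt.
  have [li|li] := ltnP (index i a) (index i.+1 a).
    have [|||//|[c0 c1 ck] ri] := IH; rewrite //=; try nlia.
    split=> //; split=> // k kle.
    have [->|klt] : k = i.+1 \/ k < i.+1 by nlia.
      by [].
    by apply: ck; nlia.
  case: (lil_three la (s := i.+1) (t := i.+2)) => //; try (rewrite /adj; nlia).
    move=> r; rewrite adjE ?lowerE; [|nlia|nlia] => /orP[/eqP-> //|/eqP->].
    exact: ltnW.
  move=> r; rewrite adjE ?lowerE; [|nlia|nlia] => /orP[/eqP-> /eqP//|/eqP-> //].
subst i; have adj2 r : adj n 2 r -> [\/ r = 0, r = 1 | r = 3].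
  rewrite adjE; last nlia.
  rewrite lower2; case: r => [|[|r]] /=; [by constructor 1|by constructor 2|].
  by move=> /eqP ->; constructor 3.
have adj01 c r : c < 2 -> adj n c r -> r = 2 by move=> c2; rewrite adj0 // => /eqP.
have a2 := index_lt_mem ilt.
suff [c0 c1] : index 0 a < index 2 a /\ index 1 a < index 2 a.
  by split; split=> //; [move=> k kle; have -> : k = 2 by nlia | apply: ltnW].
have [l0|g0] := ltnP (index 0 a) (index 2 a);
  have [l1|g1] := ltnP (index 1 a) (index 2 a) => //; exfalso.
- apply: (lil_three la (s := 0) (t := 2)) => //; try (rewrite /adj; nlia).
    by move=> r /(adj01 0 _ isT)->; apply: ltnW.
  by move=> r /adj2[]-> //; rewrite ltnW.
- apply: (lil_three la (s := 1) (t := 2)) => //; try (rewrite /adj; nlia).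
    by move=> r /(adj01 1 _ isT)->; apply: ltnW.
  by move=> r /adj2[]-> //; rewrite ltnW.
- apply: (lil_three la (s := 2) (t := 3)) => //; try (rewrite /adj; nlia).
    by move=> r /adj2[]-> //; rewrite ltnW.
  move=> r; rewrite adjE ?lowerE; [|nlia|nlia] => /orP[/eqP-> /eqP//|/eqP-> //].
Qed.

(** Unless i+2 precedes i+1, the letters i+1, i are a reducible front pair. The same argument then
    applies one step higher, until n+1 is reached. *)
Lemma chain_down_first a i : li_local n a -> 2 <= i < n -> i \in a ->
  index i.+1 a < index i a -> (forall c, lower n i c -> index i a <= index c a) ->
  chain_down a i /\ falls a.
Proof.
move=> la; have [k] := ubnP (n - i); elim: k i => // k IH i ki ile ia ilt ige.
have i1a := index_lt_mem ilt.
have li3 : (forall r, adj n i.+1 r -> index i.+1 a <= index r a) -> False.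
  move=> H; apply: (lil_three la (s := i.+1) (t := i)) => //.
  - by rewrite /adj; nlia.
  - by nlia.
  - move=> r; rewrite adjE; last nlia.
    by move=> /orP[/ige//|/eqP->]; rewrite eqxx.
have [l2|g2] := ltnP (index i.+2 a) (index i.+1 a); last first.
  case: li3 => r; rewrite adjE ?lowerE; [|nlia|nlia].
  by move=> /orP[/eqP->|/eqP->//]; rewrite ltnW.
have [i1n|i1n] : i.+1 < n \/ i.+1 = n by nlia.
  have [||//|//||ck fa] := IH i.+1; try nlia.
    by move=> c; rewrite lowerE; [move=> /eqP->; rewrite ltnW|nlia].
  split=> // j jle; have [->//|jlt] : j = i \/ i < j by nlia.
  by apply: ck; nlia.
split; last by split; rewrite -?i1n.
by move=> j jle; have [->|->] : j = i \/ j = i.+1 by nlia.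
Qed.

(** Consider the letter just below the top of the chain. Between its first two occurrences nothing
    lower occurs, because by induction each lower letter has been used once already; so two copies
    of the top letter would be needed in between, and b contains one. *)
Lemma chain_up_count a j b q c : fc_local n a -> chain_up a j -> 2 <= j <= n ->
  a = b ++ q -> count_mem j b = 1 -> c < j -> count_mem c b = 1.
Proof.
move=> fa; elim: j b q c => // j IH b q c ch jle eb bj cj.
have lowb d : lower n j.+1 d -> 0 < count_mem d b.
  move=> ld; have /split_first[x [y [ebx jx]]] := count1_mem bj.
  have ea : a = x ++ j.+1 :: (y ++ q) by rewrite eb ebx; cat_norm.
  rewrite -has_count has_pred1 ebx mem_cat (mem_prefix _ ea) //.
  by rewrite (chain_up_lower jle ch).
have [j1|j2] : j = 1 \/ 2 <= j by nlia.
  subst j; have {}cj : c < 2 by nlia.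
  apply/eqP; rewrite eqn_leq lowb ?lower2 // andbT leqNgt.
  apply/negP => /split_two[x [p [y [ebx _ cp]]]].
  have ea : a = x ++ c :: p ++ c :: (y ++ q) by rewrite eb ebx; cat_norm.
  have cn : c < n by nlia.
  have := fcl_two fa ea cp cn; rewrite ltnNge (leq_trans (@count_adj1 n c 2 _ _)) //.
  - by move=> r _; rewrite adj0 // => /eqP.
  - by move: bj; rewrite ebx count_cat /= count_cat /=; nlia.
have chj : chain_up a j by apply: chain_upW ch; nlia.
have {j2} jle' : 2 <= j <= n by nlia.
suff bj1 : count_mem j b = 1.
  have [->//|cj'] : c = j \/ c < j by nlia.
  exact: (IH b q).
apply/eqP; rewrite eqn_leq lowb; last by rewrite lowerE; nlia.
rewrite andbT leqNgt; apply/negP => /split_two[x [p [y [ebx jx jp]]]].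
have ea : a = x ++ j :: p ++ j :: (y ++ q) by rewrite eb ebx; cat_norm.
have lp : ~~ has (lower n j) p.
  apply/hasPn => d dp; apply/negP => ld.
  have ea1 : a = (x ++ j :: p) ++ (j :: y ++ q) by rewrite ea; cat_norm.
  have := IH _ _ d chj jle' ea1; rewrite !count_cat /= eqxx.
  rewrite (count_memPn jx) (count_memPn jp) => /(_ erefl (lower_lt ld)).
  have : d \in x by rewrite (mem_prefix _ ea) // chain_up_lower.
  by move: dp; rewrite -!has_pred1 !has_count /=; nlia.
have [_ lt1] := fcl_no_lower fa jle' ea jp lp.
have := lt1 ltac:(nlia).
by move: bj; rewrite ebx count_cat /= count_cat /=; nlia.
Qed.

Lemma chain_down_count a j b q c : fc_local n a -> fc_local n (n :: a) ->
  chain_down a j -> index n a < index n.-1 a -> 2 <= j <= n ->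
  a = b ++ q -> count_mem j b = 1 -> j < c <= n.+1 -> count_mem c b = 1.
Proof.
move=> fa fna + nn1; have [k] := ubnP (n - j).
elim: k j b q c => // k IH j b q c kj ch jle eb bj cj.
have lowb : 0 < count_mem j.+1 b.
  have /split_first[x [y [ebx jx]]] := count1_mem bj.
  have ea : a = x ++ j :: (y ++ q) by rewrite eb ebx; cat_norm.
  rewrite -has_count has_pred1 ebx mem_cat (mem_prefix _ ea) //.
  by rewrite ch //; nlia.
have [jn|jn] : j = n \/ j < n by nlia.
  subst j; have {cj} -> : c = n.+1 by nlia.
  apply/eqP; rewrite eqn_leq lowb andbT leqNgt; apply/negP.
  move=> /split_two[x [p [y [ebx n1x n1p]]]].
  have ea : a = x ++ n.+1 :: p ++ n.+1 :: (y ++ q) by rewrite eb ebx; cat_norm.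
  have [p1 [p2 [ep np1]]] := split_first (fcl_n1 fa ea).
  (* One n between two letters n+1 is legal across the double bond. Prepending n turns it into the
     braid n, n+1, n, n+1, and n-1 has not occurred yet. *)
  have ena : n :: a = [::] ++ n :: x ++ n.+1 :: p1 ++ n :: p2 ++ n.+1 :: (y ++ q).
    by rewrite ea ep; cat_norm.
  have := fcl_br fna ena.
  move: bj n1p; rewrite ebx ep !(count_cat, mem_cat, inE, negb_or) /= !count_cat /= eqxx.
  move=> bj /and3P[n1p1 _ n1p2].
  have nx : n \notin x by apply/count_memPn; nlia.
  have np2 : n \notin p2 by apply/count_memPn; nlia.
  rewrite nx np1 np2 n1x n1p1 n1p2 => /(_ isT isT).
  have ean : a = (x ++ n.+1 :: p1) ++ n :: (p2 ++ n.+1 :: y ++ q).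
    by rewrite ea ep; cat_norm.
  have nw : n \notin x ++ n.+1 :: p1.
    by rewrite mem_cat inE (negPf nx) (negPf np1) orbF /=; nlia.
  have := mem_prefix n.-1 ean nw; rewrite [RHS]ltnNge ltnW //= mem_cat inE.
  by case: (_ \in x) => //=; case: (_ \in p1) => //; rewrite orbT.
have chj : chain_down a j.+1 by apply: chain_downW ch; nlia.
have jle' : 2 <= j.+1 <= n by nlia.
suff bj1 : count_mem j.+1 b = 1.
  have [->//|cj'] : c = j.+1 \/ j.+1 < c <= n.+1 by nlia.
  by apply: (IH j.+1 b q) => //; nlia.
apply/eqP; rewrite eqn_leq lowb andbT leqNgt.
apply/negP => /split_two[x [p [y [ebx jx jp]]]].
have ea : a = x ++ j.+1 :: p ++ j.+1 :: (y ++ q) by rewrite eb ebx; cat_norm.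
have j2p : j.+2 \notin p.
  have ea1 : a = (x ++ j.+1 :: p) ++ (j.+1 :: y ++ q) by rewrite ea; cat_norm.
  have := IH j.+1 _ _ j.+2 ltac:(nlia) chj jle' ea1; rewrite !count_cat /= eqxx.
  rewrite (count_memPn jx) (count_memPn jp) => /(_ erefl ltac:(nlia)).
  have : j.+2 \in x by rewrite (mem_prefix _ ea) // chj //; nlia.
  by rewrite -!has_pred1 !has_count /=; nlia.
have := fcl_no_upper fa jle' ea jp j2p; rewrite ltnNge.
rewrite (@eq_in_count _ _ (pred1 j)); last by move=> r _; rewrite lowerE //; nlia.
by move: bj; rewrite ebx count_cat /= count_cat /=; nlia.
Qed.

End Chains.

(** * Propagation of the two patterns across the diagram *)

Section FullChains.
Variable n : nat.
Hypothesis n3 : 3 <= n.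
Implicit Types (a b x y p q : seq nat) (c d i j : nat).

Lemma chain_up_no_lower a j x p q : fc_local n a -> chain_up a j -> 2 <= j <= n ->
  a = x ++ j :: p ++ j :: q -> j \notin x -> j \notin p -> ~~ has (lower n j) p.
Proof.
move=> fa ch jle ea jx jp; apply/hasPn => d dp; apply/negP => ld.
have ea1 : a = (x ++ j :: p) ++ (j :: q) by rewrite ea; cat_norm.
have := chain_up_count n3 fa ch jle ea1; rewrite !count_cat /= eqxx.
rewrite (count_memPn jx) (count_memPn jp) => /(_ d erefl (lower_lt ld)).
have : d \in x by rewrite (mem_prefix _ ea) // (chain_up_lower jle ch).
by move: dp; rewrite -!has_pred1 !has_count count_cat /=; nlia.
Qed.

Lemma chain_down_no_upper a j x p q : fc_local n a -> fc_local n (n :: a) ->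
  chain_down n a j -> index n a < index n.-1 a -> 2 <= j <= n ->
  a = x ++ j :: p ++ j :: q -> j \notin x -> j \notin p -> j.+1 \notin p.
Proof.
move=> fa fna ch nn1 jle ea jx jp; apply/negP => jp'.
have ea1 : a = (x ++ j :: p) ++ (j :: q) by rewrite ea; cat_norm.
have := chain_down_count n3 fa fna ch nn1 jle ea1; rewrite !count_cat /= eqxx.
rewrite (count_memPn jx) (count_memPn jp) => /(_ j.+1 erefl ltac:(nlia)).
have : j.+1 \in x by rewrite (mem_prefix _ ea) // ch //; nlia.
by move: jp'; rewrite -!has_pred1 !has_count count_cat /=; nlia.
Qed.

Lemma count1P a j : j \in a ->
  (forall x p q, a = x ++ j :: p ++ j :: q -> j \notin x -> j \notin p -> False) ->
  count_mem j a = 1.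
Proof.
move=> ja H; apply/eqP; rewrite eqn_leq -has_count has_pred1 ja andbT leqNgt.
by apply/negP => /split_two[x [p [q [e jx jp]]]]; apply: H e jx jp.
Qed.

Lemma falls_chain_down a : falls n a -> chain_down n a n.-1.
Proof.
move=> [_ f1 f2] k kle; have [->|->] : k = n.-1 \/ k = n by nlia.
  by rewrite prednK //; nlia.
by [].
Qed.

(** The front n+1, n is a pair that irreducibility tolerates; what it gives in return is that n can
    be prepended. *)
Lemma falls_fc_cons a : li_local n a -> falls n a -> fc_local n (n :: a).
Proof.
move=> la [n1a f1 f2]; apply: (lil_n1 la) => //; last exact: ltnW.
exact: index_lt_mem f2.
Qed.

Lemma lower_exists j : 2 <= j <= n -> exists t, lower n j t.
Proof.
move=> jn; have [->|j3] : j = 2 \/ 3 <= j by nlia.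
  by exists 0; rewrite lower2.
by exists j.-1; rewrite lowerE ?eqxx; nlia.
Qed.

Section Word.
Variable a : seq nat.
Hypotheses (fa : fc_local n a) (la : li_local n a) (la' : li_local n (rev a)).

Let fa' : fc_local n (rev a). Proof. exact: fc_local_rev. Qed.

(** Right irreducibility keeps the chain going: if it stopped or met the next letter too early, its
    letters would occur once, and the right end would show a reducible pair or a falling chain that
    contradicts the order on the left. *)
Lemma rises_chain j : rises a -> 2 <= j <= n.+1 ->
  [/\ chain_up a j, j \in a & j <= n -> index j a <= index j.+1 a].
Proof.
move=> [a2 c0 c1 c2]; elim: j => // j IH jle.
have [j1|j2] : j = 1 \/ 2 <= j by nlia.
  by subst j; split=> //; split=> // k; nlia.
have [//|ch ja jj] := IH _; first nlia.
have jn : 2 <= j <= n by nlia.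
have {}jj := jj ltac:(nlia).
(* Two letters j would enclose a j+1. So if j+1 is missing, everything up to j occurs once, and the
   reversed word starts with j and a lower neighbour of it. *)
have ja1 : j.+1 \in a.
  apply/negPn/negP => j1a.
  have cj : count_mem j a = 1.
    apply: count1P => // x p q ea jx jp.
    have [jp' _] := fcl_no_lower n3 fa jn ea jp (chain_up_no_lower fa ch jn ea jx jp).
    by move: j1a; rewrite ea !(mem_cat, inE) jp' !orbT.
  have cc c : c < j -> count_mem c a = 1.
    by apply: (chain_up_count n3 fa ch jn (b := a) (q := [::])); rewrite ?cats0.
  have j1a' : index j (rev a) <= index j.+1 (rev a).
    by rewrite ltnW // index_mem_lt ?mem_rev.
  have lj r : lower n j r -> index j (rev a) < index r (rev a).
    move=> lr; apply: index_rev => //; first exact: cc (lower_lt lr).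
    exact: (chain_up_lower jn ch).
  have [t lt] := lower_exists jn.
  apply: (lil_three la' (s := j) (t := t)).
  - exact: lower_adj.
  - by have := lower_lt lt; nlia.
  - by rewrite mem_rev; apply: count1_mem (cc _ (lower_lt lt)).
  - exact: lj.
  - by move=> r; rewrite adjE // => /orP[/lj/ltnW|/eqP->].
  move=> r; have [t2|t2] : t < 2 \/ 2 <= t by nlia.
    have -> : j = 2.
      move: lt; have [->//|j3] : j = 2 \/ 3 <= j by nlia.
      by rewrite lowerE; nlia.
    by rewrite adj0 // => /eqP->; rewrite eqxx.
  have ej : j = t.+1.
    move: lt; have [->|j3] : j = 2 \/ 3 <= j by nlia.
      by rewrite lower2; nlia.
    by rewrite lowerE; nlia.
  have tn : 2 <= t <= n by nlia.
  rewrite adjE // -ej => /orP[lr _|/eqP->]; last by rewrite eqxx.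
  rewrite ltnW // index_rev //; [apply: cc|apply: cc|].
  - by have := lower_lt lr; nlia.
  - by nlia.
  - by apply: (chain_up_lower tn) => //; apply: chain_upW ch; nlia.
have jj1 : index j a < index j.+1 a.
  rewrite ltn_neqAle jj andbT; apply/eqP => E.
  by have := congr1 (nth 0 a) E; rewrite !nth_index //; nlia.
have ch1 : chain_up a j.+1.
  case: ch => d0 d1 dk; split=> // k kle.
  have [->//|kj] : k = j \/ k < j by nlia.
  by apply: dk; nlia.
split=> // j1n; rewrite leqNgt; apply/negP => j2j1.
have {}j1n : 2 <= j.+1 <= n by nlia.
have cj : count_mem j.+1 a = 1.
  apply: count1P => // x p q ea jx jp.
  have lp := chain_up_no_lower fa ch1 j1n ea jx jp.
  have : j.+2 \in x by rewrite (mem_prefix _ ea).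
  move=> /split_first[x1 [x2 [ex _]]].
  have e : a = x1 ++ j.+2 :: x2 ++ j.+1 :: p ++ j.+1 :: q by rewrite ea ex; cat_norm.
  apply: (fcl_succ_pair n3 fa j1n e) => //.
  by move: jx; rewrite ex mem_cat inE !negb_or => /and3P[].
have cc c : c < j.+1 -> count_mem c a = 1.
  by apply: (chain_up_count n3 fa ch1 j1n (b := a) (q := [::])); rewrite ?cats0.
have lj r : lower n j.+1 r -> index j.+1 (rev a) < index r (rev a).
  move=> lr; apply: index_rev => //; first exact: cc (lower_lt lr).
  exact: (chain_up_lower j1n ch1).
have low : lower n j.+1 j by rewrite lowerE //; nlia.
(* From the right, either j+1 comes before j+2 and forms a reducible pair with j, or j+2 comes first
   and starts a falling chain. In the second case j+2 also occurs once, yet it would precede j+1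
   from both ends. *)
have [g|g] := leqP (index j.+1 (rev a)) (index j.+2 (rev a)).
  apply: (lil_three la' (s := j.+1) (t := j)).
  - exact: lower_adj.
  - by nlia.
  - by rewrite mem_rev.
  - exact: lj.
  - by move=> r; rewrite adjE // => /orP[/lj/ltnW|/eqP->].
  move=> r; rewrite adjE // => /orP[lr _|/eqP->]; last by rewrite eqxx.
  rewrite ltnW // index_rev //; [apply: cc|apply: cc|].
  - by have := lower_lt lr; nlia.
  - by [].
  - exact: (chain_up_lower jn).
have [chd fl] : chain_down n (rev a) j.+1 /\ falls n (rev a).
  have [jn'|jn'] : j.+1 < n \/ j.+1 = n by nlia.
    apply: (chain_down_first n3) => //; first by nlia.
      by rewrite mem_rev.
    by move=> c /lj/ltnW.
  have fl : falls n (rev a).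
    by split; rewrite -?jn' ?mem_rev //=; apply: lj.
  by split=> //; rewrite jn'; apply: chain_downW (falls_chain_down fl); nlia.
have [_ _ fl2] := fl.
have c2j : count_mem j.+2 a = 1.
  rewrite -count_rev.
  apply: (chain_down_count n3 fa' (falls_fc_cons la' fl) chd fl2 j1n (b := rev a) (q := [::])).
  - by rewrite cats0.
  - by rewrite count_rev.
  - by nlia.
by have := index_rev c2j cj j2j1; rewrite ltnNge ltnW.
Qed.

Section Falls.
Hypothesis fl : falls n a.

Let fna : fc_local n (n :: a). Proof. exact: falls_fc_cons la fl. Qed.

(** Along the falling chain the first two letters j enclose no j+1, hence at least two lower
    neighbours. Having none in the word excludes this at once, and one before the first j does so by
    [fcl_lower_pair]. *)
Lemma falls_single j : 2 <= j < n -> chain_down n a j -> j \in a ->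
  (exists2 c, lower n j c & index c a < index j a) \/ ~~ has (lower n j) a ->
  count_mem j a = 1.
Proof.
move=> jn ch ja H; have jn' : 2 <= j <= n by nlia.
have [_ _ fl2] := fl.
apply: count1P => // x p q ea jx jp.
have jp' := chain_down_no_upper fa fna ch fl2 jn' ea jx jp.
case: H => [[c lc cj]|/hasPn la0].
  have : c \in x by rewrite (mem_prefix _ ea).
  move=> /split_first[x1 [x2 [ex _]]].
  have e : a = x1 ++ c :: x2 ++ j :: p ++ j :: q by rewrite ea ex; cat_norm.
  apply: (fcl_lower_pair n3 fa jn' lc e) => //.
  by move: jx; rewrite ex mem_cat inE !negb_or => /and3P[].
have := fcl_no_upper n3 fa jn' ea jp jp'.
rewrite (@eq_in_count _ _ pred0) ?count_pred0 // => c cp /=.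
by rewrite (negPf (la0 c _)) // ea !(mem_cat, inE) cp !orbT.
Qed.

(** Otherwise j and j+1 would form a reducible pair at the right end. *)
Lemma falls_last j : 2 <= j < n -> chain_down n a j -> count_mem j a = 1 ->
  index j (rev a) < index j.+1 (rev a) /\
  exists2 c, lower n j c & index c (rev a) < index j (rev a).
Proof.
move=> jn ch cj; have jn' : 2 <= j <= n by nlia.
have [_ _ fl2] := fl.
have cc c : j < c <= n.+1 -> count_mem c a = 1.
  by apply: (chain_down_count n3 fa fna ch fl2 jn' (b := a) (q := [::])); rewrite ?cats0.
have lj : index j (rev a) < index j.+1 (rev a).
  by apply: index_rev (cc _ _) cj (ch _ _); nlia.
split=> //; apply: contrapT => nex.
have lo c : lower n j c -> index j (rev a) <= index c (rev a).
  by move=> lc; rewrite leqNgt; apply/negP => cj'; apply: nex; exists c.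
apply: (lil_three la' (s := j) (t := j.+1)) => //.
- by rewrite adjE // eqxx orbT.
- by nlia.
- by rewrite mem_rev; apply: count1_mem; apply: cc; nlia.
- by move=> r; rewrite adjE // => /orP[/lo//|/eqP->]; apply: ltnW.
move=> r; rewrite adjE ?lowerE; [|nlia|nlia] => /orP[/eqP->|/eqP-> _].
  by rewrite eqxx.
by apply/ltnW/index_rev; [apply: cc|apply: cc|apply: ch]; nlia.
Qed.

(** A missing j contradicts [falls_last] at j+1. A j before j+1 would precede it from both ends,
    although both letters occur once. *)
Lemma falls_chain j : 2 <= j < n -> chain_down n a j /\ j \in a.
Proof.
move=> jn; have [k] := ubnP (n - j); elim: k j jn => // k IH j jn kj.
have [->|jn1] : j = n.-1 \/ j.+1 < n by nlia.
  by split; [apply: falls_chain_down | case: fl].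
have [||ch ja] := IH j.+1; try nlia.
have j1n : 2 <= j.+1 < n by nlia.
have j1n' : 2 <= j.+1 <= n by nlia.
have lE c : lower n j.+1 c = (c == j) by rewrite lowerE //; nlia.
have [jj|jj] := ltnP (index j.+1 a) (index j a).
  have jin : j \in a.
    apply/negPn/negP => nja.
    have cj : count_mem j.+1 a = 1.
      apply: falls_single => //; right; apply/hasPn => c ca; rewrite lE.
      by apply: contraNneq nja => <-.
    have [_ [c]] := falls_last j1n ch cj.
    by rewrite lE => /eqP-> /index_lt_mem; rewrite mem_rev (negPf nja).
  split=> // i ijn; have [->//|ij] : i = j \/ j < i by nlia.
  by apply: ch; nlia.
have {}jj : index j a < index j.+1 a.
  rewrite ltn_neqAle jj andbT; apply/eqP => E.
  have jin : j \in a by rewrite -index_mem E index_mem.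
  by have := congr1 (nth 0 a) E; rewrite !nth_index //; nlia.
have cj : count_mem j.+1 a = 1.
  by apply: falls_single => //; left; exists j; rewrite ?lE.
have [lj [c]] := falls_last j1n ch cj.
rewrite lE => /eqP-> {c} cj'.
have [||//||chu _] := chain_up_first n3 la' (i := j.+1).
- by nlia.
- by rewrite mem_rev.
- exact: ltnW.
have c1 : count_mem j a = 1.
  rewrite -count_rev.
  apply: (chain_up_count n3 fa' chu j1n' (b := rev a) (q := [::])) => //.
    by rewrite cats0.
  by rewrite count_rev.
by have := index_rev c1 cj jj; rewrite ltnNge ltnW.
Qed.

(** If c preceded 2, there would be a single 2 and no c after it. At the right end 2 would then be
    preceded by the other fork letter only, and these two letters form a reducible pair there. *)
Lemma falls_fork c : c < 2 -> index 2 a <= index c a.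
Proof.
move=> c2; rewrite leqNgt; apply/negP => cj.
have n2 : 2 <= 2 < n by nlia.
have [ch a2] := falls_chain n2.
have cj2 : count_mem 2 a = 1.
  by apply: falls_single => //; left; exists c; rewrite ?lower2.
have [l23 [d]] := falls_last n2 ch cj2; rewrite lower2 => d2 dj.
have /split_first[x [y [ea x2]]] := a2.
have cx : c \in x by rewrite (mem_prefix _ ea).
have y2 : 2 \notin y.
  by apply/count_memPn; move: cj2; rewrite ea count_cat /= (count_memPn x2); nlia.
have cy : c \notin y.
  apply/negP => /split_first[y1 [y2' [ey cy1]]].
  have [x1 [x2' [ex cx2]]] := split_last cx.
  have e : a = x1 ++ c :: (x2' ++ 2 :: y1) ++ c :: y2' by rewrite ea ex ey; cat_norm.
  have := fcl_two fa e; rewrite mem_cat inE (negPf cx2) (negPf cy1) orbF /=.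
  have -> : c != 2 by nlia.
  have cn : c < n by nlia.
  move=> /(_ isT cn); rewrite ltnNge (leq_trans (@count_adj1 n c 2 _ _)) //.
    by move=> r _; rewrite adj0 // => /eqP.
  move: x2 y2; rewrite ex ey !(mem_cat, inE, negb_or) => /and3P[_ _ h1] /and3P[h2 _ _].
  by rewrite count_cat /= (count_memPn h1) (count_memPn h2).
have er : rev a = rev y ++ 2 :: rev x by rewrite ea rev_cat rev_cons cat_rcons.
have y2' : 2 \notin rev y by rewrite mem_rev.
have cj' : index 2 (rev a) <= index c (rev a).
  by rewrite leqNgt -(mem_prefix _ er) // mem_rev.
have dc : d != c by apply: contraTneq dj => ->; rewrite -leqNgt.
apply: (lil_three la' (s := d) (t := 2)) => //.
- by rewrite /adj; nlia.
- by nlia.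
- by rewrite mem_rev.
- by move=> r; rewrite adj0 // => /eqP->; apply: ltnW.
move=> r; rewrite adjE ?lower2; last nlia.
move=> /orP[r2 rd|/eqP-> _]; last exact: ltnW.
by have -> : r = c by nlia.
Qed.

End Falls.

End Word.
End FullChains.

Lemma iota_rcons m k : iota m k.+1 = rcons (iota m k) (m + k).
Proof. by rewrite -addn1 iotaD cats1. Qed.

(** * The first run of a zigzag *)

Section Zigzags.
Variable n : nat.
Hypothesis n3 : 3 <= n.
Implicit Types (a b x y z p q u : seq nat) (c d i j k : nat).

Definition fork u : bool := (u == [:: 0; 1]) || (u == [:: 1; 0]).

Lemma fork_mem u c : fork u -> (c \in u) = (c < 2).
Proof. by move=> /orP[]/eqP->; rewrite !inE; case: c => [|[|]]. Qed.

Lemma fork_count u c : fork u -> count_mem c u = (c < 2).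
Proof. by move=> /orP[]/eqP->; case: c => [|[|]]. Qed.

Lemma fc_local_adjacent a x c y : fc_local n a -> a = x ++ c :: c :: y -> False.
Proof.
move=> fa e; have cin : c <= n.+1.
  by apply: (fcl_le fa); rewrite e mem_cat inE eqxx orbT.
have e' : a = x ++ c :: [::] ++ c :: y by [].
have [cn|[cn|cn]] : c < n \/ c = n \/ c = n.+1 by nlia.
- by have := fcl_two fa e' isT cn.
- by subst c; have := fcl_n fa e' isT isT.
- by subst c; have := fcl_n1 fa e'.
Qed.

(** An equality of words and not only of classes: a larger letter at this place would violate the
    order of first occurrences, and a smaller one would repeat too early, against the counts or full
    commutativity. *)
Lemma rises_prefix a : fc_local n a -> li_local n a -> li_local n (rev a) ->
  rises a -> exists u y, fork u /\ a = u ++ iota 2 n ++ y.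
Proof.
move=> fa la la' ra.
have [ch n1a _] := rises_chain n3 fa la' ra (j := n.+1) ltac:(nlia).
have [c0 c1 ck] := ch.
have ina j : 2 <= j <= n.+1 -> j \in a.
  by move=> jn; case: (rises_chain n3 fa la' ra jn).
have step b j : 2 <= j <= n.+1 -> (forall c, (c \in b) = (c < j)) ->
    (exists y, a = b ++ y) -> (forall c y, a = b ++ c :: y -> c < j -> False) ->
    exists y, a = rcons b j ++ y.
  move=> jn mb [[|c y] ea] H.
    by have := ina j jn; rewrite ea cats0 mb ltnn.
  exists y; rewrite ea cat_rcons; congr (_ ++ _ :: _).
  have [cj|cj] := ltnP c j; first by case: (H c y ea cj).
  apply/eqP; rewrite eq_sym eqn_leq cj leqNgt; apply/negP => jc.
  have cn : c <= n.+1 by apply: (fcl_le fa); rewrite ea mem_cat inE eqxx orbT.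
  have cb : c \notin b by rewrite mb -leqNgt.
  have := ck c.-1 ltac:(nlia); rewrite prednK; last nlia.
  by rewrite -(mem_prefix _ ea cb) mb; nlia.
have [u [y0 [fu ea]]] : exists u y, fork u /\ a = u ++ y.
  case: a => [|c [|d y]] in fa ina ck c0 c1 {la la' ra ch n1a step} *.
  - by have := ina 2 ltac:(nlia).
  - have := ina 3 ltac:(nlia); have := ina 2 ltac:(nlia).
    by rewrite !inE => /eqP<-.
  have cn : c <= n.+1 by apply: (fcl_le fa); rewrite inE eqxx.
  have dn : d <= n.+1 by apply: (fcl_le fa); rewrite !inE eqxx orbT.
  have c2 : c < 2.
    rewrite ltnNge; apply/negP => c2; have [cE|c3] : c = 2 \/ 3 <= c by nlia.
      by move: c0; rewrite cE.
    have := ck c.-1 ltac:(nlia); rewrite prednK; last nlia.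
    by rewrite /= eqxx.
  have cd : c != d.
    by apply/eqP => cd; apply: (fc_local_adjacent (x := [::]) (c := c) (y := y) fa); rewrite cd.
  have d2 : d < 2.
    rewrite ltnNge; apply/negP => d2; have [dE|d3] : d = 2 \/ 3 <= d by nlia.
      move: c0 c1; rewrite dE /= (_ : c == 2 = false); last nlia.
      by case: (c) c2 => [|[|]].
    have := ck d.-1 ltac:(nlia); rewrite prednK; last nlia.
    rewrite /= eqxx (negPf cd) (_ : c == d.-1 = false); last nlia.
    by rewrite ltnS ltn0.
  exists [:: c; d], y; split=> //; rewrite /fork.
  by move: c2 d2 cd; case: (c) => [|[|]] //; case: (d) => [|[|]].
exists u; suff H k : k <= n -> exists y, a = (u ++ iota 2 k) ++ y.
  by have [y ->] := H n (leqnn n); exists y; rewrite -catA.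
elim: k => [|k IH] kn; first by exists y0; rewrite cats0.
have [|y ey] := IH; first exact: ltnW.
rewrite iota_rcons -rcons_cat add2n; apply: step.
- by nlia.
- by move=> c; rewrite mem_cat (fork_mem _ fu) mem_iota; nlia.
- by exists y.
move=> c z ez ck2; have [k0|k1] : k = 0 \/ 0 < k by nlia.
  subst k; have cu : c \in u by rewrite fork_mem.
  have [u1 [u2 [eu cu2]]] := split_last cu.
  have e : a = u1 ++ c :: u2 ++ c :: z by rewrite ez eu /=; cat_norm.
  have cn : c < n by nlia.
  have := fcl_two fa e cu2 cn; rewrite ltnNge (leq_trans (@count_adj1 n c 2 _ _)) //.
    by move=> r _; rewrite adj0 // => /eqP.
  by have := fork_count 2 fu; rewrite eu count_cat /=; nlia.
have [cE|cltk] : c = k.+1 \/ c < k.+1 by nlia.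
  apply: (fc_local_adjacent (x := u ++ iota 2 k.-1) (c := c) (y := z) fa).
  by rewrite ez -[in iota 2 k](prednK k1) iota_rcons cE add2n prednK //; cat_norm.
have chk : chain_up a k.+1 by apply: chain_upW ch; nlia.
have e : a = (rcons (u ++ iota 2 k) c) ++ z by rewrite ez cat_rcons.
have cnt d : count_mem d (rcons (u ++ iota 2 k) c) = (d < k.+2) + (c == d).
  rewrite -cats1 !count_cat (fork_count _ fu) /= addn0; congr (_ + _).
  rewrite count_uniq_mem ?iota_uniq // mem_iota; nlia.
have := chain_up_count n3 fa chk _ e (c := c); rewrite !cnt eqxx.
by move=> /(_ ltac:(nlia) ltac:(nlia) cltk); nlia.
Qed.

Lemma falls_prefix a : fc_local n a -> li_local n a -> li_local n (rev a) ->
  falls n a -> exists y, a = rev (iota 2 n) ++ y.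
Proof.
move=> fa la la' fl.
have [ch a2] := falls_chain n3 fa la la' fl (j := 2) ltac:(nlia).
have ck := falls_fork n3 fa la la' fl; have [n1a _ fl2] := fl.
have ina j : 2 <= j <= n.+1 -> j \in a.
  move=> jn; have [jn'|[->|->]] : j < n \/ j = n \/ j = n.+1 by nlia.
  - by case: (falls_chain n3 fa la la' fl (j := j)) => //; nlia.
  - exact: index_lt_mem fl2.
  - by case: fl => _ /index_lt_mem.
suff H k : k <= n -> exists y, a = rev (iota (n.+2 - k) k) ++ y.
  by have [y ->] := H n (leqnn n); exists y; congr (rev (iota _ _) ++ _); nlia.
elim: k => [|k IH] kn; first by exists a.
have [|[|c y] ey] := IH; first exact: ltnW.
  have := ina (n.+1 - k) ltac:(nlia).
  by rewrite ey cats0 mem_rev mem_iota; nlia.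
exists y; rewrite ey (_ : n.+2 - k = (n.+2 - k.+1).+1); last nlia.
rewrite -[iota (n.+2 - k.+1) k.+1]/(n.+2 - k.+1 :: iota (n.+2 - k.+1).+1 k).
rewrite rev_cons cat_rcons; congr (_ ++ _ :: _).
set b := rev (iota (n.+2 - k) k) in ey.
have mb d : (d \in b) = (n.+2 - k <= d < n.+2) by rewrite mem_rev mem_iota; nlia.
have cn : c <= n.+1 by apply: (fcl_le fa); rewrite ey mem_cat inE eqxx orbT.
have [clt|[|cgt]] : c < n.+1 - k \/ c = n.+1 - k \/ n.+1 - k < c by nlia.
- have cb : c \notin b by rewrite mb; nlia.
  have : (if c < 2 then 2 else c.+1) \in b.
    rewrite (mem_prefix _ ey cb); case: ifP => c2; last by apply: ch; nlia.
    rewrite ltn_neqAle ck // andbT; apply/eqP => E.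
    by have := congr1 (nth 0 a) E; rewrite !nth_index ?a2 ?ey ?mem_cat ?inE ?eqxx ?orbT //; nlia.
  by rewrite mb; case: ifP; nlia.
- by nlia.
have k0 : 0 < k by nlia.
have eb : b = rev (iota (n.+2 - k).+1 k.-1) ++ [:: n.+2 - k].
  by rewrite /b; case: (k) k0 => // k' _; rewrite /= rev_cons cats1.
have [cE|cgt2] : c = n.+2 - k \/ n.+2 - k < c by nlia.
  case: (fc_local_adjacent (x := rev (iota (n.+2 - k).+1 k.-1)) (c := c) (y := y) fa).
  by rewrite ey eb -catA /= cE.
have fna := falls_fc_cons la fl.
have chk : chain_down n a (n.+2 - k) by apply: chain_downW ch; nlia.
have e : a = (rcons b c) ++ y by rewrite ey cat_rcons.
have cnt d : count_mem d (rcons b c) = (n.+2 - k <= d < n.+2) + (c == d).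
  rewrite -cats1 !count_cat /= addn0; congr (_ + _).
  by rewrite count_uniq_mem ?rev_uniq ?iota_uniq // mb.
have := chain_down_count n3 fa fna chk fl2 _ e (c := c); rewrite !cnt eqxx.
by move=> /(_ ltac:(nlia) ltac:(nlia) ltac:(nlia)); nlia.
Qed.

End Zigzags.

(** * Zigzags *)

Section Runs.
Variable n : nat.
Hypothesis n3 : 3 <= n.
Implicit Types (a b x y z p q u : seq nat) (c d i j k : nat).

Section Word.
Variable a : seq nat.
Hypothesis fa : fc_local n a.

Let le_letter x c y : a = x ++ c :: y -> c <= n.+1.
Proof. by move=> e; apply: (fcl_le fa); rewrite e mem_cat inE eqxx orbT. Qed.

(** Until the next k+1 the word stays above the run it has just climbed, since an earlier letter of
    the run that came back would enclose a single copy of its successor. *)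
Lemma rising_run_gt x u k y z c : fork u -> 0 < k < n -> a = x ++ u ++ iota 2 k ++ y ++ z ->
  k.+1 \notin y -> c \in y -> k.+1 < c.
Proof.
move=> fu; elim: k y z c => // k IH y z c kn ea ky cy.
have [k0|k0] : k = 0 \/ 0 < k by nlia.
  subst k; have c2' : c != 2 by apply: contraNneq ky => <-.
  rewrite ltnNge; apply/negP => cle; have {cle c2'} c2 : c < 2 by nlia.
  have [y1 [y2 [ey cy1]]] := split_first cy.
  have cu : c \in u by rewrite fork_mem.
  have [u1 [u2 [eu cu2]]] := split_last cu.
  have e : a = (x ++ u1) ++ c :: (u2 ++ 2 :: y1) ++ c :: (y2 ++ z).
    by rewrite ea ey eu /=; cat_norm.
  have cn : c < n by nlia.
  have ce : c \notin u2 ++ 2 :: y1.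
    by rewrite mem_cat inE (negPf cu2) (negPf cy1) orbF; nlia.
  have := fcl_two fa e ce cn; rewrite ltnNge (leq_trans (@count_adj1 n c 2 _ _)) //.
    by move=> r _; rewrite adj0 // => /eqP.
  move: ky; rewrite ey mem_cat negb_or => /andP[/count_memPn y12 _].
  by have := fork_count 2 fu; rewrite eu !count_cat /= y12; nlia.
rewrite iota_rcons add2n in ea.
suff ky' : k.+1 \notin y.
  have e : a = x ++ u ++ iota 2 k ++ (k.+2 :: y) ++ z by rewrite ea; cat_norm.
  have := IH (k.+2 :: y) z c _ e; rewrite !inE negb_or ky' cy orbT.
  move=> /(_ ltac:(nlia) ltac:(nlia) isT) kc; rewrite ltn_neqAle kc andbT.
  by apply: contraNneq ky => ->.
apply/negP => /split_first[y1 [y2 [ey ky1]]].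
have e : a = x ++ u ++ iota 2 k ++ (k.+2 :: y1) ++ (k.+1 :: y2 ++ z).
  by rewrite ea ey; cat_norm.
have gt d : d \in k.+2 :: y1 -> k.+1 < d.
  apply: (IH _ _ _ _ e); first by nlia.
  by rewrite inE (negPf ky1) orbF; nlia.
have e1 : a = (x ++ u ++ iota 2 k.-1) ++ k.+1 :: (k.+2 :: y1) ++ k.+1 :: (y2 ++ z).
  rewrite e -[in iota 2 k](prednK k0) iota_rcons add2n prednK //; cat_norm.
  by [].
have kn' : k.+1 < n by nlia.
have ky1' : k.+1 \notin k.+2 :: y1 by apply/negP => /gt; nlia.
have := fcl_two fa e1 ky1' kn'; rewrite ltnNge (leq_trans (@count_adj1 n _ k.+2 _ _)) //.
  move=> r /gt; rewrite adjE; last nlia.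
  by move=> lt /orP[/lower_lt|/eqP//]; nlia.
rewrite /= eqxx (count_memPn _) //.
by move: ky; rewrite ey mem_cat negb_or => /andP[].
Qed.

(** Mirror image of [rising_run_gt]. The run is preceded by n, n+1, so that another n+1 before the
    next n would complete a braid. *)
Lemma falling_run_lt x k y z c : 0 < k < n ->
  a = x ++ [:: n; n.+1] ++ rev (iota (n.+1 - k) k) ++ y ++ z ->
  n.+1 - k \notin y -> c \in y -> c < n.+1 - k.
Proof.
elim: k y z c => // k IH y z c kn ea ky cy.
have cn : c <= n.+1.
  by apply: (fcl_le fa); rewrite ea !(mem_cat, inE) cy !orbT.
rewrite subSS in ea ky *.
rewrite -[iota _ k.+1]/((n - k) :: iota (n - k).+1 k) rev_cons in ea.
have [k0|k0] : k = 0 \/ 0 < k by nlia.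
  subst k; rewrite subn0 /= in ea ky *.
  suff ny : n.+1 \notin y.
    have : c != n by apply: contraNneq ky => <-.
    have : c != n.+1 by apply: contraNneq ny => <-.
    by nlia.
  apply/negP => /split_first[y1 [y2 [ey n1y]]].
  have e : a = x ++ n :: [::] ++ n.+1 :: [::] ++ n :: y1 ++ n.+1 :: (y2 ++ z).
    by rewrite ea ey; cat_norm.
  have ny : n \notin y1 by move: ky; rewrite ey mem_cat negb_or => /andP[].
  by have := fcl_br fa e ny n1y.
rewrite -(_ : n.+1 - k = (n - k).+1) in ea; last nlia.
suff ky' : n.+1 - k \notin y.
  have e : a = x ++ [:: n; n.+1] ++ rev (iota (n.+1 - k) k) ++ ((n - k) :: y) ++ z.
    by rewrite ea; cat_norm.
  have := IH ((n - k) :: y) z c _ e; rewrite !inE negb_or ky' cy orbT.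
  move=> /(_ ltac:(nlia) ltac:(nlia) isT) kc.
  have : c != n - k by apply: contraNneq ky => <-.
  by nlia.
apply/negP => /split_first[y1 [y2 [ey ky1]]].
have e : a = x ++ [:: n; n.+1] ++ rev (iota (n.+1 - k) k) ++ ((n - k) :: y1) ++ (n.+1 - k :: y2 ++ z).
  by rewrite ea ey; cat_norm.
have gt d : d \in (n - k) :: y1 -> d < n.+1 - k.
  apply: (IH _ _ _ _ e); first by nlia.
  by rewrite inE (negPf ky1) orbF; nlia.
have e1 : a = (x ++ [:: n; n.+1] ++ rev (iota (n.+1 - k).+1 k.-1)) ++ (n.+1 - k)
    :: ((n - k) :: y1) ++ (n.+1 - k) :: (y2 ++ z).
  rewrite e -[iota (n.+1 - k) k](_ : (n.+1 - k) :: iota (n.+1 - k).+1 k.-1 = _).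
    by rewrite rev_cons; cat_norm.
  by case: (k) k0.
have ky1' : n.+1 - k \notin (n - k) :: y1 by apply/negP => /gt; nlia.
have n1p : (n.+1 - k).+1 \notin (n - k) :: y1 by apply/negP => /gt; nlia.
have := fcl_no_upper n3 fa _ e1 ky1' n1p => /(_ ltac:(nlia)).
rewrite ltnNge; have -> // : count (lower n (n.+1 - k)) ((n - k) :: y1) <= 1.
rewrite (@eq_count _ _ (pred1 (n - k))); last first.
  by move=> r; rewrite lowerE /=; [congr (_ == _); nlia | nlia].
rewrite /= eqxx (count_memPn _) //.
by move: ky; rewrite ey mem_cat negb_or => /andP[].
Qed.

(** The endings excluded by right irreducibility, stated for literal suffixes because they are also
    applied to [n :: a], where only full commutativity is at hand. *)
Hypothesis ri3 : forall z j i, a = z ++ [:: j; i] -> adj n j i ->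
  (j < n) || (i < n) -> False.
Hypothesis ri4 : forall z, a = z ++ [:: n; n.+1; n] -> False.

(** After 2 the word stays below 2 until the next 2; it may end neither after 2 nor after one fork
    letter, and 2 c 2 is a braid. So both fork letters follow. *)
Lemma fork_after_fall x y : a = x ++ [:: n; n.+1] ++ rev (iota 2 n.-1) ++ y ->
  exists u y', fork u /\ y = u ++ y'.
Proof.
move=> ea; have lt2 p q c : y = p ++ q -> 2 \notin p -> c \in p -> c < 2.
  move=> ey p2 cp; have := falling_run_lt (x := x) (k := n.-1) (y := p) (z := q) (c := c).
  rewrite (_ : n.+1 - n.-1 = 2); last nlia.
  by rewrite -ey; apply => //; nlia.
have en : rev (iota 2 n.-1) = rcons (rcons (rev (iota 4 (n - 3))) 3) 2.
  by rewrite -!rev_cons; congr rev; rewrite -[n in LHS](subnK n3) addnS -/(_.-1) addn2.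
rewrite en in ea; case: y => [|c y] in ea lt2 *.
  case: (ri3 (z := x ++ [:: n, n.+1 & rev (iota 4 (n - 3))]) (j := 3) (i := 2)).
  - by rewrite ea; cat_norm.
  - by rewrite /adj; nlia.
  - by nlia.
have c2 : c != 2.
  apply/eqP => c2; apply: (fc_local_adjacent n3 (c := 2) (y := y) fa
    (x := x ++ [:: n, n.+1 & rcons (rev (iota 4 (n - 3))) 3])).
  by rewrite ea c2; cat_norm.
have {}c2 : c < 2.
  by apply: (lt2 [:: c] y); rewrite ?inE // eq_sym.
pose x' := x ++ [:: n, n.+1 & rcons (rev (iota 4 (n - 3))) 3].
have {}ea : a = x' ++ [:: 2, c & y] by rewrite ea; cat_norm.
case: y => [|d y] in ea lt2 *.
  case: (ri3 ea) => //; last by nlia.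
  by rewrite /adj; nlia.
have cd : d != c.
  apply/eqP => cd; apply: (fc_local_adjacent n3 (x := rcons x' 2) (c := c) (y := y) fa).
  by rewrite ea cd; cat_norm.
have d2 : d != 2.
  apply/eqP => d2; have e : a = x' ++ 2 :: [:: c] ++ 2 :: y by rewrite ea d2.
  have := fcl_two fa e; rewrite inE /= => /(_ ltac:(nlia) ltac:(nlia)).
  by case: (adj _ _ _).
have {}d2 : d < 2.
  by apply: (lt2 [:: c; d] y); rewrite ?inE ?eqxx ?orbT //; nlia.
exists [:: c; d], y; split=> //; rewrite /fork.
by move: c2 d2 cd; case: (c) => [|[|]] //; case: (d) => [|[|]].
Qed.

(** Each new letter is squeezed between the rising run, which bounds it from below, and the falling
    run, which bounds it from above. Only directly after n+1 may the word stop. *)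
Lemma fall_after_rise x u y : fork u -> a = x ++ u ++ iota 2 n ++ y ->
  y = [::] \/ exists y', y = rev (iota 2 n.-1) ++ y'.
Proof.
move=> fu ea; have [|y0] := eqVneq y [::]; [by left|right].
suff H k : 0 < k < n -> exists y', y = rev (iota (n.+1 - k) k) ++ y'.
  have [|y' ->] := H n.-1; first by nlia.
  by exists y'; congr (rev (iota _ _) ++ _); nlia.
have en : iota 2 n = rcons (rcons (iota 2 n.-2) n) n.+1.
  rewrite -[in LHS](prednK (n := n)) ?iota_rcons; last nlia.
  rewrite -[in LHS](prednK (n := n.-1)) ?iota_rcons; last nlia.
  by congr (rcons (rcons _ _) _); nlia.
have eR : a = (x ++ u ++ iota 2 n.-2) ++ [:: n; n.+1] ++ y.
  by rewrite ea en; cat_norm.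
elim: k => // k IH kn; have [k0|k0] : k = 0 \/ 0 < k by nlia.
  subst k; rewrite subn1 /=.
  case: y => // c y in ea y0 eR IH *; exists y; congr (_ :: _).
  have cn := le_letter (x := x ++ u ++ iota 2 n) (c := c) (y := y).
  rewrite ea -!catA in cn; have {}cn := cn erefl.
  have c1 : c != n.+1.
    apply/eqP => c1; apply: (fc_local_adjacent n3 (c := c) (y := y) fa
      (x := x ++ u ++ iota 2 n.-2 ++ [:: n])).
    by rewrite eR c1; cat_norm.
  apply/eqP/negPn/negP => c2.
  have := rising_run_gt (x := x) (u := u) (k := n.-1) (y := [:: n.+1; c]) (z := y) (c := c) fu.
  rewrite !inE eqxx orbT; have -> : n.-1.+1 = n by nlia.
  move=> H; suff: n < c by nlia.
  apply: H => //; try nlia.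
  rewrite eR -[in iota 2 n.-1](prednK (n := n.-1)) ?iota_rcons; last nlia.
  by rewrite (_ : 2 + n.-2 = n); [cat_norm | nlia].
have [|y1 ey] := IH; first by nlia.
rewrite ey in eR ea; case: y1 => [|c y1] in eR ea ey *.
  have [k1|k1] : k = 1 \/ 1 < k by nlia.
    case: (ri4 (z := x ++ u ++ iota 2 n.-2)).
    by rewrite eR k1 subn1 /=; cat_norm.
  case: (ri3 (z := x ++ u ++ iota 2 n ++ rev (iota (n.+3 - k) k.-2))
      (j := n.+2 - k) (i := n.+1 - k)).
  - rewrite ea cats0 -(_ : (n.+1 - k) :: (n.+2 - k) :: iota (n.+3 - k) k.-2 = iota (n.+1 - k) k).
      by rewrite !rev_cons; cat_norm.
    by case: (k) k1 kn => [|[|k']] //= _ kn; congr [:: _, _ & iota _ _]; nlia.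
  - by rewrite /adj; nlia.
  - by nlia.
exists y1; rewrite ey subSS.
rewrite -[iota _ k.+1]/((n - k) :: iota (n - k).+1 k) rev_cons cat_rcons.
rewrite -(_ : n.+1 - k = (n - k).+1); last nlia.
congr (_ ++ _ :: _).
have cn : c <= n.+1.
  by apply: (fcl_le fa); rewrite ea !(mem_cat, inE) eqxx !orbT.
have c1 : c != n.+1 - k.
  apply/eqP => c1; apply: (fc_local_adjacent n3 (c := c) (y := y1) fa
    (x := x ++ u ++ iota 2 n ++ rev (iota (n.+2 - k) k.-1))).
  rewrite ea -(_ : (n.+1 - k) :: iota (n.+2 - k) k.-1 = iota (n.+1 - k) k).
    by rewrite !rev_cons c1; cat_norm.
  by case: (k) k0 kn => [|k'] //= _ kn; congr (_ :: iota _ _); nlia.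
have clt : c < n.+1 - k.
  apply: (falling_run_lt (x := x ++ u ++ iota 2 n.-2) (y := [:: c]) (z := y1)).
  - by nlia.
  - by rewrite eR; cat_norm.
  - by rewrite inE eq_sym.
  - by rewrite inE.
apply/eqP/negPn/negP => c2.
have : (n - k.+1).+1 < c; last by nlia.
apply: (rising_run_gt (x := x) (u := u) (k := n - k.+1) (z := y1)
  (y := iota (n.+1 - k) k.+1 ++ rev (iota (n.+1 - k) k) ++ [:: c]) fu).
- by nlia.
- rewrite ea; have -> : iota 2 n = iota 2 (n - k.+1) ++ iota (n.+1 - k) k.+1.
    by rewrite -[in LHS](subnK (m := k.+1) (n := n)) ?iotaD; [congr (_ ++ iota _ _)|]; nlia.
  by cat_norm.
- by rewrite !mem_cat mem_rev !mem_iota inE; nlia.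
- by rewrite !mem_cat mem_seq1 eqxx !orbT.
Qed.

(** The same squeeze on the way up; here the word may stop directly after the fork. *)
Lemma rise_after_fork x u y : fork u ->
  a = x ++ [:: n; n.+1] ++ rev (iota 2 n.-1) ++ u ++ y ->
  y = [::] \/ exists y', y = iota 2 n ++ y'.
Proof.
move=> fu ea; have [|y0] := eqVneq y [::]; [by left|right].
suff H k : 0 < k <= n -> exists y', y = iota 2 k ++ y'.
  by apply: H; nlia.
(* Only the part of the fall down to j is used, so that the bound of [falling_run_lt] lasts until
   the next j. *)
have gap j p q c : 2 <= j <= n -> u ++ y = p ++ q -> j \notin p -> c \in p -> c < j.
  move=> jn ey jp cp.
  have := falling_run_lt (x := x) (k := n.+1 - j) (z := q) (c := c)
    (y := rev (iota 2 (j - 2)) ++ p).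
  rewrite (_ : n.+1 - (n.+1 - j) = j); last nlia.
  apply; try nlia.
  - rewrite ea ey; have -> : iota 2 n.-1 = iota 2 (j - 2) ++ iota j (n.+1 - j).
      by rewrite -[n.-1](_ : (j - 2) + (n.+1 - j) = _) ?iotaD; [congr (_ ++ iota _ _)|]; nlia.
    by rewrite rev_cat; cat_norm.
  - by rewrite mem_cat mem_rev mem_iota negb_or jp; nlia.
  - by rewrite mem_cat cp orbT.
elim: k => // k IH kn; have [k0|k0] : k = 0 \/ 0 < k by nlia.
  subst k; case: y => // c y in ea y0 gap IH *; exists y; congr (_ :: _).
  apply/eqP/negPn/negP => c2.
  have {}c2 : c < 2.
    apply: (gap 2 (rcons u c) y).
    - by nlia.
    - by rewrite cat_rcons.
    - by rewrite mem_rcons inE fork_mem // negb_or eq_sym c2.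
    - by rewrite mem_rcons inE eqxx.
  have cu : c \in u by rewrite fork_mem.
  have [u1 [u2 [eu cu2]]] := split_last cu.
  have e : a = (x ++ [:: n; n.+1] ++ rev (iota 2 n.-1) ++ u1) ++ c :: u2 ++ c :: y.
    by rewrite ea eu; cat_norm.
  have cn : c < n by nlia.
  have := fcl_two fa e cu2 cn; rewrite ltnNge (leq_trans (@count_adj1 n c 2 _ _)) //.
    by move=> r _; rewrite adj0 // => /eqP.
  by have := fork_count 2 fu; rewrite eu count_cat /=; nlia.
have [|y1 ey] := IH; first by nlia.
have ek : iota 2 k = rcons (iota 2 k.-1) k.+1.
  by rewrite -[in LHS](prednK k0) iota_rcons; congr rcons; nlia.
have {}ea : a = (x ++ [:: n; n.+1] ++ rev (iota 2 n.-1)) ++ u ++ iota 2 k ++ y1.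
  by rewrite ea ey; cat_norm.
set x' := x ++ _ in ea.
case: y1 => [|c y1] in ea ey *.
  have [k1|k1] : k = 1 \/ 1 < k by nlia.
    have [u' [r [eu r2]]] : exists u' r, u = rcons u' r /\ r < 2.
      by case/orP: fu => /eqP->; [exists [:: 0], 1|exists [:: 1], 0].
    case: (ri3 (z := x' ++ u') (j := r) (i := 2)).
    - by rewrite ea eu k1 /=; cat_norm.
    - by rewrite /adj; nlia.
    - by nlia.
  have ek' : iota 2 k.-1 = rcons (iota 2 k.-2) k.
    by rewrite -[in LHS](prednK (n := k.-1)) ?iota_rcons; [congr rcons|]; nlia.
  case: (ri3 (z := x' ++ u ++ iota 2 k.-2) (j := k) (i := k.+1)).
  - by rewrite ea ek ek'; cat_norm.
  - by rewrite /adj; nlia.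
  - by nlia.
exists y1; rewrite ey iota_rcons cat_rcons; congr (_ ++ _ :: _).
have cn : c <= n.+1.
  by apply: (fcl_le fa); rewrite ea !(mem_cat, inE) eqxx !orbT.
have c1 : c != k.+1.
  apply/eqP => c1; apply: (fc_local_adjacent n3 (c := c) (y := y1) fa
    (x := x' ++ u ++ iota 2 k.-1)).
  by rewrite ea ek c1; cat_norm.
have clt : k.+1 < c.
  apply: (rising_run_gt (x := x') (u := u) (k := k) (y := [:: c]) (z := y1)) => //.
  - by nlia.
  - by rewrite inE eq_sym.
  - by rewrite inE.
apply/eqP/negPn/negP => c2.
have kn' : k.+2 <= n by nlia.
suff: c < k.+2 by nlia.
apply: (gap k.+2 (u ++ iota 2 k ++ [:: c]) y1).
- by nlia.
- by rewrite ey; cat_norm.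
- by rewrite !mem_cat fork_mem // mem_iota inE; nlia.
- by rewrite !mem_cat mem_seq1 eqxx !orbT.
Qed.

End Word.

(* The commuting letters 0 and 1 may come in either order at each turn of a zigzag. *)
Definition swap01 a b : bool :=
  ([seq c <- a | c != 0] == [seq c <- b | c != 0]) &&
  ([seq c <- a | c != 1] == [seq c <- b | c != 1]).

Lemma swap01_refl a : swap01 a a.
Proof. by rewrite /swap01 !eqxx. Qed.

Lemma swap01_cat a b p q : swap01 a b -> swap01 p q -> swap01 (a ++ p) (b ++ q).
Proof.
by rewrite /swap01 !filter_cat => /andP[/eqP-> /eqP->] /andP[/eqP-> /eqP->]; rewrite !eqxx.
Qed.

Lemma swap01_fork u v : fork u -> fork v -> swap01 u v.
Proof. by move=> /orP[]/eqP-> /orP[]/eqP->. Qed.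

Definition zA : seq nat := iota 2 n.
Definition zB : seq nat := rev (iota 0 n.+1).
Definition npow a k : seq nat := flatten (nseq k a).

Lemma npowC a b k : a ++ npow (b ++ a) k = npow (a ++ b) k ++ a.
Proof.
by elim: k => [|k IH]; rewrite /npow /= ?cats0 // -!catA -/(npow _ _) IH.
Qed.

(** Absorbs one more block at the front into the normal form; k' + h' > 0 because a block has been
    added. *)
Lemma npow_shift a b k h : h <= 1 -> exists k' h',
  [/\ h' <= 1, 0 < k' + h'
    & a ++ npow (b ++ a) k ++ npow b h = npow (a ++ b) k' ++ npow a h'].
Proof.
case: h => [|[|//]] _; [exists k, 1|exists k.+1, 0]; split=> //.
- by rewrite addn1.
- by rewrite /npow /= !cats0 -!/(npow _ _) npowC.
have := npowC (a ++ b) [::] k; rewrite cats0 cat0s => E.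
by rewrite /npow /= !cats0 -!/(npow _ _) E catA npowC -catA.
Qed.

Lemma swap01_zB u : fork u -> swap01 (rev (iota 2 n.-1) ++ u) zB.
Proof.
move=> fu; have -> : zB = rev (iota 2 n.-1) ++ [:: 1; 0].
  rewrite /zB -[n in LHS](prednK (n := n)); last nlia.
  by rewrite -[iota 0 _]/([:: 0; 1] ++ iota 2 n.-1) rev_cat.
by apply: swap01_cat; [apply: swap01_refl|apply: swap01_fork].
Qed.

(** The two claims are the two states of one automaton, after a rise and after a fork. Every
    transition consumes letters, so the induction is on the length of what remains. *)
Lemma runs a x u y : fc_local n a ->
  (forall z j i, a = z ++ [:: j; i] -> adj n j i -> (j < n) || (i < n) -> False) ->
  (forall z, a = z ++ [:: n; n.+1; n] -> False) -> fork u ->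
  (a = x ++ u ++ zA ++ y ->
    exists k h, h <= 1 /\ swap01 y (npow (zB ++ zA) k ++ npow zB h)) /\
  (a = x ++ [:: n; n.+1] ++ rev (iota 2 n.-1) ++ u ++ y ->
    exists k h, h <= 1 /\ swap01 y (npow (zA ++ zB) k ++ npow zA h)).
Proof.
move=> fa ri3 ri4; have [m] := ubnP (size y).
elim: m x u y => // m IH x u y ym fu; split=> ea.
  have [->|[y1 ey]] := fall_after_rise fa ri3 ri4 fu ea.
    by exists 0, 0.
  have en : zA = rcons (rcons (iota 2 n.-2) n) n.+1.
    rewrite /zA -[in LHS](prednK (n := n)) ?iota_rcons; last nlia.
    rewrite -[in LHS](prednK (n := n.-1)) ?iota_rcons; last nlia.
    by congr (rcons (rcons _ _) _); nlia.
  have {}ea : a = (x ++ u ++ iota 2 n.-2) ++ [:: n; n.+1] ++ rev (iota 2 n.-1) ++ y1.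
    by rewrite ea en ey; cat_norm.
  have [v [y2 [fv ey1]]] := fork_after_fall fa ri3 ea.
  rewrite ey1 in ea; have sz : size y2 < m.
    by move: ym; rewrite ey ey1 !size_cat size_rev size_iota; nlia.
  have [_ /(_ ea)[k [h [h1 sw]]]] := IH (x ++ u ++ iota 2 n.-2) _ _ sz fv.
  have E : y = (rev (iota 2 n.-1) ++ v) ++ y2 by rewrite ey ey1 catA.
  have := swap01_cat (swap01_zB fv) sw; rewrite -E.
  by have [k' [h' [h'1 _ ->]]] := npow_shift zB zA k h1; exists k', h'.
have [->|[y1 ey]] := rise_after_fork fa ri3 fu ea.
  by exists 0, 0.
have {}ea : a = (x ++ [:: n; n.+1] ++ rev (iota 2 n.-1)) ++ u ++ zA ++ y1.
  by rewrite ea ey; cat_norm.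
have sz : size y1 < m.
  by move: ym; rewrite ey !size_cat size_iota; nlia.
have [/(_ ea)[k [h [h1 sw]]] _] := IH (x ++ [:: n; n.+1] ++ rev (iota 2 n.-1)) _ _ sz fu.
have := swap01_cat (swap01_refl zA) sw; rewrite -ey.
by have [k' [h' [h'1 _ ->]]] := npow_shift zA zB k h1; exists k', h'.
Qed.

End Runs.

(** * Complete zigzags and their reversals *)

Section CompleteZigzags.
Variable n : nat.
Hypothesis n3 : 3 <= n.
Implicit Types (a b x y z p q u : seq nat) (c d i j k : nat).

Lemma li_local_end3 a z j i : li_local n (rev a) -> a = z ++ [:: j; i] ->
  adj n j i -> (j < n) || (i < n) -> False.
Proof.
move=> la' ea ji jin; have er : rev a = [:: i, j & rev z] by rewrite ea rev_cat.
have nij : i != j by apply: contraTneq ji => ->; rewrite /adj; nlia.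
apply: (lil_three la' (s := i) (t := j)).
- by rewrite adjC.
- by rewrite orbC.
- by rewrite er !inE eqxx orbT.
- by rewrite er /= eqxx (negPf nij).
- by move=> r _; rewrite er /= eqxx.
by move=> r _; rewrite er /= eqxx eq_sym (negPf nij) => /negPf->.
Qed.

(** Irreducibility tolerates this ending only if n+1 can still be added, and that would complete a
    braid. *)
Lemma li_local_end4 a z : li_local n (rev a) -> a = z ++ [:: n; n.+1; n] -> False.
Proof.
move=> la' ea; have er : rev a = [:: n, n.+1, n & rev z] by rewrite ea rev_cat.
have n1 : n == n.+1 = false by nlia.
have f := lil_n la'; rewrite er !inE !eqxx /= !eqxx n1 orbT /= in f.
have := fcl_br' (f isT isT isT) (x := [::]) (y1 := [::]) (y2 := [::]) (y3 := [::]).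
by move=> /(_ (rev z) erefl isT isT).
Qed.

Definition zig_up k h : seq nat := [:: 0; 1] ++ npow (zA n ++ zB n) k ++ npow (zA n) h.
Definition zig_down k h : seq nat := n.+1 :: npow (zB n ++ zA n) k ++ npow (zB n) h.

Lemma rises_zigzag a : fc_local n a -> li_local n a -> li_local n (rev a) -> rises a ->
  exists k h, [/\ h <= 1, 0 < k + h & swap01 a (zig_up k h)].
Proof.
move=> fa la la' ra; have [u [y [fu ea]]] := rises_prefix n3 fa la la' ra.
have ri3 z j i := @li_local_end3 a z j i la'.
have ri4 z := @li_local_end4 a z la'.
have [/(_ ea)[k [h [h1 sw]]] _] := runs n3 [::] y fa ri3 ri4 fu.
have [k' [h' [h'1 kh' E]]] := npow_shift (zA n) (zB n) k h1.
exists k', h'; split=> //; rewrite /zig_up -E ea.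
by apply: swap01_cat; [apply: swap01_fork|apply: swap01_cat; rewrite ?swap01_refl].
Qed.

(** The word starts with n+1, n, ..., 2 and lacks the n before n+1 that marks a turn. Therefore
    [runs] is applied to [n :: a], which irreducibility provides. *)
Lemma falls_zigzag a : fc_local n a -> li_local n a -> li_local n (rev a) -> falls n a ->
  exists k h, [/\ h <= 1, 0 < k + h & swap01 a (zig_down k h)].
Proof.
move=> fa la la' fl; have [y ea] := falls_prefix n3 fa la la' fl.
have fna := falls_fc_cons la fl.
have en : rev (iota 2 n) = n.+1 :: rev (iota 2 n.-1).
  rewrite -[in LHS](prednK (n := n)) ?iota_rcons; last nlia.
  by rewrite rev_rcons; congr (_ :: _); nlia.
rewrite en in ea.
have sz : 2 < size (n :: a) by rewrite ea /= size_cat size_rev size_iota; nlia.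
have ri3 z j i : n :: a = z ++ [:: j; i] -> adj n j i -> (j < n) || (i < n) -> False.
  case: z => [E|c z [_ E]]; first by rewrite E in sz.
  exact: li_local_end3 E.
have ri4 z : n :: a = z ++ [:: n; n.+1; n] -> False.
  case: z => [[E]|c z [_ E]]; last exact: li_local_end4 E.
  have := congr1 size ea; have : 2 \in a by rewrite ea !(inE, mem_cat) mem_rev mem_iota; nlia.
  by rewrite E !inE; nlia.
have ena : n :: a = [::] ++ [:: n; n.+1] ++ rev (iota 2 n.-1) ++ y by rewrite ea.
have [u [y' [fu ey]]] := fork_after_fall n3 fna ri3 ena.
rewrite ey in ena ea.
have [_ /(_ ena)[k [h [h1 sw]]]] := runs n3 [::] y' fna ri3 ri4 fu.
have [k' [h' [h'1 kh' E]]] := npow_shift (zB n) (zA n) k h1.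
exists k', h'; split=> //; rewrite /zig_down -E ea.
have := swap01_cat (swap01_refl [:: n.+1]) (swap01_cat (swap01_zB n3 fu) sw).
by rewrite -!catA.
Qed.

Lemma swap01_rev a b : swap01 a b -> swap01 (rev a) (rev b).
Proof. by rewrite /swap01 !filter_rev => /andP[/eqP-> /eqP->]; rewrite !eqxx. Qed.

Lemma swap01_cons a c b : 2 <= c -> swap01 a (c :: b) ->
  exists2 a', a = c :: a' & swap01 a' b.
Proof.
case: c => [|[|c]] // _; case: a => [|[|[|d]] a]; rewrite /swap01 //= ?andbF //.
by move=> /andP[/eqP[-> E] /eqP[E']]; exists a => //; rewrite E E' !eqxx.
Qed.

Lemma swap01_fork_cons a b : swap01 a [:: 0, 1, 2 & b] ->
  exists u y, fork u /\ a = u ++ 2 :: y.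
Proof.
rewrite /swap01 /= => /andP[/eqP E0 /eqP E1].
case: a E0 E1 => [|[|[|c]] a] //=.
- case: a => [|[|[|d]] a] //=; case: a => [|[|[|d]] a] //= [E0] _ _.
  by exists [:: 0; 1], a; rewrite E0.
- case: a => [|[|[|d]] a] //=; case: a => [|[|[|d]] a] //= [E0] _.
  by exists [:: 1; 0], a; rewrite E0.
Qed.

Lemma npowSr a k : npow a k.+1 = npow a k ++ a.
Proof. by have := npowC a [::] k; rewrite cats0 cat0s. Qed.

Lemma npow_end a b k h : h <= 1 -> 0 < k + h ->
  exists w, npow (a ++ b) k ++ npow a h = w ++ a \/
            npow (a ++ b) k ++ npow a h = w ++ b.
Proof.
case: h => [|[|//]] _ kh.
  exists (npow (a ++ b) k.-1 ++ a); right; rewrite cats0 -catA.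
  by case: k kh => // k _; rewrite npowSr.
by exists (npow (a ++ b) k); left; rewrite /npow /= cats0.
Qed.

Lemma zig_up_start a y : swap01 a (rev (zB n) ++ y) -> rises a.
Proof.
rewrite revK; have -> : iota 0 n.+1 = [:: 0, 1, 2 & iota 3 n.-2].
  by case: (n) n3 => [|[|m]].
move=> /swap01_fork_cons[u [y' [fu ->]]].
have idx c : index c (u ++ 2 :: y') = if c < 2 then index c u else 2 + index c (2 :: y').
  rewrite index_cat (fork_mem _ fu); case: ifP => // _.
  by case/orP: fu => /eqP->.
have u2 c : c < 2 -> index c u < 2.
  have su : size u = 2 by case/orP: fu => /eqP->.
  by move=> c2; rewrite -[X in _ < X]su index_mem fork_mem.
by split; rewrite ?mem_cat ?inE ?eqxx ?orbT // !idx //= ?addn0 ?u2.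
Qed.

Lemma zig_down_start a y : swap01 a (rev (zA n) ++ y) -> falls n a.
Proof.
have -> : rev (zA n) = [:: n.+1, n, n.-1 & rev (iota 2 (n - 3).+1.-1)].
  rewrite /zA -[in LHS](subnK n3) addn3 !iota_rcons !rev_rcons /=.
  by congr [:: _, _, _ & _]; nlia.
move=> /swap01_cons[|a1 ->]; first by nlia.
move=> /swap01_cons[|a2 ->]; first by nlia.
move=> /swap01_cons[|a3 ->]; first by nlia.
move=> _; split; rewrite ?inE ?eqxx ?orbT //=.
  by rewrite !eqxx; have -> : n.+1 == n = false by nlia.
rewrite !eqxx; have -> : n.+1 == n = false by nlia.
have -> : n.+1 == n.-1 = false by nlia.
by have -> : n == n.-1 = false by nlia.
Qed.

(** A pattern at the right end makes the whole word a zigzag, whose left end shows a pattern too.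
    This passes the absence of patterns from a word to its reverse. *)
Lemma zig_rev a : fc_local n a -> li_local n a -> li_local n (rev a) ->
  rises (rev a) \/ falls n (rev a) -> rises a \/ falls n a.
Proof.
move=> fa la la'; have fa' := fc_local_rev fa.
have la'' : li_local n (rev (rev a)) by rewrite revK.
have E w : swap01 (rev a) w -> swap01 a (rev w) by move=> /swap01_rev; rewrite revK.
case=> [/(rises_zigzag fa' la' la'')|/(falls_zigzag fa' la' la'')][k [h [h1 kh /E]]].
  have [w [ew|ew]] := npow_end (zA n) (zB n) h1 kh;
    rewrite /zig_up ew catA rev_cat.
    by move/zig_down_start; right.
  by move/zig_up_start; left.
have [w [ew|ew]] := npow_end (zB n) (zA n) h1 kh;
  rewrite /zig_down ew -cat_cons rev_cat.
  by move/zig_up_start; left.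
by move/zig_down_start; right.
Qed.

End CompleteZigzags.

(** * Words without the two patterns *)

Section Alternating.
Variable n : nat.
Hypothesis n3 : 3 <= n.
Implicit Types (a b x y z p q u : seq nat) (c d e i j k o : nat).

Lemma mem_index_neq a c d : c \in a -> c != d -> index c a != index d a.
Proof.
move=> ca cd; apply: contraNneq cd => E.
have da : d \in a by rewrite -index_mem -E index_mem.
by rewrite -(nth_index 0 ca) E nth_index.
Qed.

Section Tops.
Variable a : seq nat.
Hypotheses (fa : fc_local n a) (la : li_local n a).
Hypotheses (nr : ~ rises a) (nf : ~ falls n a).

Lemma top_lower i c : 2 <= i <= n -> i \in a -> lower n i c ->
  index c a < index i a -> index i.+1 a < index i a.
Proof.
move=> ile ia lc ci; rewrite ltnNge; apply/negP => ii; apply: nr.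
have [i2|i3] : i = 2 \/ 3 <= i by nlia.
  subst i; move: lc; rewrite lower2 => c2.
  have [cd|cd] := ltnP (index (1 - c) a) (index 2 a).
    by case: c c2 ci cd => [|[|]] //= _ h1 h2; split.
  exfalso; apply: (lil_three la (s := c) (t := 2)) => //.
  - by rewrite /adj; nlia.
  - by nlia.
  - by move=> r; rewrite adj0 // => /eqP->; apply: ltnW.
  move=> r; rewrite adjE ?lower2; last nlia.
  move=> /orP[r2 rc|/eqP-> _] //.
  by have -> : r = 1 - c by nlia.
move: lc ci; rewrite lowerE; last nlia.
move=> /eqP-> ci.
have h3 : 3 <= i <= n by nlia.
by case: (chain_up_first n3 la h3 ia ci ii).
Qed.

(** The side condition at i = n leaves room for the elements s_{n+1} s_n v, where n+1 precedes n and
    n-1 is absent. *)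
Lemma top_upper i : 2 <= i <= n -> i \in a -> (i = n -> n.-1 \in a) ->
  index i.+1 a < index i a -> exists2 c, lower n i c & index c a < index i a.
Proof.
move=> ile ia i_n ii; apply: contrapT => nex; apply: nf.
have lo c : lower n i c -> index i a <= index c a.
  by move=> lc; rewrite leqNgt; apply/negP => ci; apply: nex; exists c.
have [iE|iltn] : i = n \/ i < n by nlia.
  subst i; have n1a := i_n erefl; split=> //.
  rewrite ltn_neqAle lo ?lowerE ?eqxx //; last nlia.
  by rewrite mem_index_neq //; nlia.
have hn : 2 <= i < n by nlia.
by case: (chain_down_first n3 la hn ia ii lo).
Qed.

(** Induction on the prefix [x]. A gap that misses one side would be the turn of a zigzag, and
    without the two patterns no run can lead to it. *)
Lemma no_returns x i p q : 2 <= i <= n -> a = x ++ i :: p ++ i :: q -> i \notin p ->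
  has (lower n i) p /\ i.+1 \in p.
Proof.
have [m] := ubnP (size x); elim: m x i p q => // m IH x i p q xm ile ea ip.
have ia : i \in a by rewrite ea mem_cat inE eqxx orbT.
split.
  apply/negPn/negP => lp; have [ip1 ip2] := fcl_no_lower n3 fa ile ea ip lp.
  (* With an earlier i, the induction hypothesis puts an i+1 before the pair, against
     [fcl_succ_pair]. *)
  have [ix|ix] := boolP (i \in x).
    have [x1 [r [ex ir]]] := split_last ix.
    have e : a = x1 ++ i :: r ++ i :: (p ++ i :: q) by rewrite ea ex; cat_norm.
    have [|_] := IH x1 i r _ _ ile e ir.
      by move: xm; rewrite ex size_cat /=; nlia.
    move=> /split_first[r1 [r2 [er _]]].
    have e1 : a = (x1 ++ i :: r1) ++ i.+1 :: r2 ++ i :: p ++ i :: q.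
      by rewrite ea ex er; cat_norm.
    apply: (fcl_succ_pair n3 fa ile e1) => //.
    by move: ir; rewrite er mem_cat inE !negb_or => /and3P[].
  have i1x : i.+1 \notin x.
    apply/negP => /split_first[r1 [r2 [er _]]].
    have e1 : a = r1 ++ i.+1 :: r2 ++ i :: p ++ i :: q by rewrite ea er; cat_norm.
    apply: (fcl_succ_pair n3 fa ile e1) => //.
    by move: ix; rewrite er mem_cat inE !negb_or => /and3P[].
  have nii : ~~ (index i.+1 a < index i a) by rewrite -(mem_prefix _ ea).
  have lo c : lower n i c -> index i a <= index c a.
    by move=> lc; rewrite leqNgt; apply: contra nii; apply: top_lower.
  have i1a : i.+1 \in a by rewrite ea !(mem_cat, inE) ip1 !orbT.
  have ii1 : index i a < index i.+1 a.
    rewrite ltn_neqAle [X in _ && X]leqNgt nii andbT mem_index_neq //; last nlia.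
  (* Here i comes before all its neighbours. At the top n+1 can be prepended, and [fcl_n_split]
     applies to the longer word. *)
  have [iE|iltn] : i = n \/ i < n by nlia.
    subst i; have f := lil_n la i1a ii1 (lo n.-1 ltac:(by rewrite lowerE ?eqxx; nlia)).
    have e1 : n.+1 :: a = [::] ++ n.+1 :: x ++ n :: p ++ n :: q by rewrite ea.
    have := fcl_n_split f e1 ix ip.
    by move=> n1p; case/negP: lp; apply/hasP; exists n.-1; rewrite // lowerE ?eqxx; nlia.
  have [p0 [p1 [p2 [ep ip0 ip1']]]] := split_two (ip2 iltn).
  have e1 : a = (x ++ i :: p0) ++ i.+1 :: p1 ++ i.+1 :: (p2 ++ i :: q).
    by rewrite ea ep; cat_norm.
  have nw : i.+1 \notin x ++ i :: p0.
    by rewrite mem_cat inE (negPf i1x) (negPf ip0) orbF; nlia.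
  have i1n : 2 <= i.+1 <= n by nlia.
  have lowi : lower n i.+1 i by rewrite lowerE ?eqxx; nlia.
  (* Since i precedes i+1, so does i+2; then the pair of letters i+1 inside p contradicts
     [fcl_succ_pair]. *)
  have := top_lower i1n i1a lowi ii1.
  rewrite -(mem_prefix _ e1 nw) => /split_first[w1 [w2 [ew _]]].
  have e2 : a = w1 ++ i.+2 :: w2 ++ i.+1 :: p1 ++ i.+1 :: (p2 ++ i :: q).
    by rewrite e1 ew; cat_norm.
  apply: (fcl_succ_pair n3 fa i1n e2) => //.
    by move: nw; rewrite ew mem_cat inE !negb_or => /and3P[].
  apply/hasPn => c cp1; rewrite lowerE; last nlia.
  apply: contraNneq ip => /= <-.
  by rewrite ep !(mem_cat, inE) cp1 !orbT.
apply/negPn/negP => i1p; have lp2 := fcl_no_upper n3 fa ile ea ip i1p.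
have /hasP[c0 c0p lc0] : has (lower n i) p by rewrite has_count; nlia.
have [ix|ix] := boolP (i \in x).
  have [x1 [r [ex ir]]] := split_last ix.
  have e : a = x1 ++ i :: r ++ i :: (p ++ i :: q) by rewrite ea ex; cat_norm.
  have [|/hasP[c cr lc] _] := IH x1 i r _ _ ile e ir.
    by move: xm; rewrite ex size_cat /=; nlia.
  have [r1 [r2 [er _]]] := split_first cr.
  have e1 : a = (x1 ++ i :: r1) ++ c :: r2 ++ i :: p ++ i :: q.
    by rewrite ea ex er; cat_norm.
  apply: (fcl_lower_pair n3 fa ile lc e1) => //.
  by move: ir; rewrite er mem_cat inE !negb_or => /and3P[].
have cx c : lower n i c -> c \notin x.
  move=> lc; apply/negP => /split_first[r1 [r2 [er _]]].
  have e1 : a = r1 ++ c :: r2 ++ i :: p ++ i :: q by rewrite ea er; cat_norm.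
  apply: (fcl_lower_pair n3 fa ile lc e1) => //.
  by move: ix; rewrite er mem_cat inE !negb_or => /and3P[].
have lo c : lower n i c -> index i a <= index c a.
  by move=> lc; rewrite leqNgt -(mem_prefix _ ea) // cx.
have c0a : c0 \in a by rewrite ea !(mem_cat, inE) c0p !orbT.
have up : index i a <= index i.+1 a.
  rewrite leqNgt; apply/negP => /top_upper[]//.
    by move=> iE; move: lc0; rewrite iE lowerE; [move=> /eqP<-|nlia].
  by move=> c /lo; rewrite leqNgt => /negP.
(* Again i comes before all its neighbours. For i = 2 a fork letter of p completes a reducible pair;
   for larger i the argument moves down to two letters i-1 in p. *)
have [i2|i3] : i = 2 \/ 3 <= i by nlia.
  subst i; have c02 : c0 < 2 by move: lc0; rewrite lower2.
  apply: (lil_three la (s := 2) (t := c0)) => //.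
  - exact: lower_adj.
  - by nlia.
  - by rewrite ltn_neqAle lo // andbT mem_index_neq //; have := lower_lt lc0; nlia.
  - by move=> r; rewrite adjE // => /orP[/lo|/eqP->].
  by move=> r; rewrite adj0 // => /eqP->; rewrite eqxx.
have lt1 : 1 < count_mem i.-1 p.
  by rewrite -(@eq_count _ (lower n i)) // => r; rewrite lowerE //; nlia.
have [p0 [p1 [p2 [ep ip0 ip1]]]] := split_two lt1.
have e1 : a = (x ++ i :: p0) ++ i.-1 :: p1 ++ i.-1 :: (p2 ++ i :: q).
  by rewrite ea ep; cat_norm.
have lowi : lower n i i.-1 by rewrite lowerE ?eqxx; nlia.
have nw : i.-1 \notin x ++ i :: p0.
  by rewrite mem_cat inE (negPf (cx _ lowi)) (negPf ip0) orbF; nlia.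
have i1n : 2 <= i.-1 <= n by nlia.
have i1a : i.-1 \in a by rewrite e1 !(mem_cat, inE) eqxx !orbT.
have ii1 : index i a < index i.-1 a.
  by rewrite ltn_neqAle lo // andbT mem_index_neq //; nlia.
have [||c lc] := top_upper i1n i1a.
- by nlia.
- by rewrite prednK //; nlia.
rewrite -(mem_prefix _ e1 nw) => /split_first[w1 [w2 [ew _]]].
have e2 : a = w1 ++ c :: w2 ++ i.-1 :: p1 ++ i.-1 :: (p2 ++ i :: q).
  by rewrite e1 ew; cat_norm.
apply: (fcl_lower_pair n3 fa i1n lc e2) => //.
  by move: nw; rewrite ew mem_cat inE !negb_or => /and3P[].
rewrite prednK; last nlia.
by apply: contra ip => ip1i; rewrite ep !(mem_cat, inE) ip1i !orbT.
Qed.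

End Tops.
End Alternating.

(** * Alternating and sparse words *)

Section AltSeq.
Variable T : eqType.
Implicit Types (a x p q : seq T) (o e : T).

Definition altseq o e k : seq T := o :: flatten (nseq k [:: e; o]).

(** Alternation leaves only the two ends open; the right end is read as the beginning of the
    reversed word. *)
Lemma filter_altseq a o e : o != e ->
  (forall x p q, a = x ++ o :: p ++ o :: q -> o \notin p -> e \in p) ->
  (forall x p q, a = x ++ e :: p ++ e :: q -> e \notin p -> o \in p) ->
  o \in a -> index o a < index e a -> index o (rev a) < index e (rev a) ->
  filter (pred2 o e) a = altseq o e (count_mem e a).
Proof.
move=> oe; have [m] := ubnP (size a); elim: m a => // m IH a am Ho He oa oi oi'.
have [x [y [ea ox]]] := split_first oa.
have ex : e \notin x.
  apply/negP => /split_first[x1 [x2 [ex ex1]]].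
  have e1 : a = x1 ++ e :: (x2 ++ o :: y) by rewrite ea ex; cat_norm.
  have := mem_prefix o e1 ex1; rewrite oi => ox1.
  by case/negP: ox; rewrite ex mem_cat ox1.
have fx : filter (pred2 o e) x = [::].
  apply/eqP; rewrite -(negbK (_ == _)) -has_filter; apply/hasPn => c cx /=.
  by rewrite negb_or; apply/andP; split; apply: contraTneq cx => ->.
rewrite ea filter_cat fx /= eqxx /= count_cat (count_memPn ex) add0n /=.
rewrite (negPf oe) add0n.
have [ey|ey] := boolP (e \in y); last first.
  have oy : o \notin y.
    apply/negP => /split_first[p [q [eyq op]]].
    have e1 : a = x ++ o :: p ++ o :: q by rewrite ea eyq.
    by case/negP: ey; rewrite eyq mem_cat (Ho _ _ _ e1 op).
  rewrite (count_memPn ey) /altseq /=; congr (_ :: _).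
  apply/eqP; rewrite -(negbK (_ == _)) -has_filter; apply/hasPn => c cx /=.
  by rewrite negb_or; apply/andP; split; apply: contraTneq cx => ->.
have [p [q [eyq ep]]] := split_first ey.
have op : o \notin p.
  apply/negP => /split_first[p1 [p2 [epp op1]]].
  have e1 : a = x ++ o :: p1 ++ o :: (p2 ++ e :: q) by rewrite ea eyq epp; cat_norm.
  by case/negP: ep; rewrite epp mem_cat (Ho _ _ _ e1 op1).
have eq1 : a = (x ++ o :: p ++ [:: e]) ++ q by rewrite ea eyq; cat_norm.
have fp : filter (pred2 o e) p = [::].
  apply/eqP; rewrite -(negbK (_ == _)) -has_filter; apply/hasPn => c cx /=.
  by rewrite negb_or; apply/andP; split; apply: contraTneq cx => ->.
have erev : rev a = rev q ++ e :: rev (x ++ o :: p).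
  by rewrite ea eyq !(rev_cat, rev_cons); cat_norm.
have oq : o \in q.
  apply/negPn/negP => oq; move: oi'; rewrite erev !index_cat !mem_rev (negPf oq) /= eqxx.
  rewrite (eq_sym e) (negPf oe) addn0; case: ifP => eq'.
    by rewrite ltnNge ltnW // ltn_addr // index_mem mem_rev.
  by rewrite ltnNge leq_addr.
have := IH q; rewrite eyq filter_cat fp /= eqxx orbT /= count_cat (count_memPn ep) /= eqxx.
move=> -> //.
- by move: am; rewrite eq1 !size_cat /= size_cat /=; nlia.
- move=> x' p' q' e'; apply: (Ho ((x ++ o :: p ++ [:: e]) ++ x') p' q').
  by rewrite eq1 e'; cat_norm.
- move=> x' p' q' e'; apply: (He ((x ++ o :: p ++ [:: e]) ++ x') p' q').
  by rewrite eq1 e'; cat_norm.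
- have [eq'|eq'] := boolP (e \in q); last exact: index_mem_lt.
  have [q1 [q2 [eqq eq1']]] := split_first eq'.
  have e1 : a = (x ++ o :: p) ++ e :: q1 ++ e :: q2 by rewrite eq1 eqq; cat_norm.
  by rewrite -(mem_prefix _ eqq) // (He _ _ _ e1 eq1').
move: oi'; rewrite erev !index_cat !mem_rev oq; case: ifP => // eq' _.
by rewrite index_mem_lt // mem_rev // eq'.
Qed.

End AltSeq.

(** * Full or sparse support *)

Section Trichotomy.
Variable n : nat.
Hypothesis n3 : 3 <= n.
Implicit Types (a b x y z p q u : seq nat) (c d e i j k o : nat).

Fixpoint candy3 c k : seq nat := if k is k'.+1 then [:: c, 2 & candy3 (1 - c) k'] else [:: c].

Lemma uniq_filter_lt2 x : count_mem 0 x <= 1 -> count_mem 1 x <= 1 ->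
  2 \notin x -> has (fun c => c < 2) x -> ~~ ((0 \in x) && (1 \in x)) ->
  exists2 c, c < 2 & filter (fun c => c < 3) x = [:: c].
Proof.
move=> c0 c1 x2 /hasP[c cx c2] nb; exists c => //.
have -> : filter (fun c => c < 3) x = filter (pred1 c) x.
  apply: eq_in_filter => d dx /=; apply/idP/eqP => [d3|->]; last by nlia.
  have d2 : d != 2 by apply: contraNneq x2 => <-.
  case: c c2 cx => [|[|]] // _ cx; case: d d3 d2 dx => [|[|[|]]] //= _ _ dx.
    by move: nb; rewrite cx dx.
  by move: nb; rewrite cx dx.
have cc : count_mem c x = 1.
  by apply/eqP; rewrite eqn_leq -has_count has_pred1 cx andbT; case: c c2 {cx} => [|[|]].
have -> : filter (pred1 c) x = nseq (count_mem c x) c; last by rewrite cc.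
by elim: (x) => //= d s ->; case: eqP => //= ->.
Qed.

(** Two equal fork letters enclose two letters 2. So each segment cut out by the letters 2 contains
    exactly one fork letter, and consecutive segments contain different ones. *)
Lemma filter_candy3 a :
  (forall x p q, a = x ++ 2 :: p ++ 2 :: q -> 2 \notin p -> has (fun c => c < 2) p) ->
  (forall x c p q, a = x ++ c :: p ++ c :: q -> c < 2 -> c \notin p -> 1 < count_mem 2 p) ->
  2 \in a -> (exists2 c, c < 2 & index c a < index 2 a) ->
  (exists2 c, c < 2 & index c (rev a) < index 2 (rev a)) ->
  exists2 c, c < 2 & filter (fun c => c < 3) a = candy3 c (count_mem 2 a).
Proof.
have [m] := ubnP (size a); elim: m a => // m IH a am H2 Hc a2 [cf cf2 cfi] [cl cl2 cli].
have [x [y [ea x2]]] := split_first a2.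
have erev : rev a = rev y ++ 2 :: rev x by rewrite ea !(rev_cat, rev_cons); cat_norm.
have ly : cl \in y.
  apply/negPn/negP => ly; move: cli; rewrite erev !index_cat !mem_rev (negPf ly) /=.
  have -> : 2 == cl = false by nlia.
  case: ifP => y2; last by rewrite ltnNge addn0 leq_addr.
  by rewrite ltnNge ltnW // ltn_addr // index_mem mem_rev.
have no_gap x' c p q : a = x' ++ c :: p ++ c :: q -> c < 2 -> count_mem 2 p <= 1 ->
    False.
  move=> e c2 p2; have [cp|cp] := boolP (c \in p); last first.
    by have := Hc _ _ _ _ e c2 cp; rewrite ltnNge p2.
  have [p1 [q1 [ep cp1]]] := split_first cp.
  have e1 : a = x' ++ c :: p1 ++ c :: (q1 ++ c :: q) by rewrite e ep; cat_norm.
  have := Hc _ _ _ _ e1 c2 cp1; move: p2; rewrite ep count_cat; nlia.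
have cnt1 c s t r : c < 2 -> a = s ++ t ++ r -> 2 \notin t -> count_mem c t <= 1.
  move=> c2 es t2; rewrite leqNgt; apply/negP => /split_two[s1 [p [q [et _ _]]]].
  apply: (no_gap (s ++ s1) c p (q ++ r)) => //; first by rewrite es et; cat_norm.
  by move: t2; rewrite et !(mem_cat, inE, negb_or) => /and5P[_ _ /count_memPn-> _ _].
have hl : has (fun c => c < 2) y by apply/hasP; exists cl.
have [r [s [e [ey re e2]]]] :
    exists r s e, [/\ y = r ++ e :: s, ~~ has (fun c => c < 2) r & e < 2].
  elim: (y) hl => //= d t IHt; have [d2 _|d2] := ltnP d 2.
    by exists [::], t, d.
  move=> /IHt[r [s [e [-> re e2]]]]; exists (d :: r), s, e; split=> //=.
  by rewrite negb_or re -leqNgt d2.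
have r2 : 2 \notin r.
  apply/negP => /split_first[r1 [r' [er r12]]].
  have e1 : a = x ++ 2 :: r1 ++ 2 :: (r' ++ e :: s) by rewrite ea ey er; cat_norm.
  have := H2 _ _ _ e1 r12; apply/negP; move: re; rewrite er has_cat negb_or.
  by case/andP.
have nex : e \notin x.
  apply/negP => /split_first[x1 [x' [ex _]]].
  apply: (no_gap x1 e (x' ++ 2 :: r) s) => //; first by rewrite ea ey ex; cat_norm.
  move: x2; rewrite ex !(mem_cat, inE, negb_or) => /and3P[_ _ /count_memPn x20].
  by rewrite count_cat /= x20 (count_memPn r2).
have [c c2 fx] : exists2 c, c < 2 & filter (fun c => c < 3) x = [:: c].
  have ea' : a = [::] ++ x ++ (2 :: y) by [].
  apply: uniq_filter_lt2 => //.
  - exact: (cnt1 0 _ _ _ isT ea' x2).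
  - exact: (cnt1 1 _ _ _ isT ea' x2).
  - by apply/hasP; exists cf => //; rewrite (mem_prefix _ ea).
  - by case: (e) e2 nex => [|[|]] // _ /negPf->; rewrite ?andbF.
have cx : c \in x.
  suff : c \in filter (fun c => c < 3) x by rewrite mem_filter => /andP[].
  by rewrite fx inE.
exists c => //; rewrite ea filter_cat fx count_cat (count_memPn x2) /=.
have [y2|y2] := boolP (2 \in y); last first.
  rewrite (count_memPn y2) /=; congr [:: _, _ & _].
  have ea' : a = (x ++ [:: 2]) ++ y ++ [::] by rewrite ea cats0; cat_norm.
  have ncy : c \notin y.
    apply/negP => /split_first[y1 [y' [eyy _]]].
    have [x1 [x' [ex _]]] := split_first cx.
    apply: (no_gap x1 c (x' ++ 2 :: y1) y') => //; first by rewrite ea eyy ex; cat_norm.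
    move: x2 y2; rewrite ex eyy !(mem_cat, inE, negb_or) => /and3P[_ _ /count_memPn x20].
    by move=> /and3P[/count_memPn y20 _ _]; rewrite count_cat /= x20 y20.
  have [d d2 fy] : exists2 d, d < 2 & filter (fun c => c < 3) y = [:: d].
    apply: uniq_filter_lt2 => //.
    - exact: (cnt1 0 _ _ _ isT ea' y2).
    - exact: (cnt1 1 _ _ _ isT ea' y2).
    - by case: (c) c2 ncy => [|[|]] // _ /negPf->; rewrite ?andbF.
  rewrite fy; congr [:: _].
  have dy : d \in filter (fun c => c < 3) y by rewrite fy inE.
  have : d != c by apply: contraNneq ncy => <-; move: dy; rewrite mem_filter => /andP[].
  by nlia.
have [d d2 fy] : exists2 d, d < 2 & filter (fun c => c < 3) y = candy3 d (count_mem 2 y).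
  apply: IH => //.
  - by move: am; rewrite ea size_cat /=; nlia.
  - move=> x' p q e'; apply: (H2 (x ++ 2 :: x') p q).
    by rewrite ea e'; cat_norm.
  - move=> x' c' p q e'; apply: (Hc (x ++ 2 :: x') c' p q).
    by rewrite ea e'; cat_norm.
  - have [y1 [y' [eyy y12]]] := split_first y2.
    have e1 : a = x ++ 2 :: y1 ++ 2 :: y' by rewrite ea eyy.
    have /hasP[c' c'y c'2] := H2 _ _ _ e1 y12.
    by exists c' => //; rewrite -(mem_prefix _ eyy).
  exists cl => //; move: cli; rewrite erev !index_cat !mem_rev ly y2.
  by [].
rewrite fy /=; congr [:: _, _ & candy3 _ _].
have : d != c; last by nlia.
have dE : d = e.
  move: fy; rewrite ey filter_cat /= (_ : e < 3); last nlia.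
  have -> : filter (fun c => c < 3) r = [::].
    apply/eqP; rewrite -(negbK (_ == _)) -has_filter; apply/hasPn => d' d'r.
    have := hasPn re d' d'r; have : d' != 2 by apply: contraNneq r2 => <-.
    by nlia.
  by case: (count_mem 2 _) => [|k] /= [].
by rewrite dE; apply: contraNneq nex => ->.
Qed.

Section Word.
Variable a : seq nat.
Hypotheses (fa : fc_local n a) (la : li_local n a) (la' : li_local n (rev a)).
Hypotheses (nr : ~ rises a) (nf : ~ falls n a).

Let fa' : fc_local n (rev a). Proof. exact: fc_local_rev. Qed.

Let nr' : ~ rises (rev a).
Proof. by move=> h; have [] := zig_rev n3 fa la la' (or_introl h). Qed.

Let nf' : ~ falls n (rev a).
Proof. by move=> h; have [] := zig_rev n3 fa la la' (or_intror h). Qed.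

Let returns := no_returns n3 fa la nr nf.

(** If r comes before c from both ends, the occurrences of r nearest to the first c on either side
    enclose it. *)
Lemma surround r c : c \in a -> index r a < index c a ->
  index r (rev a) < index c (rev a) ->
  exists x p q, [/\ a = x ++ r :: p ++ r :: q, r \notin p & c \in p].
Proof.
move=> ca rc rc'; have [x [y [ea cx]]] := split_first ca.
have rx : r \in x by rewrite (mem_prefix _ ea).
have nrc : r != c by apply: contraTneq rc => ->; rewrite ltnn.
have ry : r \in y.
  apply/negPn/negP => ry; move: rc'.
  have -> : rev a = rev y ++ c :: rev x by rewrite ea !(rev_cat, rev_cons); cat_norm.
  rewrite !index_cat !mem_rev (negPf ry) /= eqxx eq_sym (negPf nrc).
  case: ifP => cy; last by rewrite ltnNge addn0 leq_addr.
  by rewrite ltnNge ltnW // ltn_addr // index_mem mem_rev.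
have [x1 [x2 [ex rx2]]] := split_last rx.
have [y1 [y2 [ey ry1]]] := split_first ry.
exists x1, (x2 ++ c :: y1), y2; split.
- by rewrite ea ex ey; cat_norm.
- by rewrite mem_cat inE !negb_or rx2 ry1 nrc.
- by rewrite mem_cat inE eqxx orbT.
Qed.

(** Without r+1, [top_lower] makes r precede c from both ends; then two letters r enclose c, and
    [returns] puts an r+1 between them. *)
Lemma upper_mem r c : 2 <= r <= n -> r \in a -> lower n r c -> c \in a -> r.+1 \in a.
Proof.
move=> rn ra lc ca; apply/negPn/negP => r1a.
have ge b : (r.+1 \in b) = (r.+1 \in a) -> index r.+1 b = size b.
  by move=> E; rewrite memNindex // E.
have rc : index r a < index c a.
  rewrite ltn_neqAle mem_index_neq //; last by have := lower_lt lc; nlia.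
  rewrite leqNgt; apply: contra r1a => cr.
  exact: index_lt_mem (top_lower n3 la nr rn ra lc cr).
have rc' : index r (rev a) < index c (rev a).
  rewrite ltn_neqAle mem_index_neq ?mem_rev //; last by have := lower_lt lc; nlia.
  rewrite leqNgt; apply: contra r1a => cr; rewrite -mem_rev.
  by apply: index_lt_mem (top_lower n3 la' nr' rn _ lc cr); rewrite mem_rev.
have [x [p [q [ea rp _]]]] := surround ca rc rc'.
have [_ rp1] := returns rn ea rp.
by case/negP: r1a; rewrite ea !(mem_cat, inE) rp1 !orbT.
Qed.

Lemma lower_mem l : 2 <= l < n -> l \in a -> l.+1 \in a -> has (lower n l) a.
Proof.
move=> ln ra l1a; apply/negPn/negP => /hasPn lo; have ln' : 2 <= l <= n by nlia.
have vac b : l = n -> n.-1 \in b by nlia.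
have ra' : l \in rev a by rewrite mem_rev.
have rc : index l a < index l.+1 a.
  rewrite ltn_neqAle mem_index_neq //; last by nlia.
  rewrite leqNgt; apply/negP => /(top_upper n3 la nf ln' ra (vac _))[c lc /index_lt_mem ca].
  by have := lo c ca; rewrite lc.
have rc' : index l (rev a) < index l.+1 (rev a).
  rewrite ltn_neqAle mem_index_neq ?mem_rev //; last by nlia.
  rewrite leqNgt; apply/negP => /(top_upper n3 la' nf' ln' ra' (vac _))[c lc /index_lt_mem ca].
  by have := lo c; rewrite lc -mem_rev => /(_ ca).
have [x [p [q [ea rp _]]]] := surround l1a rc rc'.
have [/hasP[c cp lc] _] := returns ln' ea rp.
by have := lo c; rewrite lc ea !(mem_cat, inE) cp !orbT => /(_ isT).
Qed.

Lemma fork_first b c : li_local n b -> ~ falls n b -> 2 \in b -> c \in b -> c < 2 ->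
  exists2 d, d < 2 & index d b < index 2 b.
Proof.
move=> lb nfb b2 bc c2; apply: contrapT => nex.
have lo d : d < 2 -> index 2 b <= index d b.
  by move=> d2; rewrite leqNgt; apply/negP => dlt; apply: nex; exists d.
have [up|up] := ltnP (index 3 b) (index 2 b).
  have vac : 2 = n -> n.-1 \in b by nlia.
  have n2 : 2 <= 2 <= n by nlia.
  have [d ld di] := top_upper n3 lb nfb n2 b2 vac up.
  by apply: nex; exists d; rewrite // -(lower2 n).
apply: (lil_three lb (s := 2) (t := c)) => //.
- by rewrite /adj; nlia.
- by nlia.
- by rewrite ltn_neqAle lo // andbT mem_index_neq //; nlia.
- by move=> r; rewrite adjE ?lower2; [move=> /orP[/lo|/eqP->] | nlia].
by move=> r; rewrite adj0 // => /eqP->; rewrite eqxx.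
Qed.

(** If the other fork letter is missing, c precedes 2 from both ends. Two consecutive letters c then
    enclose two letters 2, between which [returns] demands a fork letter. *)
Lemma fork_both c : 2 \in a -> c < 2 -> c \in a -> 1 - c \in a.
Proof.
move=> a2 c2 ca; apply/negPn/negP => da.
have only b d : (b =i a) -> d < 2 -> index d b < index 2 b -> d = c.
  move=> ba d2 /index_lt_mem; rewrite ba => dain.
  have : d != 1 - c by apply: contraNneq da => <-.
  by nlia.
have c2i : index c a < index 2 a.
  by have [d d2 di] := fork_first la nf a2 ca c2; rewrite -(only a d).
have c2i' : index c (rev a) < index 2 (rev a).
  have [||d d2 di] := fork_first la' nf' _ _ c2; rewrite ?mem_rev //.
  by rewrite -(only (rev a) d) // => e; rewrite mem_rev.
have [x [p [q [ea cp _]]]] := surround a2 c2i c2i'.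
have cn : c < n by nlia.
have := fcl_two fa ea cp cn.
rewrite (@eq_count _ _ (pred1 2)); last by move=> r /=; rewrite adj0.
move=> /split_two[p0 [p1 [p2 [ep _ p12]]]].
have e1 : a = (x ++ c :: p0) ++ 2 :: p1 ++ 2 :: (p2 ++ c :: q).
  by rewrite ea ep; cat_norm.
have [|/hasP[d dp d2] _] := returns _ e1 p12; first by nlia.
move: d2; rewrite lower2 => d2.
have : d != c by apply: contraNneq cp => <-; rewrite ep !(mem_cat, inE) dp !orbT.
have : d != 1 - c.
  by apply: contraNneq da => <-; rewrite e1 !(mem_cat, inE) dp !orbT.
by nlia.
Qed.

Lemma full_support i : 2 <= i < n -> i \in a -> i.+1 \in a ->
  forall j, j <= n.+1 -> j \in a.
Proof.
move=> iltn ia i1a.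
have up k : i + k <= n -> (i + k \in a) && (i + k.+1 \in a).
  elim: k => [|k IH] kn; first by rewrite addn0 addn1 ia i1a.
  have /andP[h1 h2] := IH ltac:(nlia).
  rewrite h2 !addnS; apply: (@upper_mem (i + k).+1 (i + k)); rewrite -?addnS //; try nlia.
  by rewrite lowerE; nlia.
have down k : k <= i - 2 -> (i - k \in a) && ((i - k).+1 \in a).
  elim: k => [|k IH] ki; first by rewrite subn0 ia i1a.
  have /andP[h1 h2] := IH ltac:(nlia).
  have /hasP[c ca] := lower_mem (l := i - k) ltac:(nlia) h1 h2.
  rewrite lowerE; last nlia.
  move=> /eqP ec; rewrite subnS -ec ca ec prednK //; nlia.
have a2 : 2 \in a by have /andP[+ _] := down (i - 2) (leqnn _); rewrite subKn //; nlia.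
have a3 : 3 \in a by have /andP[_ +] := down (i - 2) (leqnn _); rewrite subKn //; nlia.
have /hasP[c ca] := lower_mem (l := 2) ltac:(nlia) a2 a3; rewrite lower2 => c2.
have da := fork_both a2 c2 ca.
move=> j jn; have [j2|[ji|ij]] : j < 2 \/ 2 <= j <= i \/ i < j by nlia.
- have [->//|->//] : j = c \/ j = 1 - c by nlia.
- by have /andP[+ _] := down (i - j) ltac:(nlia); rewrite subKn //; nlia.
- have /andP[_ +] := up (j - i.+1) ltac:(nlia).
  by rewrite (_ : i + (j - i.+1).+1 = j) //; nlia.
Qed.

(** Any adjacent pair other than n, n+1 spreads over the whole diagram; a pair at the fork first
    yields the pair 2, 3. Without such a pair no letter can return. *)
Lemma full_or_sparse :
  (forall j, j <= n.+1 -> j \in a) \/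
  [/\ uniq a, {in a &, forall i j, adj n i j -> (n <= i) && (n <= j)}
    & n \in a -> n.-1 \notin a].
Proof.
have [[i [iltn ia i1a]]|nex] := pselect (exists i, [/\ 2 <= i < n, i \in a & i.+1 \in a]).
  by left; apply: full_support iltn ia i1a.
right; have succ i : 2 <= i < n -> i \in a -> i.+1 \in a -> False.
  by move=> *; apply: nex; exists i.
have n1a : n \in a -> n.-1 \notin a.
  move=> na; apply/negP => n1a; apply: (succ n.-1) => //; first by nlia.
  by rewrite prednK //; nlia.
have fork2 c : c < 2 -> c \in a -> 2 \in a -> False.
  move=> c2 ca a2; apply: (succ 2) => //; apply: (@upper_mem 2 c) => //; first by nlia.
  by rewrite lower2.
have sp : {in a &, forall i j, adj n i j -> (n <= i) && (n <= j)}.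
  have H i j : i \in a -> j \in a -> i < j -> adj n i j -> (n <= i) && (n <= j).
    move=> ia ja ij; have [i2|i2] := ltnP i 2.
      by rewrite adj0 // => /eqP j2; case: (fork2 i); rewrite // -j2.
    move=> aij; have {aij} jE : j = i.+1.
      by move: aij; rewrite /adj; nlia.
    subst j; have [iltn|] := ltnP i n; last by nlia.
    by case: (succ i); rewrite ?i2.
  move=> i j ia ja aij; have [ij|ij|ij] := ltngtP i j; first exact: H.
    by rewrite andbC; apply: H; rewrite // adjC.
  by subst j; move: aij; rewrite /adj; nlia.
split=> //; apply: count_mem_uniq => c; have [ca|/count_memPn//] := boolP (c \in a).
have cle := fcl_le fa ca.
have small d : d <= n -> d \in a -> count_mem d a = 1.
  move=> dn da; apply: count1P => // x p q ea _ dp.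
  have [/hasP[r rp adr]|dE] : has (adj n d) p \/ d = n.
    have [dltn|] := ltnP d n; last by nlia.
    by left; rewrite has_count; apply: ltnW (fcl_two fa ea dp dltn).
    have ra : r \in a by rewrite ea !(mem_cat, inE) rp !orbT.
    have := sp d r da ra adr => /andP[nd _].
    have dE : d = n by nlia.
    subst d; have [|/hasP[c' c'p lc] _] := returns _ ea dp; first by nlia.
    move: lc; rewrite lowerE; last nlia.
    by move=> /eqP cE; move: (n1a da); rewrite -cE ea !(mem_cat, inE) c'p !orbT.
  subst d; have [|/hasP[c' c'p lc] _] := returns _ ea dp; first by nlia.
  move: lc; rewrite lowerE; last nlia.
  by move=> /eqP cE; move: (n1a da); rewrite -cE ea !(mem_cat, inE) c'p !orbT.
have [cn|cE] : c <= n \/ c = n.+1 by nlia.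
  exact: small.
(* Two letters n+1 would enclose the only n. Prepending n then gives the braid n, n+1, n, n+1, with
   n-1 absent. *)
subst c; apply: count1P => // x p q ea n1x n1p.
have np := fcl_n1 fa ea; have [p1 [p2 [ep np1]]] := split_first np.
have na : n \in a by rewrite ea !(mem_cat, inE) np !orbT.
have := small n (leqnn n) na; rewrite ea ep !(count_cat, inE) /= !count_cat /= eqxx.
move=> cn; have nx : n \notin x by apply/count_memPn; nlia.
have np2 : n \notin p2 by apply/count_memPn; nlia.
have e1 : a = (x ++ n.+1 :: p1) ++ n :: (p2 ++ n.+1 :: q) by rewrite ea ep; cat_norm.
have nw : n \notin x ++ n.+1 :: p1.
  by rewrite mem_cat inE (negPf nx) (negPf np1) orbF; nlia.
have f : fc_local n (n :: a).
  apply: (lil_n1 la) => //; last by rewrite ltnW // index_mem_lt // n1a.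
  by rewrite -(mem_prefix _ e1 nw) mem_cat inE eqxx orbT.
have e2 : n :: a = [::] ++ n :: x ++ n.+1 :: p1 ++ n :: p2 ++ n.+1 :: q.
  by rewrite e1; cat_norm.
have := fcl_br f e2; move: n1p; rewrite ep !(mem_cat, inE, negb_or) nx np1 np2 n1x.
move=> /and3P[-> _ ->] /(_ isT isT) H.
by move: (n1a na); rewrite e1 !(mem_cat, inE) !negb_or => /and3P[/andP[h1 /andP[_ h2]] _ _]; move: H; rewrite (negPf h1) (negPf h2).
Qed.

Section Full.
Hypothesis full : forall j, j <= n.+1 -> j \in a.

(** Parity enters here: a fork letter precedes 2, hence 3 precedes 2, hence 4 cannot precede 3, and
    so on upwards. Applied to a and to its reverse, this fixes both ends of every projection. *)
Lemma full_tops b i : b =i a -> li_local n b -> ~ rises b -> ~ falls n b ->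
  2 <= i <= n -> if odd i then index i b < index i.+1 b else index i.+1 b < index i b.
Proof.
move=> ba lb nrb nfb; have fb j : j <= n.+1 -> j \in b by move=> /full; rewrite ba.
elim: i => // i IH; have [i1 ile|i2 ile] : i <= 1 \/ 2 <= i by nlia.
  have {i1 IH ile} -> : i = 1 by nlia.
  have b0 : 0 \in b by apply: fb.
  have b2 : 2 \in b by apply: fb; nlia.
  have [d d2 di] := fork_first lb nfb b2 b0 isT.
  by apply: (top_lower n3 lb nrb _ b2 _ di); rewrite ?lower2 //; nlia.
have bi : i.+1 \in b by apply: fb; nlia.
have i2n : i.+1 < n.+1 by nlia.
have {}ile : 2 <= i.+1 <= n by nlia.
have low : lower n i.+1 i by rewrite lowerE //; nlia.
have := IH ltac:(nlia); rewrite /=; case: (odd i) => /= ii.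
  exact: (top_lower n3 lb nrb ile bi low ii).
rewrite ltn_neqAle mem_index_neq //; last by nlia.
rewrite leqNgt; apply/negP => /(top_upper n3 lb nfb ile bi)[].
  by move=> _; apply: fb; nlia.
move=> c; rewrite lowerE; last nlia.
by move=> /eqP->; rewrite ltnNge ltnW.
Qed.

Lemma count_altseq o e k : o != e ->
  count_mem o (altseq o e k) = k.+1 /\ count_mem e (altseq o e k) = k.
Proof.
move=> oe; rewrite /altseq /= eqxx (negPf oe); elim: k => //= k [IH1 IH2].
by rewrite !eqxx (negPf oe) (eq_sym e) (negPf oe); split; nlia.
Qed.

Lemma full_alternating i : 2 <= i <= n ->
  let o := if odd i then i else i.+1 in let e := if odd i then i.+1 else i in
  filter (pred2 o e) a = altseq o e (count_mem 2 a).
Proof.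
have alt j : 2 <= j <= n ->
    let o := if odd j then j else j.+1 in let e := if odd j then j.+1 else j in
    o != e /\ filter (pred2 o e) a = altseq o e (count_mem e a).
  move=> jn o e; have oe : o != e by rewrite /o /e; case: ifP; nlia.
  split=> //.
  have Hj x p q : a = x ++ j :: p ++ j :: q -> j \notin p -> j.+1 \in p.
    by move=> ea jp; have [_ ->] := returns jn ea jp.
  have Hj1 x p q : a = x ++ j.+1 :: p ++ j.+1 :: q -> j.+1 \notin p -> j \in p.
    move=> ea jp; have [jE|jlt] : j = n \/ j < n by nlia.
      by move: ea; rewrite jE => /(fcl_n1 fa).
    have j1n : 2 <= j.+1 <= n by nlia.
    have [/hasP[c cp lc] _] := returns j1n ea jp.
    by move: lc; rewrite lowerE; [move=> /eqP /= <-|nlia].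
  have tj := full_tops (fun=> erefl) la nr nf jn.
  have tj' : if odd j then index j (rev a) < index j.+1 (rev a)
             else index j.+1 (rev a) < index j (rev a).
    by apply: full_tops => //; move=> c; rewrite mem_rev.
  have ja : j \in a by apply: full; nlia.
  have ja1 : j.+1 \in a by apply: full; nlia.
  by rewrite /o /e in oe *; move: oe tj tj'; case: ifP => _ *; apply: filter_altseq.
have cnt (j : nat) : 2 <= j <= n ->
    let o := if odd j then j else j.+1 in let e := if odd j then j.+1 else j in
    count_mem o a = (count_mem e a).+1.
  move=> jn o e; have [oe fE] := alt j jn.
  have [c1 _] := count_altseq (count_mem e a) oe.
  rewrite -c1 -fE count_filter; apply: eq_count => r /=.
  by case: eqP => //= ->; rewrite eqxx.
(* Each odd letter occurs once more than an even neighbour, and consecutive pairs share a letter; so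
   all even letters occur equally often. *)
suff ck j : 2 <= j <= n -> count_mem (if odd j then j.+1 else j) a = count_mem 2 a.
  by move=> ile; have [_ fE] := alt i ile; rewrite /= -(ck i ile).
elim: j => // j IH; have [j1 jn|j2 jn] : j <= 1 \/ 2 <= j by nlia.
  by have -> : j.+1 = 2 by nlia.
have := IH ltac:(nlia); have := cnt j ltac:(nlia); have := cnt j.+1 jn.
by rewrite /=; case: (odd j) => //= -> [->].
Qed.

Lemma full_candy : exists2 c, c < 2 & filter (fun c => c < 3) a = candy3 c (count_mem 2 a).
Proof.
have a2 : 2 \in a by apply: full; nlia.
have a0 : 0 \in a by apply: full.
have n2 : 2 <= 2 <= n by nlia.
apply: filter_candy3 => //.
- move=> x p q ea p2; have [/hasP[c cp lc] _] := returns n2 ea p2.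
  by apply/hasP; exists c; rewrite // -(lower2 n).
- move=> x c p q ea c2 cp; have cn : c < n by nlia.
  have := fcl_two fa ea cp cn.
  by rewrite (@eq_count _ _ (pred1 2)) // => r /=; rewrite adj0.
- exact: fork_first a2 a0 isT.
- by apply: (fork_first la' nf' _ _ (c := 0)); rewrite ?mem_rev.
Qed.

End Full.

End Word.
End Trichotomy.

(** * From words to group elements *)

Section SingleLetters.
Variable n : nat.
Hypothesis n3 : 3 <= n.
Implicit Types (a b x y z p q : seq nat) (c d i j s t r : nat).

Lemma adj_neq s t : adj n s t -> s != t.
Proof. by rewrite /adj; nlia. Qed.

(* The word a is s t ... up to commutations. *)
Definition head_pair a s t : Prop := exists x y z,
  [/\ a = x ++ s :: y ++ t :: z, {in x, forall r, (r != s) && ~~ adj n s r}, s \notin y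
    & {in x ++ y, forall r, (r != t) && ~~ adj n t r}].

(** The inequalities of [li_local] concern first occurrences and do not prevent s from recurring
    before t, in which case t could not be moved next to the first s. The work is to exclude
    this. *)
Lemma li_of_single a : fc_local n a ->
  (forall s t, adj n s t -> head_pair a s t -> fc_local n (t :: a)) -> li_local n a.
Proof.
move=> fa G.
(* Across a simple bond the two letters t of [t :: a] would enclose s as their only neighbour. *)
have hp3 s t : adj n s t -> (s < n) || (t < n) -> head_pair a s t -> False.
  move=> st stn hp; have f := G s t st hp; case: hp => [x [y [z [ea xs sy xy]]]].
  have e : t :: a = [::] ++ t :: (x ++ s :: y) ++ t :: z by rewrite ea; cat_norm.
  have nbr r : r \in x ++ s :: y -> adj n t r -> r = s.
    rewrite !(mem_cat, inE) => rxy tr; apply/eqP.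
    case: (r =P s) rxy => //= _; rewrite -mem_cat => /xy.
    by rewrite tr andbF.
  have tn : t \notin x ++ s :: y.
    rewrite mem_cat inE !negb_or eq_sym adj_neq //=.
    by apply/andP; split; apply/negP => h; have := xy t; rewrite mem_cat h ?orbT eqxx => /(_ isT).
  have sx : s \notin x by apply/negP => /xs; rewrite eqxx.
  have c1 : count_mem s (x ++ s :: y) = 1.
    by rewrite count_cat /= eqxx (count_memPn sx) (count_memPn sy).
  have [tn'|tn'] := ltnP t n.
    have := fcl_two f e tn tn'; rewrite ltnNge -c1 count_adj1 //.
  have [tE sE] : t = n /\ s = n.-1.
    by move: st stn; rewrite /adj; have := fcl_le f (mem_head _ _); nlia.
  subst t s; have n1 : n.+1 \notin x ++ n.-1 :: y.
    apply/negP => /nbr; rewrite /adj => /(_ ltac:(nlia)); nlia.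
  by have := fcl_n f e tn n1; rewrite c1.
(* A second s before t would enclose other neighbours of s. The first of them forms a forbidden
   front pair with s, or the gap shows a pattern already excluded by full commutativity. *)
have single s t x p q : adj n s t -> a = x ++ s :: p ++ s :: q ->
    {in x, forall r, (r != s) && ~~ adj n s r} -> s \notin p -> t \notin x -> t \notin p -> False.
  move=> st ea xs sp tx tp.
  have sx : s \notin x by apply/negP => /xs; rewrite eqxx.
  have sa : s \in a by rewrite ea mem_cat inE eqxx orbT.
  have sle := fcl_le fa sa.
  have [s2|s2] : s < 2 \/ 2 <= s by nlia.
    have sn : s < n by nlia.
    have := fcl_two fa ea sp sn; rewrite (@eq_count _ _ (pred1 2)) //.
      move: st; rewrite adj0 // => /eqP tE; subst t.
      by rewrite (count_memPn tp).
    by move=> r; rewrite /= adj0.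
  have hp r : r \in p -> adj n s r ->
      (forall c, c \in x ++ s :: p -> adj n r c -> c = s) -> head_pair a s r.
    move=> rp sr H; have [p1 [p2 [ep rp1]]] := split_first rp.
    exists x, p1, (p2 ++ s :: q); split.
    - by rewrite ea ep; cat_norm.
    - exact: xs.
    - by apply: contra sp; rewrite ep mem_cat => ->.
    move=> c cxp; have rc : c != r.
      apply/eqP => cE; move: cxp; rewrite cE mem_cat (negPf rp1) orbF => /xs.
      by rewrite sr andbF.
    rewrite rc /=; apply/negP => adrc; have cE : c = s.
      apply: H adrc; move: cxp; rewrite !(mem_cat, inE) ep !(mem_cat, inE).
      by case/orP=> ->; rewrite ?orbT.
    move: cxp; rewrite cE mem_cat (negPf sx) /= => h.
    by case/negP: sp; rewrite ep mem_cat h.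
  have [sE|sn] : s = n.+1 \/ s <= n by nlia.
    have := fcl_n1 fa; rewrite -sE => /(_ _ _ _ ea) np.
    have tE : t = n by move: st; rewrite sE /adj; nlia.
    by rewrite -tE (negPf tp) in np.
  have sn2 : 2 <= s <= n by rewrite s2.
  have xl c : lower n s c -> c \notin x.
    by move=> lc; apply/negP => /xs; rewrite (lower_adj lc) andbF.
  have xu : s.+1 \notin x by apply/negP => /xs; rewrite adjE // eqxx orbT andbF.
  have no_low : ~~ has (lower n s) p -> False.
    move=> lp; have [s1p s1p2] := fcl_no_lower n3 fa sn2 ea sp lp.
    have [sE|sn'] : s = n \/ s < n by nlia.
      subst s; have h : head_pair a n n.+1.
        have ann : adj n n n.+1 by rewrite /adj; nlia.
        apply: (hp _ s1p ann) => c cxp; have cn : c <= n.+1.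
          by apply: (fcl_le fa); move: cxp; rewrite ea !(mem_cat, inE) => /or3P[]->; rewrite ?orbT.
        by rewrite /adj; nlia.
      have f := G _ _ _ h; have {}f := f ltac:(rewrite /adj; nlia).
      have e : n.+1 :: a = [::] ++ n.+1 :: x ++ n :: p ++ n :: q by rewrite ea.
      have := fcl_n_split f e sx sp => n1p.
      by case/negP: lp; apply/hasP; exists n.-1; rewrite // lowerE ?eqxx; nlia.
    have [p0 [p1 [p2 [ep ip0 ip1]]]] := split_two (s1p2 sn').
    have s1n : 2 <= s.+1 <= n by nlia.
    have e1 : a = (x ++ s :: p0) ++ s.+1 :: p1 ++ s.+1 :: (p2 ++ s :: q).
      by rewrite ea ep; cat_norm.
    have sp1 : s \notin p1 by move: sp; rewrite ep !(mem_cat, inE, negb_or) => /and5P[].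
    have lp1 : ~~ has (lower n s.+1) p1.
      apply/hasPn => c cp1; rewrite lowerE; last nlia.
      by apply: contraNneq sp1 => /= <-.
    have [h|h] := boolP (s.+2 \in x ++ s :: p0).
      have [w1 [w2 [ew _]]] := split_first h.
      have e2 : a = w1 ++ s.+2 :: w2 ++ s.+1 :: p1 ++ s.+1 :: (p2 ++ s :: q).
        by rewrite e1 ew; cat_norm.
      apply: (fcl_succ_pair n3 fa s1n e2) => //.
      have : s.+1 \notin x ++ s :: p0 by rewrite mem_cat inE (negPf xu) (negPf ip0) orbF; nlia.
      by rewrite ew mem_cat inE !negb_or => /and3P[].
    apply: (hp3 s s.+1); rewrite ?sn' //; first by rewrite adjE // eqxx orbT.
    exists x, p0, (p1 ++ s.+1 :: p2 ++ s :: q); split=> //.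
    - by rewrite ea ep; cat_norm.
    - by move: sp; rewrite ep mem_cat negb_or => /andP[].
    move=> c cxp; have cxsp : c \in x ++ s :: p0.
      by move: cxp; rewrite !(mem_cat, inE) => /orP[]->; rewrite ?orbT.
    have cs : c != s.+1.
      by apply: contraTneq cxp => ->; rewrite mem_cat negb_or xu.
    have cs2 : c != s.+2 by apply: contraNneq h => <-.
    have cs0 : c != s.
      apply: contraTneq cxp => ->; rewrite mem_cat negb_or sx.
      by move: sp; rewrite ep mem_cat negb_or => /andP[].
    by rewrite cs /= adjE // lowerE ?negb_or ?cs2 ?cs0 //; nlia.
  have [tE|lt] : t = s.+1 \/ lower n s t by move: st; rewrite adjE // => /orP[|/eqP]; [right|left].
    subst t; have l2 := fcl_no_upper n3 fa sn2 ea sp tp.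
    have [s2E|s3] : s = 2 \/ 3 <= s by nlia.
      subst s; have /hasP[c cp lc] : has (lower n 2) p by rewrite has_count; nlia.
      apply: (hp3 2 c); rewrite ?(lower_adj lc) //; first by nlia.
      apply: (hp c cp (lower_adj lc)) => d _.
      by rewrite adj0 -?(lower2 n) // => /eqP.
    have lt1 : 1 < count_mem s.-1 p.
      by rewrite -(@eq_count _ (lower n s)) // => r; rewrite lowerE //; nlia.
    have [p0 [p1 [p2 [ep ip0 ip1]]]] := split_two lt1.
    have s1n : 2 <= s.-1 <= n by nlia.
    have lows : lower n s s.-1 by rewrite lowerE ?eqxx; nlia.
    have e1 : a = (x ++ s :: p0) ++ s.-1 :: p1 ++ s.-1 :: (p2 ++ s :: q).
      by rewrite ea ep; cat_norm.
    have nw : s.-1 \notin x ++ s :: p0.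
      by rewrite mem_cat inE (negPf (xl _ lows)) (negPf ip0) orbF; nlia.
    have sp1 : s.-1.+1 \notin p1.
      by rewrite prednK; [move: sp; rewrite ep !(mem_cat, inE, negb_or) => /and5P[]|nlia].
    have [/hasP[c cw lc]|/hasPn h] := boolP (has (lower n s.-1) (x ++ s :: p0)).
      have [w1 [w2 [ew _]]] := split_first cw.
      have e2 : a = w1 ++ c :: w2 ++ s.-1 :: p1 ++ s.-1 :: (p2 ++ s :: q).
        by rewrite e1 ew; cat_norm.
      apply: (fcl_lower_pair n3 fa s1n lc e2) => //.
      by move: nw; rewrite ew mem_cat inE !negb_or => /and3P[].
    apply: (hp3 s s.-1); first exact: lower_adj.
      by nlia.
    exists x, p0, (p1 ++ s.-1 :: p2 ++ s :: q); split=> //.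
    - by rewrite ea ep; cat_norm.
    - by move: sp; rewrite ep mem_cat negb_or => /andP[].
    move=> c cxp; have cxsp : c \in x ++ s :: p0.
      by move: cxp; rewrite !(mem_cat, inE) => /orP[]->; rewrite ?orbT.
    have cs : c != s.-1 by apply: contraTneq cxsp => ->.
    have cs0 : c != s.
      apply: contraTneq cxp => ->; rewrite mem_cat negb_or sx.
      by move: sp; rewrite ep mem_cat negb_or => /andP[].
    have := h c cxsp; rewrite cs /= adjE // negb_or => ->.
    by rewrite prednK //; nlia.
  have [s2E|s3] : s = 2 \/ 3 <= s by nlia.
    subst s; apply: no_low; apply/hasPn => c cp; apply/negP => lc.
    apply: (hp3 2 c); rewrite ?(lower_adj lc) //; first by nlia.
    apply: (hp c cp (lower_adj lc)) => d _.
    by rewrite adj0 -?(lower2 n) // => /eqP.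
  apply: no_low; apply/hasPn => c cp; move: lt; rewrite !lowerE; [|nlia|nlia].
  by move=> /eqP tE; apply: contraNneq tp => cE; rewrite tE -cE.
have pair s t : adj n s t -> t \in a -> index s a < index t a ->
    (forall r, adj n s r -> index s a <= index r a) ->
    (forall r, adj n t r -> r != s -> index t a <= index r a) -> head_pair a s t.
  move=> st ta sti hs ht; have [w [z [ea tw]]] := split_first ta.
  have sw : s \in w by rewrite (mem_prefix _ ea).
  have [x [y [ew sx]]] := split_first sw.
  have eas : a = x ++ s :: (y ++ t :: z) by rewrite ea ew; cat_norm.
  have xs : {in x, forall r, (r != s) && ~~ adj n s r}.
    move=> r rx; have -> : r != s by apply: contraNneq sx => <-.
    apply/negP => /hs; rewrite leqNgt -(mem_prefix _ eas) // rx.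
    by [].
  move: tw; rewrite ew mem_cat inE !negb_or => /and3P[tx _ ty].
  have sy : s \notin y.
    apply/negP => /split_first[p [q [ey sp]]].
    apply: (single s t x p (q ++ t :: z)) => //.
      by rewrite eas ey; cat_norm.
    by move: ty; rewrite ey mem_cat negb_or => /andP[].
  exists x, y, z; split=> //.
  move=> r rxy; have rt : r != t.
    by apply: contraTneq rxy => ->; rewrite mem_cat negb_or tx.
  have rs : r != s.
    by apply: contraTneq rxy => ->; rewrite mem_cat negb_or sx.
  rewrite rt; apply/negP => /ht/(_ rs); rewrite leqNgt -(mem_prefix _ ea); last first.
    by rewrite ew mem_cat inE !negb_or tx ty eq_sym adj_neq.
  by rewrite ew mem_cat inE (negPf rs) -mem_cat rxy.
split.
- by move=> s t st stn ta sti hs ht; apply: (hp3 s t) => //; apply: pair.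
- move=> n1a h1 h2; apply: (G n n.+1); first by rewrite /adj; nlia.
  apply: pair => //; first by rewrite /adj; nlia.
    move=> r; rewrite adjE ?lowerE; [|nlia|nlia].
    by move=> /orP[/eqP->//|/eqP->]; apply: ltnW.
  by move=> r; rewrite /adj => h /eqP[]; nlia.
move=> na h1 h2; apply: (G n.+1 n); first by rewrite /adj; nlia.
apply: pair => //; first by rewrite /adj; nlia.
  by move=> r; rewrite /adj => h; have -> : r = n; [nlia|apply: ltnW].
move=> r; rewrite adjE ?lowerE; [|nlia|nlia].
by move=> /orP[/eqP->//|/eqP->]; rewrite eqxx.
Qed.

End SingleLetters.

(** * Irreducibility in terms of words, and passage to inverses *)

Section Inverse.
Local Open Scope group_scope.
Variables (S : finType) (M : coxmatrix S).
Implicit Types (a b c x y z : seq S) (s t u : S).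

Local Notation W := (coxgroup M).
Local Notation gen := (cox_gen M).
Local Notation wp := (word_prod M).
Local Notation ell := (@cox_length S M).

Lemma reduced_ceq (w : W) a b : reduced_expr w a -> ceq M a b -> reduced_expr w b.
Proof. by case=> wa sa ab; rewrite /reduced_expr -(ceq_wp ab) -(ceq_size ab). Qed.

Lemma word_prod_rev a : wp (rev a) = (wp a)^-1.
Proof.
elim: a => [|s a IH]; first by rewrite word_prod_nil invg1.
by rewrite rev_cons word_prod_rcons IH word_prod_cons invgM genV.
Qed.

Lemma ell_inv (w : W) : ell w^-1 = ell w.
Proof.
have le (v : W) : (ell v^-1 <= ell v)%N.
  have [a [<- <-]] := reduced_exists v.
  by rewrite -word_prod_rev -(size_rev a) ell_word_le.
by apply/eqP; rewrite eqn_leq le /=; have := le w^-1; rewrite invgK.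
Qed.

Lemma reduced_rev (w : W) a : reduced_expr w a -> reduced_expr w^-1 (rev a).
Proof. by case=> <- sa; rewrite /reduced_expr word_prod_rev size_rev ell_inv. Qed.

Lemma full_comm_inv (w : W) : fully_commutative w -> fully_commutative w^-1.
Proof.
move=> fcw a b /reduced_rev ra /reduced_rev rb; apply/ceq_rev.
by apply: fcw; [move: ra|move: rb]; rewrite invgK.
Qed.

Lemma right_descents_inv (w : W) s : right_descents w s = left_descents w^-1 s.
Proof. by rewrite /right_descents /left_descents /= ell_inv -[in RHS](genV M s) -invgM ell_inv. Qed.

Lemma right_weak_star_inv (w : W) s t :
  right_weak_star_reducible w s t <-> left_weak_star_reducible w^-1 s t.
Proof.
have E u : gen u * w^-1 = (w * gen u)^-1 by rewrite invgM genV.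
rewrite /right_weak_star_reducible /left_weak_star_reducible !right_descents_inv !E.
split=> -[h1 h2 h3 h4]; split=> // fc; apply: h4; last exact: full_comm_inv.
by have := full_comm_inv fc; rewrite invgK.
Qed.

(** The descents s of w and t of sw appear as the first two letters of an equivalent word. *)
Definition left_irr a : Prop := forall s t b, ceq M a [:: s, t & b] ->
  (3 <= M s t)%N -> fc_word M (t :: a).

Hypothesis alt_neq : forall s t j, s != t -> (0 < j < M s t)%N ->
  wp (alt s t j) <> wp (alt t s j).

Lemma left_irrP (w : W) a : fully_commutative w -> reduced_expr w a ->
  (forall s t, ~ left_weak_star_reducible w s t) <-> left_irr a.
Proof.
move=> fcw ra; split=> [nred s t b ab st|irr s t [st ds dt nfc]].
  have rst := reduced_ceq ra ab.
  have [ds rt] := reduced_left_descent rst.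
  have [dt _] := reduced_left_descent rt.
  have st2 : M s t != 2 by case: eqP st => // ->.
  (* If t were a left descent of w, some reduced word would start with t and another with s; their
     projections onto s and t would differ. *)
  have rta : reduced_expr (gen t * w) (t :: a).
    case: (ra) => wa sa; split; first by rewrite word_prod_cons wa.
    apply/eqP; rewrite eqn_leq -{2}wa -word_prod_cons ell_word_le andbT /= sa ltnNge.
    apply/negP => /left_descent_le/left_descent_reduced[c _ rc].
    have := ceq_proj st2 (fcw _ _ rst rc); rewrite /= !eqxx orbT => -[est].
    by move: st; rewrite est cox_diag.
  apply: full_comm_fc_word rta; apply: contrapT => nfc.
  by apply: (nred s t).
have [b rb rsb] := left_descent_reduced ds.
have [c rc rtc] := left_descent_reduced dt.
apply: nfc; have -> : gen t * w = wp (t :: a) by rewrite word_prod_cons; case: ra => ->.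
apply: (fc_word_full_comm alt_neq); apply: (irr s t c) => //.
apply: fcw => //; case: rtc => wtc stc; split.
  by rewrite word_prod_cons wtc genK.
by rewrite -[size _]/(size (t :: c)).+1 stc -rb.2; exact: rsb.2.
Qed.

Lemma weak_star_irreducibleP (w : W) a : reduced_expr w a ->
  weak_star_irreducible w <-> [/\ fully_commutative w, left_irr a & left_irr (rev a)].
Proof.
move=> ra; split=> [[fcw irr]|[fcw l r]].
  have fcw' := full_comm_inv fcw.
  split=> //; first by apply/(left_irrP fcw ra) => s t; case: (irr s t).
  apply/(left_irrP fcw' (reduced_rev ra)) => s t /right_weak_star_inv.
  by case: (irr s t).
split=> // s t; split; first exact: (left_irrP fcw ra).2.
move=> /right_weak_star_inv.
exact: ((left_irrP (full_comm_inv fcw) (reduced_rev ra)).2 r).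
Qed.

End Inverse.

Lemma map_cat_inv (S T : Type) (f : S -> T) a x y : map f a = x ++ y ->
  exists a1 a2, [/\ a = a1 ++ a2, map f a1 = x & map f a2 = y].
Proof.
move=> e; exists (take (size x) a), (drop (size x) a); rewrite cat_take_drop.
by rewrite map_take map_drop e take_size_cat // drop_size_cat.
Qed.

Lemma map_cons_inv (S T : Type) (f : S -> T) a x c y : map f a = x ++ c :: y ->
  exists a1 s a2, [/\ a = a1 ++ s :: a2, map f a1 = x, f s = c & map f a2 = y].
Proof.
move=> /map_cat_inv[a1 [[|s a2] [-> e1]]] //= [es e2].
by exists a1, s, a2.
Qed.

(** * Words of generators read as words of indices *)

Section Letters.
Variable n : nat.
Hypothesis n3 : 3 <= n.
Local Notation I := 'I_n.+2.
Local Notation M := (Btilde_mx n).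
Implicit Types (a b x y p q : seq I) (s t u : I).

Definition vals a : seq nat := map val a.

Lemma BtildeE s t : M s t = if s == t then 1 else if adj n s t then
  (if (n <= s) && (n <= t) then 4 else 3) else 2.
Proof.
rewrite /= /Btilde_entry; case: eqP => // /eqP st.
have {}st : nat_of_ord s != t by [].
have := ltn_ord s; have := ltn_ord t; move: (nat_of_ord s) (nat_of_ord t) st => i j ij hi hj.
have -> : Btilde_edge3 n i j || Btilde_edge3 n j i = adj n i j && ~~ ((n <= i) && (n <= j)).
  by rewrite /Btilde_edge3 /adj; nlia.
have -> : (i == n) && (j == n.+1) || (j == n) && (i == n.+1) = (n <= i) && (n <= j).
  by nlia.
case: ifP => [/andP[-> /negPf->] //|]; case: ifP => h; rewrite ?andbF ?andbT.
  by rewrite (_ : adj n i j) // /adj; nlia.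
by case: ifP.
Qed.

Lemma Btilde_ge3 s t : (3 <= M s t) = adj n s t.
Proof.
rewrite BtildeE; case: (eqVneq s t) => [->|_]; last by case: ifP => // _; case: ifP.
by rewrite /adj; nlia.
Qed.

Lemma Btilde_eq2 s t : (M s t == 2) = (s != t) && ~~ adj n s t.
Proof.
rewrite BtildeE; case: (eqVneq s t) => //= _.
by case: ifP => //= _; case: ifP.
Qed.

Lemma commutes_vals s x :
  commutes M s x = all (fun r : nat => (r != s) && ~~ adj n s r) (vals x).
Proof.
rewrite /commutes /vals all_map; apply: eq_all => u.
by rewrite Btilde_eq2 /= adjC.
Qed.

Lemma vals_cat a b : vals (a ++ b) = vals a ++ vals b.
Proof. exact: map_cat. Qed.

Lemma vals_proj s t a : vals (proj s t a) = filter (pred2 (s : nat) (t : nat)) (vals a).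
Proof. by rewrite /vals filter_map. Qed.

Lemma mem_vals s a : (val s \in vals a) = (s \in a).
Proof. by rewrite /vals mem_map //; apply: val_inj. Qed.

Lemma vals_split a (x : seq nat) (c : nat) (y : seq nat) : vals a = x ++ c :: y -> exists a1 s a2,
  [/\ a = a1 ++ s :: a2, vals a1 = x, s = c :> nat & vals a2 = y].
Proof. exact: map_cons_inv. Qed.

(* The relation [ceq] read on indices: equality in the partially commutative monoid. *)
Definition teq (x y : seq nat) : Prop := forall i j, (i == j) || adj n i j ->
  filter (pred2 i j) x = filter (pred2 i j) y.

Lemma teq_ceq a b : teq (vals a) (vals b) -> ceq M a b.
Proof.
move=> ab; apply/ceqP => s t st; apply: (inj_map val_inj); rewrite -!/(vals _).
rewrite !vals_proj; apply: ab; move: st; rewrite Btilde_eq2 negb_and !negbK.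
by rewrite -val_eqE.
Qed.

Lemma ceq_teq a b : ceq M a b -> teq (vals a) (vals b).
Proof.
move=> ab i j ij.
have [i_le|i_gt] := ltnP i n.+2; last first.
  have nf c : filter (pred2 i j) (vals c) = [::].
    apply/eqP; rewrite -(negbK (_ == _)) -has_filter; apply/hasPn => _ /mapP[u _ ->] /=.
    have := ltn_ord u; move: ij; rewrite /adj; nlia.
  by rewrite !nf.
have [j_le|j_gt] := ltnP j n.+2; last first.
  have nf c : filter (pred2 i j) (vals c) = [::].
    apply/eqP; rewrite -(negbK (_ == _)) -has_filter; apply/hasPn => _ /mapP[u _ ->] /=.
    have := ltn_ord u; move: ij; rewrite /adj; nlia.
  by rewrite !nf.
have := @ceq_proj _ M (Ordinal i_le) (Ordinal j_le) a b; rewrite Btilde_eq2 negb_and !negbK.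
by move=> /(_ ij ab)/(congr1 vals); rewrite !vals_proj.
Qed.

(** Since 0 and 1 commute, every pair of letters to be compared omits one of them. *)
Lemma swap01_teq (x y : seq nat) : swap01 x y -> teq x y.
Proof.
move=> /andP[/eqP E0 /eqP E1] i j ij.
have H c z : c != i -> c != j ->
    filter (pred2 i j) z = filter (pred2 i j) (filter (fun d => d != c) z).
  move=> ci cj; rewrite -filter_predI; apply: eq_filter => d /=.
  by nlia.
have [/andP[h1 h2]|h] := boolP ((0 != i) && (0 != j)).
  by rewrite (H 0 x) // (H 0 y) // E0.
have [h1 h2] : 1 != i /\ 1 != j by move: h ij; rewrite /adj; nlia.
by rewrite (H 1 x) // (H 1 y) // E1.
Qed.

Section FcWord.
Variable a : seq I.
Hypothesis fa : fc_word M a.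

(** Letters of p that are not neighbours of s commute past it. Without a neighbour the two s meet,
    and with a single one across a simple bond they form a braid. *)
Lemma fc_word_count x s p q : a = x ++ s :: p ++ s :: q -> s \notin p ->
  0 < count (adj n s) (vals p) /\
  (forall u, count (adj n s) (vals p) = 1 -> u \in p -> adj n s u -> M s u <> 3).
Proof.
move=> ea sp; have [sq br] := fa.
have com y : {subset y <= p} -> ~~ has (adj n s) (vals y) -> commutes M s y.
  move=> yp /hasPn ns; rewrite commutes_vals; apply/allP => _ /mapP[u uy ->].
  rewrite ns ?andbT ?mem_vals //; apply: contraNneq sp => /val_inj<-.
  exact: yp.
split.
  rewrite -has_count; apply/negPn/negP => ns; apply: (sq x s (p ++ q)).
  rewrite ea; apply/ceq_catl; apply: ceq_cons; apply: ceq_move.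
  exact: com.
move=> u c1 up su m3; have [p1 [p2 [ep _]]] := split_first up.
move: c1; rewrite ep vals_cat count_cat /= su => c1.
have c_1 : commutes M s p1.
  apply: com; first by move=> v vp; rewrite ep mem_cat vp.
  by rewrite has_count; nlia.
have c_2 : commutes M s p2.
  apply: com; first by move=> v vp; rewrite ep mem_cat inE vp !orbT.
  by rewrite has_count; nlia.
apply: (br (x ++ p1) s u (p2 ++ q)); first by rewrite m3.
rewrite m3 /= ea ep -!catA /=; apply: ceq_catl.
apply: ceq_trans (ceq_sym (ceq_move _ c_1)) _; apply: ceq_catl.
by do 2!apply: ceq_cons; apply: ceq_move.
Qed.

Lemma fc_word_br x s t y1 y2 y3 z : a = x ++ s :: y1 ++ t :: y2 ++ s :: y3 ++ t :: z ->
  M s t = 4 -> commutes M s y1 -> commutes M s y2 -> commutes M t y2 -> commutes M t y3 ->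
  False.
Proof.
move=> ea st s1 s2 t2 t3; have [_ br] := fa.
apply: (br (x ++ y1 ++ y2) s t (y3 ++ z)); first by rewrite st.
rewrite st /= ea -!catA; apply: ceq_catl.
apply: ceq_trans (ceq_sym (ceq_move _ s1)) _; apply: ceq_catl.
apply: (@ceq_trans _ _ (s :: y2 ++ [:: t, s & y3 ++ t :: z])).
  by apply: ceq_cons; apply/ceq_sym/ceq_move.
apply: ceq_trans (ceq_sym (ceq_move _ s2)) _; apply: ceq_catl.
by do 3!apply: ceq_cons; apply: ceq_move.
Qed.

End FcWord.

Lemma commutes_n s a : s = n :> nat -> n \notin vals a -> n.+1 \notin vals a ->
  n.-1 \notin vals a -> commutes M s a.
Proof.
move=> sn h0 h1 h2; rewrite commutes_vals; apply/allP => r rv.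
have : r != n by apply: contraNneq h0 => <-.
have : r != n.+1 by apply: contraNneq h1 => <-.
have : r != n.-1 by apply: contraNneq h2 => <-.
by rewrite /adj; nlia.
Qed.

Lemma commutes_n1 s a : s = n.+1 :> nat -> n \notin vals a -> n.+1 \notin vals a ->
  commutes M s a.
Proof.
move=> sn h0 h1; rewrite commutes_vals; apply/allP => r rv.
have : r != n by apply: contraNneq h0 => <-.
have : r != n.+1 by apply: contraNneq h1 => <-.
by rewrite /adj; nlia.
Qed.

Lemma Btilde_n_n1 s t : s = n :> nat -> t = n.+1 :> nat -> M s t = 4.
Proof.
move=> sn tn; rewrite BtildeE /adj sn tn leqnn leqnSn.
have -> : s == t = false by rewrite -val_eqE /= sn tn; nlia.
by case: ifP => //; nlia.
Qed.

Lemma fc_word_local a : fc_word M a -> fc_local n (vals a).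
Proof.
move=> fa; split.
- by move=> _ /mapP[u _ ->]; have := ltn_ord u; nlia.
- move=> i x p q /vals_split[a1 [s [a2 [ea _ si]]]].
  move=> /vals_split[b1 [t [b2 [eb <- ti _]]]].
  have {}ti : t = s by apply: val_inj; rewrite /= ti.
  subst t i; rewrite mem_vals => sp sn.
  have [c0 c1] := fc_word_count fa (etrans ea (congr1 (fun w => a1 ++ s :: w) eb)) sp.
  rewrite ltnNge; apply/negP => cle.
  have /hasP[_ /mapP[u up ->] su] : has (adj n s) (vals b1) by rewrite has_count.
  have c1' : count (adj n s) (vals b1) = 1 by nlia.
  apply: (c1 u c1' up su); rewrite BtildeE su.
  have -> : (s == u) = false by apply: contraTF su => /eqP->; rewrite /adj; nlia.
  by rewrite leqNgt sn.
- move=> x p q /vals_split[a1 [s [a2 [ea _ si]]]].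
  move=> /vals_split[b1 [t [b2 [eb <- ti _]]]].
  have {}ti : t = s by apply: val_inj; rewrite /= ti.
  subst t; rewrite -{1}si mem_vals => sp n1p.
  have [c0 c1] := fc_word_count fa (etrans ea (congr1 (fun w => a1 ++ s :: w) eb)) sp.
  have E : count (adj n s) (vals b1) = count_mem n.-1 (vals b1).
    apply: eq_in_count => r rb /=; rewrite si adjE ?lowerE; [|nlia|nlia].
    by case: (r =P n.+1) => [rE|_]; [rewrite rE in rb; rewrite rb in n1p|rewrite orbF].
  rewrite -E ltnNge; apply/negP => cle.
  have /hasP[_ /mapP[u up ->] su] : has (adj n s) (vals b1) by rewrite has_count.
  have c1' : count (adj n s) (vals b1) = 1 by nlia.
  apply: (c1 u c1' up su); rewrite BtildeE su.
  have -> : (s == u) = false by apply: contraTF su => /eqP->; rewrite /adj; nlia.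
  case: ifP => // /andP[_ nu]; case/negP: n1p; apply/mapP; exists u => //=.
  by move: su; rewrite /adj; have := ltn_ord u; nlia.
- move=> x p q /vals_split[a1 [s [a2 [ea _ si]]]].
  move=> /vals_split[b1 [t [b2 [eb <- ti _]]]].
  have {}ti : t = s by apply: val_inj; rewrite /= ti.
  subst t; apply/negPn/negP => np.
  (* [fcl_n1] does not require the two letters n+1 to be consecutive, so the gap is cut at the first
     n+1 after the left one. *)
  have [c [w2 [ew sc cb]]] : exists c w2,
      [/\ b1 ++ s :: b2 = c ++ s :: w2, s \notin c & {subset c <= b1}].
    have [sb|sb] := boolP (s \in b1); last first.
      by exists b1, b2; split.
    have [w1 [w2 [-> h]]] := split_first sb; exists w1, (w2 ++ s :: b2).
    by split=> //; [cat_norm | move=> v vw; rewrite mem_cat vw].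
  have e : a = a1 ++ s :: c ++ s :: w2 by rewrite ea eb ew.
  have [+ _] := fc_word_count fa e sc; rewrite -has_count => /hasP[_ /mapP[u uc ->]].
  rewrite si => nu; case/negP: np; apply/mapP; exists u; first exact: cb.
  by move: nu; rewrite /adj; have := ltn_ord u => /=; nlia.
- move=> x y1 y2 y3 z /vals_split[a1 [s [a2 [ea _ si]]]].
  move=> /vals_split[b1 [t [b2 [eb <- ti]]]].
  move=> /vals_split[c1 [s' [c2 [ec <- si']]]].
  move=> /vals_split[d1 [t' [d2 [ed <- ti' _]]]].
  have {}si' : s' = s by apply: val_inj; rewrite /= si'.
  have {}ti' : t' = t by apply: val_inj; rewrite /= ti'.
  subst s' t'; rewrite !mem_cat !negb_or => /and3P[h1 h2 h3] /and3P[k1 k2 k3].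
  apply/negPn/negP; rewrite negb_or => /andP[l1 l2].
  apply: (fc_word_br fa (x := a1) (s := s) (t := t) (y1 := b1) (y2 := c1) (y3 := d1) (z := d2)).
  + by rewrite ea eb ec ed.
  + exact: Btilde_n_n1.
  + exact: commutes_n.
  + exact: commutes_n.
  + exact: commutes_n1.
  + exact: commutes_n1.
move=> x y1 y2 y3 z /vals_split[a1 [s [a2 [ea _ si]]]].
move=> /vals_split[b1 [t [b2 [eb <- ti]]]].
move=> /vals_split[c1 [s' [c2 [ec <- si']]]].
move=> /vals_split[d1 [t' [d2 [ed <- ti' _]]]].
have {}si' : s' = s by apply: val_inj; rewrite /= si'.
have {}ti' : t' = t by apply: val_inj; rewrite /= ti'.
subst s' t'; rewrite !mem_cat !negb_or => /and3P[h1 h2 h3] /and3P[k1 k2 k3].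
apply/negPn/negP; rewrite negb_or => /andP[l2 l3].
(* Reversal exchanges the two forms of the braid and moves the gaps free of n-1 to the first two
   places, where [fc_word_br] expects them. *)
have fa' : fc_word M (rev a) by apply/fc_word_rev.
have mr (r : nat) y : (r \in vals (rev y)) = (r \in vals y).
  by rewrite /vals map_rev mem_rev.
apply: (fc_word_br fa' (x := rev d2) (s := t) (t := s) (y1 := rev d1) (y2 := rev c1)
  (y3 := rev b1) (z := rev a1)).
+ by rewrite ea eb ec ed !(rev_cat, rev_cons); cat_norm.
+ exact: Btilde_n_n1.
+ by apply: commutes_n; rewrite ?mr.
+ by apply: commutes_n; rewrite ?mr.
+ by apply: commutes_n1; rewrite ?mr.
+ by apply: commutes_n1; rewrite ?mr.
Qed.

Lemma left_irr_local a : fc_word M a -> left_irr M a -> li_local n (vals a).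
Proof.
move=> fa irr; apply: li_of_single => //; first exact: fc_word_local.
move=> i j ij [x [y [z [ea xi yi xyj]]]].
have [a1 [s [a2 [ea' ex si]]]] := vals_split ea.
move=> /vals_split[b1 [t [b2 [eb ey ti ez]]]].
subst i j x y z; apply: (fc_word_local (a := t :: a)).
have c1 : commutes M s a1 by rewrite commutes_vals; apply/allP.
have c2 : commutes M t (a1 ++ b1) by rewrite commutes_vals vals_cat; apply/allP.
apply: (irr s t ((a1 ++ b1) ++ b2)); last by rewrite Btilde_ge3.
rewrite ea' eb; apply: ceq_trans (ceq_move _ c1) _; apply: ceq_cons.
by rewrite catA; apply: ceq_move.
Qed.

End Letters.

Lemma split_first_uniq (T : eqType) (t : T) x y x' y' : x ++ t :: y = x' ++ t :: y' ->
  t \notin x -> t \notin x' -> x = x' /\ y = y'.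
Proof.
elim: x x' => [|c x IH] [|c' x'] /=.
- by case.
- by move=> [->]; rewrite inE eqxx.
- by move=> [<- _]; rewrite inE eqxx.
move=> [<- /IH H]; rewrite !inE !negb_or => /andP[_ tx] /andP[_ tx'].
by have [-> ->] := H tx tx'.
Qed.

(** * Insertion of a letter, and products of commuting generators *)

Section CommutingWords.
Variables (S : finType) (M : coxmatrix S).
Implicit Types (a b c x y z : seq S) (s t u : S).

Local Notation W := (coxgroup M).
Local Notation gen := (cox_gen M).
Local Notation wp := (word_prod M).
Local Notation ell := (@cox_length S M).

(** A violation that avoids the new t would already occur in z. Only letters commuting with the new
    t can stand before it, so it is the first letter of the repetition or braid. *)
Lemma fc_word_insert t z : fc_word M z -> ~ fc_word M (t :: z) ->
  (exists y, ceq M z (t :: y)) \/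
  exists u x y, [/\ 3 <= M t u, t \notin x, u \notin x
    & ceq M (t :: z) (x ++ alt t u (M t u) ++ y)].
Proof.
move=> fz nf; have [sqz brz] := fz.
have in_x x y : ceq M (t :: z) (x ++ y) -> t \in x ->
    exists x', ceq M z (x' ++ y).
  move=> /ceq_head[x1 [y1 [e tx1 _ c1]]] /split_first[x2 [x3 [ex tx2]]].
  move: e; rewrite ex -catA cat_cons => /split_first_uniq[]// e1 e2.
  by exists (x2 ++ x3); rewrite -catA e1 e2.
have in_y x w y : ceq M (t :: z) (x ++ w ++ y) -> t \notin x -> t \notin w -> t \in y ->
    exists y', ceq M z (x ++ w ++ y').
  move=> /ceq_head[x1 [y1 [e tx1 _ c1]]] tx tw /split_first[y2 [y3 [ey ty2]]].
  have e' : (x ++ w ++ y2) ++ t :: y3 = x1 ++ t :: y1 by rewrite -e ey -!catA.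
  have [//|//|e1 e2] := split_first_uniq e'.
    by rewrite !mem_cat !negb_or tx tw.
  by exists (y2 ++ y3); rewrite !catA -(catA x) e1 e2.
have head x y : ceq M (t :: z) (x ++ t :: y) -> t \notin x ->
    commutes M t x /\ ceq M z (x ++ y).
  by move=> /ceq_head[x1 [y1 [e tx1 cx1 c1]]] tx; case: (split_first_uniq e) => // -> ->.
have tin b : ceq M (t :: z) b -> t \in b.
  by move=> /ceq_mem <-; rewrite mem_head.
have [[x [s [y E]]]|nsq] := pselect (exists x s y, ceq M (t :: z) (x ++ [:: s; s] ++ y)).
  have [tx|tx] := boolP (t \in x).
    by have [x' E'] := in_x _ _ E tx; case: (sqz x' s y).
  have [st|st] := eqVneq s t.
    subst s; have [cx c1] := head _ (t :: y) E tx; left; exists (x ++ y).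
    exact: ceq_trans c1 (ceq_move _ cx).
  have ts : t \notin [:: s; s] by rewrite !inE eq_sym (negPf st).
  have ty : t \in y.
    by have := tin _ E; rewrite !mem_cat (negPf tx) (negPf ts).
  by have [y' E'] := in_y _ _ _ E tx ts ty; case: (sqz x s y').
have [[x [s [u [y [su E]]]]]|nbr] := pselect (exists x s u y, 3 <= M s u /\
    ceq M (t :: z) (x ++ alt s u (M s u) ++ y)); last first.
  case: nf; split; first by move=> x s y E; apply: nsq; exists x, s, y.
  by move=> x s u y su E; apply: nbr; exists x, s, u, y.
have [tx|tx] := boolP (t \in x).
  by have [x' E'] := in_x _ _ E tx; case: (brz x' s u y).
have [st|st] := eqVneq s t.
  subst s; right; exists u, x, y; split=> //.
  have E' : ceq M (t :: z) (x ++ t :: (alt u t (M t u).-1 ++ y)).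
    by move: E; case: (M t u) su => // m _.
  have [/allP cx _] := head _ _ E' tx.
  by apply/negP => /cx; rewrite cox_sym => /eqP h; rewrite h in su.
have [ut|ut] := eqVneq u t.
  subst u; have E' : ceq M (t :: z) ((x ++ [:: s]) ++ t :: (alt s t (M s t).-2 ++ y)).
    by rewrite -catA; move: E; case: (M s t) su => [|[|m]].
  have := head _ _ E'; rewrite mem_cat inE negb_or tx eq_sym st => /(_ isT)[/allP cx _].
  have := cx s; rewrite mem_cat inE eqxx orbT => /(_ isT) /eqP h.
  by rewrite h in su.
have talt m : t \notin alt s u m.
  have: {subset alt s u m <= [:: s; u]}.
    elim: m s u {E su st ut} => //= m IH s u v; rewrite !inE => /orP[->//|/IH].
    by rewrite !inE orbC.
  by move=> sub; apply/negP => /sub; rewrite !inE !(eq_sym t) (negPf st) (negPf ut).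
have ty : t \in y.
  by have := tin _ E; rewrite !mem_cat (negPf tx) (negPf (talt _)).
by have [y' E'] := in_y _ _ _ E tx (talt _) ty; case: (brz x s u y').
Qed.

Definition commuting_word a : Prop :=
  uniq a /\ {in a &, forall s t, s != t -> M s t = 2}.

Lemma pairwise_commuting a : pairwise (fun s t => M s t == 2) a <-> commuting_word a.
Proof.
elim: a => [|s a [IH1 IH2]] /=; first by split=> // _; split.
split=> [/andP[/allP sa /IH1[ua ca]]|[/andP[sa ua] H]].
  split=> /=.
    rewrite ua andbT; apply/negP => /sa; by rewrite cox_diag.
  move=> t u; rewrite !inE => /orP[/eqP->|ta] /orP[/eqP->|ua'] tu.
  - by rewrite eqxx in tu.
  - exact/eqP/sa.
  - by rewrite cox_sym; apply/eqP/sa.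
  - exact: ca.
apply/andP; split; last first.
  by apply: IH2; split=> // t u ta ua'; apply: H; rewrite inE ?ta ?ua' orbT.
apply/allP => t ta; apply/eqP; apply: H; rewrite ?inE ?eqxx ?ta ?orbT //.
by apply: contraNneq sa => ->.
Qed.

Lemma commuting_word_ceq a b : commuting_word a -> perm_eq a b -> ceq M a b.
Proof.
move=> [ua ca] ab; apply/ceqP => s t st.
have sub c : perm_eq a c -> {in c &, forall u v, pred2 s t u -> pred2 s t v -> u = v}.
  move=> /perm_mem ac u v; rewrite -!ac => uc vc /= us vs; apply/eqP/negPn/negP => uv.
  have := ca u v uc vc uv; move: us vs uv.
  case/orP=> /eqP->; case/orP=> /eqP->; rewrite ?eqxx // => _ E; move: st; rewrite ?E //.
  by rewrite cox_sym E.
have small c : uniq c -> perm_eq a c -> size (proj s t c) <= 1.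
  move=> uc ac; have: uniq (proj s t c) by apply: filter_uniq.
  have : {subset proj s t c <= c} by move=> u; rewrite mem_filter => /andP[].
  have : {in proj s t c, forall u, pred2 s t u} by move=> u; rewrite mem_filter => /andP[].
  case: (proj s t c) => [|u [|v r]] //= h1 h2 /andP[uv _].
  case/negP: uv; rewrite (sub c ac u v) ?mem_head //.
  - by apply: h2; rewrite mem_head.
  - by apply: h2; rewrite !inE eqxx orbT.
  - by apply: h1; rewrite mem_head.
  - by apply: h1; rewrite !inE eqxx orbT.
have ub : uniq b by rewrite -(perm_uniq ab).
have pab : perm_eq (proj s t a) (proj s t b) by apply: perm_filter.
have := small a ua (perm_refl _); case E: (proj s t a) pab => [|u [|v r]] // pab _.
  by symmetry; apply/nilP; rewrite /nilp -(perm_size pab).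
by rewrite perm_sym in pab; rewrite (perm_small_eq _ pab).
Qed.

Lemma ceq_commuting_word a b : ceq M a b -> commuting_word a -> commuting_word b.
Proof.
move=> ab [ua ca]; split; first by rewrite -(perm_uniq (ceq_perm ab)).
by move=> s t; rewrite -!(ceq_mem ab); apply: ca.
Qed.

Lemma commuting_fc_word a : commuting_word a -> fc_word M a.
Proof.
move=> ca; split=> [x s y|x s t y st] /ceq_commuting_word/(_ ca)[].
  by rewrite cat_uniq /= inE eqxx /= !andbF.
move=> _ H; have [st'|st'] := eqVneq s t; first by rewrite st' cox_diag in st.
have := H s t; rewrite !mem_cat; case E: (M s t) st => [|[|m]] // st.
by rewrite /= !inE !eqxx !orbT => /(_ isT isT st') m0; rewrite m0 in st.
Qed.

Lemma commuting_left_irr a : commuting_word a -> left_irr M a.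
Proof.
move=> ca s t b /ceq_commuting_word/(_ ca)[/= u H] st.
have [st'|st'] := eqVneq s t; first by rewrite st' cox_diag in st.
by have := H s t; rewrite !inE !eqxx orbT => /(_ isT isT st') m0; rewrite m0 in st.
Qed.

Lemma supp_reduced (w : W) a : fully_commutative w -> reduced_expr w a ->
  supp w = [set s | s \in a].
Proof.
move=> fcw ra; apply/seteqP; split=> s /=; last by exists a.
by move=> [b rb]; rewrite (ceq_mem (fcw _ _ rb ra)).
Qed.

Hypothesis alt_neq : forall s t j, s != t -> (0 < j < M s t)%N ->
  wp (alt s t j) <> wp (alt t s j).

Lemma fc_word_reduced_expr a : fc_word M a -> reduced_expr (wp a) a.
Proof. by case/(fc_word_reduced alt_neq). Qed.

Lemma completely_commutative_word (v : W) :
  completely_commutative v <-> exists2 a, reduced_expr v a & commuting_word a.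
Proof.
split=> [[_ [a /pairwise_commuting ca ->]]|[a [<- _] ca]].
  by exists a => //; apply/fc_word_reduced_expr/commuting_fc_word.
split; first by apply/(fc_word_full_comm alt_neq)/commuting_fc_word.
by exists a => //; apply/pairwise_commuting.
Qed.

End CommutingWords.

(** * Candies *)

Section CandyWords.
Variable n : nat.
Hypothesis n3 : 3 <= n.
Local Notation I := 'I_n.+2.
Local Notation M := (Btilde_mx n).
Implicit Types (a b x y p q : seq I) (s t u : I) (c d i j k : nat).

Lemma gen_idxK i : i <= n.+1 -> gen_idx n i = i :> nat.
Proof. by move=> ile; rewrite /gen_idx inordK. Qed.

Definition oddw : seq I := [seq s : I <- enum 'I_n.+2 | odd s && (3 <= s)].
Definition evenw : seq I := [seq s : I <- enum 'I_n.+2 | ~~ odd s && (2 <= s)].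

Definition alternate c i : nat := if odd i then 1 - c else c.
Definition layer c j : seq I :=
  if odd j then evenw else gen_idx n (alternate c j./2) :: oddw.
(** Here k counts the letters 2: there are 2k+1 layers, the first and the last being of the kind
    with a fork letter. *)
Definition candy_word c k : seq I := flatten [seq layer c j | j <- iota 0 k.*2.+1].

Lemma mem_oddw s : (s \in oddw) = odd s && (3 <= s).
Proof. by rewrite mem_filter mem_enum andbT. Qed.

Lemma mem_evenw s : (s \in evenw) = ~~ odd s && (2 <= s).
Proof. by rewrite mem_filter mem_enum andbT. Qed.

Lemma vals_oddw : vals oddw = [seq i <- iota 0 n.+2 | odd i && (3 <= i)].
Proof. by rewrite -val_enum_ord filter_map. Qed.

Lemma vals_evenw : vals evenw = [seq i <- iota 0 n.+2 | ~~ odd i && (2 <= i)].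
Proof. by rewrite -val_enum_ord filter_map. Qed.

Lemma alternate_lt2 c i : c < 2 -> alternate c i < 2.
Proof. clear n3; by rewrite /alternate; case: ifP; nlia. Qed.

Lemma alternateS c i : c < 2 -> alternate c i.+1 = alternate (1 - c) i.
Proof. clear n3; by rewrite /alternate /=; case: (odd i); nlia. Qed.

Lemma alternate_neq c i : c < 2 -> alternate c i != alternate c i.+1.
Proof. clear n3; by rewrite /alternate /=; case: (odd i) => /=; nlia. Qed.

Lemma candy_wordS c k : c < 2 ->
  candy_word c k.+1 = (gen_idx n c :: oddw) ++ evenw ++ candy_word (1 - c) k.
Proof.
move=> c2; rewrite /candy_word.
have -> : iota 0 k.+1.*2.+1 = [:: 0, 1 & map (addn 2) (iota 0 k.*2.+1)].
  by rewrite doubleS -iotaDl.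
have : [seq layer c j | j <- [seq 2 + j | j <- iota 0 k.*2.+1]] =
       [seq layer (1 - c) j | j <- iota 0 k.*2.+1].
  by rewrite -map_comp; apply: eq_map => j; rewrite /layer /= negbK -alternateS.
by move: (map (addn 2) _) => L; rewrite /= => ->.
Qed.

Lemma candy_word0 c : candy_word c 0 = gen_idx n c :: oddw.
Proof. by rewrite /candy_word /= cats0. Qed.

Lemma filter_single (P : pred nat) (s : seq nat) i : uniq s -> i \in s -> P i ->
  {in s, forall j, P j -> j = i} -> filter P s = [:: i].
Proof.
move=> us si Pi H; rewrite -(filter_pred1_uniq us si); apply: eq_in_filter => j js /=.
by apply/idP/eqP => [/(H j js)|->].
Qed.

Lemma filter_candy_word3 c k : c < 2 ->
  [seq i <- vals (candy_word c k) | i < 3] = candy3 c k.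
Proof.
have fo : [seq i <- vals oddw | i < 3] = [::].
  rewrite vals_oddw -filter_predI; apply/eqP; rewrite -(negbK (_ == _)) -has_filter.
  by apply/hasPn => i _ /=; nlia.
have fe : [seq i <- vals evenw | i < 3] = [:: 2].
  apply: filter_single => //.
  - by rewrite vals_evenw filter_uniq ?iota_uniq.
  - by rewrite vals_evenw mem_filter mem_iota /=; nlia.
  - by move=> i; rewrite vals_evenw mem_filter; nlia.
have fl d : d < 2 -> [seq i <- vals (gen_idx n d :: oddw) | i < 3] = [:: d].
  move=> d2; rewrite /= fo gen_idxK; last nlia.
  by rewrite (ltn_trans d2).
elim: k c => [|k IH] c c2; first by rewrite candy_word0 fl.
rewrite candy_wordS // 2!vals_cat 2!filter_cat fl // fe IH //.
by nlia.
Qed.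

Lemma filter_candy_word i c k : c < 2 -> 2 <= i <= n ->
  let o := if odd i then i else i.+1 in let e := if odd i then i.+1 else i in
  filter (pred2 o e) (vals (candy_word c k)) = altseq o e k.
Proof.
move=> c2 ile o e.
have [oo o3 on] : [/\ odd o, 3 <= o & o <= n.+1] by rewrite /o; split; case: ifP; nlia.
have [ee e2 en] : [/\ ~~ odd e, 2 <= e & e <= n.+1] by rewrite /e; split; case: ifP; nlia.
have fo : filter (pred2 o e) (vals oddw) = [:: o].
  apply: filter_single.
  - by rewrite vals_oddw filter_uniq ?iota_uniq.
  - by rewrite vals_oddw mem_filter mem_iota oo o3.
  - by rewrite /= eqxx.
  - by move=> j; rewrite vals_oddw mem_filter /= => /andP[h _] /orP[/eqP|/eqP jE] //; nlia.
have fe : filter (pred2 o e) (vals evenw) = [:: e].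
  apply: filter_single.
  - by rewrite vals_evenw filter_uniq ?iota_uniq.
  - by rewrite vals_evenw mem_filter mem_iota ee e2.
  - by rewrite /= eqxx orbT.
  - by move=> j; rewrite vals_evenw mem_filter /= => /andP[h _] /orP[/eqP jE|/eqP] //; nlia.
have fl d : d < 2 -> filter (pred2 o e) (vals (gen_idx n d :: oddw)) = [:: o].
  move=> d2; rewrite /= gen_idxK; last nlia.
  by rewrite fo (_ : (d == o) || (d == e) = false) //; nlia.
elim: k c c2 => [|k IH] c c2; first by rewrite candy_word0 fl.
rewrite candy_wordS // 2!vals_cat 2!filter_cat fl // fe IH //.
by nlia.
Qed.

Lemma filter_sub (P Q : pred nat) (x : seq nat) : subpred P Q ->
  filter P x = filter P (filter Q x).
Proof.
move=> PQ; rewrite -filter_predI; apply: eq_filter => i /=.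
by apply/idP/andP => [h|[]//]; split=> //; apply: PQ.
Qed.

(** Adjacent letters lie in {0, 1, 2} or in {m, m+1} with 2 <= m <= n, so these projections
    determine the class. *)
Lemma teq_local (x y : seq nat) : {in x, forall i, i <= n.+1} -> {in y, forall i, i <= n.+1} ->
  [seq i <- x | i < 3] = [seq i <- y | i < 3] ->
  (forall i, 2 <= i <= n -> filter (pred2 i i.+1) x = filter (pred2 i i.+1) y) ->
  teq n x y.
Proof.
move=> xn yn E3 Ei i j ij.
have [ij3|ij3] : (i < 3) && (j < 3) \/ (3 <= i) || (3 <= j) by nlia.
  have sub : subpred (pred2 i j) (fun c => c < 3) by move=> c /=; nlia.
  by rewrite (filter_sub x sub) (filter_sub y sub) E3.
have [gt|le] : n.+1 < i \/ i <= n.+1 by nlia.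
  have nf (z : seq nat) : {in z, forall i, i <= n.+1} -> filter (pred2 i j) z = [::].
    move=> zn; apply/eqP; rewrite -(negbK (_ == _)) -has_filter; apply/hasPn => c /zn.
    by move: ij; rewrite /adj /=; nlia.
  by rewrite !nf.
have [m [mn sub]] : exists m, 2 <= m <= n /\ subpred (pred2 i j) (pred2 m m.+1).
  (* A single letter i >= 3 is read in the pair i-1, i, which stays in range also for i = n+1. *)
  exists (if i == j then i.-1 else minn i j); case: eqP => [ijE|/eqP ijN].
    by split; [nlia | move=> c /=; nlia].
  have {}ij : adj n i j by move: ij; rewrite (negPf ijN).
  by move: ij; rewrite /adj => ij; split; [nlia | move=> c /=; nlia].
by rewrite (filter_sub x sub) (filter_sub y sub) Ei.
Qed.

Lemma ceq_candy_word a c k : c < 2 ->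
  [seq i <- vals a | i < 3] = candy3 c k ->
  (forall i, 2 <= i <= n ->
    let o := if odd i then i else i.+1 in let e := if odd i then i.+1 else i in
    filter (pred2 o e) (vals a) = altseq o e k) ->
  ceq M a (candy_word c k).
Proof.
move=> c2 H3 Hi; apply: (teq_ceq n3); apply: teq_local.
- by move=> _ /mapP[s _ ->]; have := ltn_ord s; rewrite ltnS.
- by move=> _ /mapP[s _ ->]; have := ltn_ord s; rewrite ltnS.
- by rewrite H3 filter_candy_word3.
move=> i ile; have := Hi i ile; have := filter_candy_word k c2 ile.
case: ifP => _ /= <- //; rewrite !(eq_filter (a1 := pred2 i i.+1) (a2 := pred2 i.+1 i)) //.
all: by move=> r /=; rewrite orbC.
Qed.

Lemma candy3_rcons c k : c < 2 -> candy3 c k.+1 = candy3 c k ++ [:: 2; alternate c k.+1].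
Proof.
elim: k c => [|k IH] c c2 //; rewrite -[LHS]/([:: c, 2 & candy3 (1 - c) k.+1]) IH; last nlia.
by rewrite -(alternateS _ c2).
Qed.

Lemma candy3_rev c k : c < 2 -> rev (candy3 c k) = candy3 (alternate c k) k.
Proof.
elim: k => [|k IH] c2 //; rewrite candy3_rcons // rev_cat IH // -[rev _]/[:: _; _] /=.
congr [:: _, _ & candy3 _ _]; move: c2; rewrite /alternate /=.
by case: (odd k) => /=; nlia.
Qed.

Lemma altseq_rev (o e : nat) k : rev (altseq o e k) = altseq o e k.
Proof.
have R m : altseq o e m.+1 = altseq o e m ++ [:: e; o].
  by elim: m => // m IH; rewrite -[LHS]/([:: o, e & altseq o e m.+1]) [in LHS]IH.
by elim: k => // k IH; rewrite [in LHS]R rev_cat IH.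
Qed.

Lemma candy_word_rev c k : c < 2 ->
  ceq M (rev (candy_word c k)) (candy_word (alternate c k) k).
Proof.
move=> c2; apply: ceq_candy_word; first exact: alternate_lt2.
  by rewrite /vals map_rev filter_rev filter_candy_word3 // candy3_rev.
move=> i ile o e; rewrite /vals map_rev filter_rev -/(vals _).
by rewrite (filter_candy_word k c2 ile) altseq_rev.
Qed.

Lemma layer_commuting c j : c < 2 -> commuting_word M (layer c j).
Proof.
move=> c2; rewrite /layer; case: ifP => _.
  split; first by rewrite filter_uniq ?enum_uniq.
  move=> s t; rewrite !mem_evenw => hs ht st; apply/eqP; rewrite Btilde_eq2 // st.
  by rewrite /adj; nlia.
have cle : gen_idx n (alternate c j./2) = alternate c j./2 :> nat.
  by rewrite gen_idxK //; have := alternate_lt2 j./2 c2; nlia.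
have : gen_idx n (alternate c j./2) < 2 by rewrite cle alternate_lt2.
move: (gen_idx _ _) => r r2; split.
  by rewrite /= mem_oddw filter_uniq ?enum_uniq // andbT; nlia.
move=> s t; rewrite !inE !mem_oddw -!val_eqE /= => hs ht st.
apply/eqP; rewrite Btilde_eq2 // -val_eqE /= st.
by rewrite /adj; nlia.
Qed.

Lemma mem_layer c j s : c < 2 -> (s \in layer c j) =
  if odd j then ~~ odd s && (2 <= s) else (s == alternate c j./2 :> nat) || odd s && (3 <= s).
Proof.
move=> c2; rewrite /layer; case: ifP => _; first exact: mem_evenw.
rewrite inE mem_oddw -val_eqE /= gen_idxK //.
by have := alternate_lt2 j./2 c2; nlia.
Qed.

(* Every letter outside the first layer is preceded by one of its neighbours. *)
Lemma candy_word_head c k s b : c < 2 -> ceq M (candy_word c k.+1) (s :: b) ->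
  (s : nat) = c \/ odd s && (3 <= s).
Proof.
move=> c2 /(ceq_teq n3) E.
have [s2|s2] : (s < 2) \/ 2 <= s by nlia.
  have [<-|sc] : s = c :> nat \/ s = 1 - c :> nat by nlia.
    by left.
  have := E s 2; rewrite /adj => /(_ ltac:(nlia)).
  rewrite (filter_sub (vals (candy_word _ _)) (Q := fun i => i < 3)); last first.
    by move=> r /=; nlia.
  rewrite filter_candy_word3 //= eqxx /= (_ : c == s = false); last nlia.
  rewrite (_ : c == 2 = false); last nlia.
  by rewrite orbT eqxx /= => -[]; nlia.
right; rewrite andbC; case os: (odd s); first by nlia.
exfalso; have sn := ltn_ord s.
have [sn'|sn'] : s <= n \/ s = n.+1 :> nat by nlia.
  have := E s.+1 s; rewrite /adj => /(_ ltac:(nlia)).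
  have := @filter_candy_word s c k.+1 c2; rewrite os s2 sn' => /(_ isT) /= ->.
  by rewrite eqxx orbT /altseq => -[]; nlia.
have := E n s; rewrite /adj => /(_ ltac:(nlia)).
have := @filter_candy_word n c k.+1 c2; have -> : odd n by rewrite sn' in os; move: os => /=; case: odd.
move=> /(_ ltac:(nlia)); rewrite sn' /= => ->.
by rewrite sn' eqxx orbT /altseq => -[]; nlia.
Qed.

(** The second letter t of an equivalent word is 2 or larger and even. A neighbour r of t other than
    s also precedes the first t, so t could not come second. Only t = n+1, s = n with n odd is left,
    where s is the single neighbour of t. *)
Lemma candy_word_left_irr c k : c < 2 -> fc_word M (candy_word c k.+1) ->
  left_irr M (candy_word c k.+1).
Proof.
move=> c2 fz s t b ab; rewrite Btilde_ge3 // => st.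
have sh := candy_word_head c2 ab; have E := ceq_teq n3 ab.
have ts : (t : nat) != s by apply: contraTneq st => ->; rewrite /adj; nlia.
have first (r : nat) l : r != s -> adj n t r -> filter (pred2 (t : nat) r) (vals (candy_word c k.+1)) = r :: l -> False.
  move=> rs tr fr; have := E t r; rewrite tr orbT => /(_ isT); rewrite fr /= eqxx /=.
  rewrite (_ : (s == t :> nat) || (s == r :> nat) = false); last nlia.
  by case=> rt _; move: tr; rewrite rt /adj; nlia.
have f3 (r : nat) : filter (pred2 2 r) (vals (candy_word c k.+1)) =
    filter (pred2 2 r) (if r < 3 then candy3 c k.+1 else vals (candy_word c k.+1)).
  case: ifP => // r3; rewrite -(filter_candy_word3 k.+1 c2); apply: filter_sub.
  by move=> i /=; nlia.
have falt i : 2 <= i <= n -> exists l, filter (pred2 i i.+1) (vals (candy_word c k.+1)) =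
    (if odd i then i else i.+1) :: l.
  move=> ile; have := filter_candy_word k.+1 c2 ile; move: (vals _) => v.
  rewrite /altseq; case: ifP => _ /=; first by move=> ->; eexists.
  rewrite (eq_filter (a2 := pred2 i i.+1)); last by move=> r /=; rewrite orbC.
  by move=> ->; eexists.
have falt' i : 2 <= i <= n -> exists l, filter (pred2 i.+1 i) (vals (candy_word c k.+1)) =
    (if odd i then i else i.+1) :: l.
  move=> /falt[l fl]; exists l; rewrite -fl; apply: eq_filter => r; exact: orbC.
have tn := ltn_ord t; have sn := ltn_ord s.
case: sh => [sc|so].
  have t2 : t = 2 :> nat by move: st; rewrite /adj; nlia.
  have [|l fl] := falt 2; first by nlia.
  by exfalso; apply: (first 3 l); rewrite ?t2 //; [nlia | rewrite /adj; nlia].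
have te : ~~ odd t && (2 <= t) by move: st; rewrite /adj; nlia.
have [t2|[t4|tn1]] : t = 2 :> nat \/ 3 < t <= n \/ t = n.+1 :> nat by nlia.
- exfalso; apply: (first c (2 :: filter (pred2 2 c) (candy3 (1 - c) k))).
  + by nlia.
  + by rewrite t2 /adj; nlia.
  rewrite t2 f3 (_ : c < 3) /=; last nlia.
  by rewrite eqxx orbT.
- exfalso; have [sE|sE] : s = t.-1 :> nat \/ s = t.+1 :> nat by move: st; rewrite /adj; nlia.
    have [|l] := falt t; first by nlia.
    rewrite (_ : odd t = false); last nlia.
    by move=> fl; apply: (first t.+1 l) => //; [nlia | rewrite /adj; nlia].
  have [|l] := falt' t.-1; first by nlia.
  rewrite prednK; last nlia.
  rewrite (_ : odd t.-1 = true); last nlia.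
  by move=> fl; apply: (first t.-1 l) => //; [nlia | rewrite /adj; nlia].
have sE : s = n :> nat by move: st; rewrite /adj; nlia.
have on : odd n by nlia.
(* The only possible violation is the braid n+1, n, n+1, n, whose two letters n have no n-1 in
   between; but the projection onto n and n-1 starts with n, n-1. *)
apply: contrapT => /(fc_word_insert fz)[[y /(candy_word_head c2)]|]; first by nlia.
move=> [u [x [y [+ tx ux]]]]; rewrite Btilde_ge3 // => tu.
have uE : u = s by apply: val_inj; have := ltn_ord u; move: tu; rewrite /= /adj; nlia.
subst u; rewrite cox_sym (Btilde_n_n1 n3 sE tn1) => /(ceq_teq n3) E'.
have := E' n n.-1; rewrite /adj => /(_ ltac:(nlia)).
have [|l] := falt' n.-1; first by nlia.
have := @filter_candy_word n.-1 c k.+1 c2 ltac:(nlia).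
rewrite (_ : odd n.-1 = false) /=; last nlia.
rewrite prednK; last nlia.
rewrite tn1 (_ : (n.+1 == n) || (n.+1 == n.-1) = false); last nlia.
move=> -> _; rewrite vals_cat filter_cat /= tn1 sE !eqxx.
rewrite (_ : (n.+1 == n) || (n.+1 == n.-1) = false) /=; last nlia.
have xn : n \notin vals x by move: ux; rewrite -mem_vals /= sE.
have : {subset filter (pred2 n n.-1) (vals x) <= [:: n.-1]}.
  move=> r; rewrite mem_filter mem_seq1 => /andP[/orP[/eqP->|//]].
  by rewrite (negPf xn).
case: [seq r <- vals x | _] => [_|r l' sub].
  by rewrite /altseq /= => -[]; nlia.
have /eqP-> : r == n.-1 by rewrite -mem_seq1; apply: sub; apply: mem_head.
by case; nlia.
Qed.

End CandyWords.

Section FlattenedWords.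
Variables (S : finType) (M : coxmatrix S).
Local Notation wp := (word_prod M).

Lemma word_prod_flatten (f : nat -> seq S) N :
  wp (flatten [seq f j | j <- iota 0 N]) = (\prod_(j < N) wp (f j))%g.
Proof.
rewrite -(big_mkord xpredT (fun j => wp (f j))) /index_iota subn0 /word_prod.
by rewrite big_flatten /= big_map.
Qed.

Lemma size_flatten_iota (f : nat -> seq S) N :
  size (flatten [seq f j | j <- iota 0 N]) = \sum_(j < N) size (f j).
Proof.
rewrite -(big_mkord xpredT (fun j => size (f j))) /index_iota subn0.
by rewrite size_flatten sumnE !big_map.
Qed.

Lemma ceq_flatten (f g : nat -> seq S) (r : seq nat) :
  {in r, forall j, ceq M (f j) (g j)} ->
  ceq M (flatten [seq f j | j <- r]) (flatten [seq g j | j <- r]).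
Proof.
elim: r => [|j r IH] fg; first exact: ceq_refl.
have h : ceq M (f j) (g j) by apply: fg; rewrite mem_head.
have {}IH : ceq M (flatten [seq f i | i <- r]) (flatten [seq g i | i <- r]).
  by apply: IH => i ir; apply: fg; rewrite inE ir orbT.
apply: (ceq_trans (b := f j ++ flatten [seq g i | i <- r])).
  exact: ceq_catl.
exact: (@ceq_cat _ _ [::]).
Qed.

End FlattenedWords.

(** * Candies as group elements *)

Section CandySets.
Variable n : nat.
Hypothesis n3 : 3 <= n.
Local Notation I := 'I_n.+2.
Local Notation M := (Btilde_mx n).
Local Notation W := (Btilde n).
Local Notation wp := (word_prod M).
Implicit Types (a b x y p q : seq I) (s t : I) (c d i j k : nat) (w : W).

(** One set for both parities: n+1 falls among the odd letters for n even and among the even ones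
    for n odd, which gives [K] or [Kw]. *)
Definition candy_set : set W :=
  candies [set i : I | odd i && (3 <= i)] [set i : I | ~~ odd i && (2 <= i)].

Lemma layer_reduced c j : c < 2 -> reduced_expr (wp (layer n c j)) (layer n c j).
Proof.
move=> c2; apply: (fc_word_reduced_expr (@Btilde_alt_neq n)).
exact/commuting_fc_word/layer_commuting.
Qed.

Lemma layer_CC c j : c < 2 -> CC n (wp (layer n c j)).
Proof.
move=> c2; apply/(completely_commutative_word (@Btilde_alt_neq n)).
by exists (layer n c j); [exact: layer_reduced | exact: layer_commuting].
Qed.

Lemma supp_layer c j : c < 2 -> supp (wp (layer n c j)) = [set s | s \in layer n c j].
Proof.
by move=> c2; apply: supp_reduced (layer_reduced _ c2); case: (layer_CC j c2).
Qed.

Lemma candy_word_set w c k : c < 2 -> 0 < k -> fully_commutative w ->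
  reduced_expr w (candy_word n c k) -> candy_set w.
Proof.
case: k => [//|k] c2 _ fw rw; split=> //.
exists k.+1.*2, (fun j => wp (layer n c j)), (fun i => gen_idx n (alternate c i)).
have altn i : gen_idx n (alternate c i) = alternate c i :> nat.
  by rewrite gen_idxK //; have := alternate_lt2 i c2; nlia.
split=> [||||].
- split=> [|i _|||j t _].
  + by rewrite -word_prod_flatten; case: rw.
  + exact: layer_CC.
  + rewrite supp_layer //; apply/seteqP; split=> s /= sl.
      have [x [y [lE sx]]] := split_first sl.
      have cx : ceq M (candy_word n c k.+1) (s :: x ++ y ++ flatten [seq layer n c j | j <- iota 1 k.+1.*2]).
        have -> : candy_word n c k.+1 =
          layer n c 0 ++ flatten [seq layer n c j | j <- iota 1 k.+1.*2] by [].
        rewrite [in X in ceq _ X]lE -catA cat_cons.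
        apply: ceq_move; apply/allP => u ux; apply/eqP.
        have [_ cl] := layer_commuting n3 0 c2.
        apply: cl; rewrite ?lE ?mem_cat ?mem_head ?ux ?orbT //.
        by apply: contraNneq sx => <-.
      by case: (reduced_left_descent (reduced_ceq rw cx)).
    have [b _ rb] := left_descent_reduced sl.
    have /(candy_word_head n3 c2) := fw _ _ rw rb.
    rewrite (mem_layer n3) //= => -[->|->]; first by rewrite eqxx.
    by rewrite orbT.
  + case: rw => _ <-; rewrite /candy_word size_flatten_iota.
    apply: eq_bigr => j _; by case: (layer_reduced j c2).
  + rewrite !supp_layer //= => tl.
    (* A neighbour in the layer before: 2 for a fork letter, the fork letter of that layer for 2,
       and t-1 for t >= 3. *)
    have [s [sl st]] : exists s, s \in layer n c j /\ adj n s t.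
      have tn := ltn_ord t; move: tl; rewrite (mem_layer n3) //=.
      case oj: (odd j) => tl.
      move/orP: tl => [/eqP tE|to].
      * exists (gen_idx n 2); rewrite (mem_layer n3) // oj /adj gen_idxK; last nlia.
        by have := alternate_lt2 (uphalf j) c2; nlia.
      * exists (gen_idx n t.-1); rewrite (mem_layer n3) // oj /adj gen_idxK; last nlia.
        by nlia.
      move: tl => /= tl; have [t2|t4] : t = 2 :> nat \/ 3 < t by nlia.
        exists (gen_idx n (alternate c j./2)); rewrite (mem_layer n3) // oj /adj altn eqxx.
        by have := alternate_lt2 j./2 c2; nlia.
      exists (gen_idx n t.-1); rewrite (mem_layer n3) // oj /adj gen_idxK; last nlia.
      by nlia.
    by exists s; rewrite // Btilde_ge3.
- by rewrite doubleS.
- by rewrite odd_double.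
- move=> i ile; split.
    have := alternate_lt2 i c2; case: (alternate c i) => [_|[_|//]]; by [left|right].
  rewrite supp_layer //; apply/seteqP; split=> s /=.
    rewrite (mem_layer n3) // odd_double doubleK => /orP[/eqP sE|]; last by left.
    by right; apply: val_inj; rewrite /= altn.
  rewrite (mem_layer n3) // odd_double doubleK => -[->|->]; first by rewrite orbT.
  by rewrite altn eqxx.
- split=> i ile.
    by move/(congr1 val) => /=; rewrite !altn; apply/eqP/alternate_neq.
  rewrite supp_layer //; apply/seteqP; split=> s /=; rewrite (mem_layer n3) //= odd_double //=.
Qed.

Lemma candy_set_word w : candy_set w -> exists c k,
  [/\ c < 2, 0 < k & reduced_expr w (candy_word n c k)].
Proof.
case=> fw [m [u [x [[wE uc _ wl _] m2 om xE [xn uE]]]]].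
pose k := m./2; have mE : m = k.*2 by rewrite /k -[LHS]odd_double_half (negPf om).
have k0 : 0 < k by nlia.
have x2 i : i <= k -> x i = gen_idx n 0 \/ x i = gen_idx n 1 by case/xE.
pose c : nat := x 0.
have c2 : c < 2 by rewrite /c; case: (x2 0 isT) => ->; rewrite gen_idxK; nlia.
have xalt i : i <= k -> x i = alternate c i :> nat.
  elim: i => [//|i IH] ile; have := xn i ile; have := IH (ltnW ile).
  have := alternate_neq i c2; have := alternate_lt2 i c2; have := alternate_lt2 i.+1 c2.
  move=> h1 h2 h3 h4 h5.
  have : x i.+1 <> x i :> nat by move=> /val_inj h6; apply: h5.
  by case: (x2 _ ile) => ->; rewrite gen_idxK; nlia.
(* A product of commuting generators is determined by its support, so a reduced word of each factor
   is a rearrangement of the layer. *)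
have /choice[b bE] : forall j, exists bj, j <= m ->
    reduced_expr (u j) bj /\ ceq M bj (layer n c j).
  move=> j; have [jm|jm] := leqP j m; last by exists [::] => ?; nlia.
  have uj := uc j jm.
  have /(completely_commutative_word (@Btilde_alt_neq n))[bj rj cj] := uj.
  exists bj => _; split=> //; apply: commuting_word_ceq => //.
  apply: uniq_perm; [by case: cj | by case: (layer_commuting n3 j c2)|] => s.
  have /(congr1 (fun A : set I => A s)) /= sE := supp_reduced (proj1 uj) rj.
  rewrite (mem_layer n3) //; apply/idP/idP.
    rewrite -/(is_true _); move: sE; rewrite propeqE => -[_ sE] /sE.
    have [oj|oj] := boolP (odd j).
      by rewrite -[j in u j](odd_double_half) oj add1n uE //; nlia.
    rewrite -[j in u j](odd_double_half) (negPf oj) add0n.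
    have jk : j./2 <= k by nlia.
    case: (xE _ jk) => _ -> /= [->|->]; first by rewrite orbT.
    by rewrite xalt // eqxx.
  move: sE; rewrite propeqE => -[sE _] h; apply: sE; move: h.
  have [oj|oj] := boolP (odd j).
    by rewrite -[j in u j](odd_double_half) oj add1n uE //; nlia.
  rewrite -[j in u j](odd_double_half) (negPf oj) add0n.
  have jk : j./2 <= k by nlia.
  case: (xE _ jk) => _ -> /= /orP[/eqP sj|]; last by left.
  by right; apply: val_inj; rewrite /= xalt.
exists c, k; split=> //.
apply: (reduced_ceq (a := flatten [seq b j | j <- iota 0 m.+1])); last first.
  rewrite /candy_word -mE; apply: ceq_flatten => j; rewrite mem_iota => jm.
  by case: (bE j).
split.
  rewrite word_prod_flatten wE; apply: eq_bigr => j _.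
  by case: (bE j (ltn_ord j)) => -[].
rewrite size_flatten_iota wl; apply: eq_bigr => j _.
by case: (bE j (ltn_ord j)) => -[].
Qed.

Lemma K_E : K n = if odd n then set0 else candy_set.
Proof.
clear n3; rewrite /K /candy_set; case: ifP => // on.
by congr candies; apply/seteqP; split=> i /=; have := ltn_ord i; nlia.
Qed.

Lemma Kw_E : Kw n = if odd n then candy_set else set0.
Proof.
clear n3; rewrite /Kw /candy_set; case: ifP => // on.
by congr candies; apply/seteqP; split=> i /=; have := ltn_ord i; nlia.
Qed.

Lemma candy_set_irreducible w : candy_set w -> Iw n w.
Proof.
move=> cw; have fw := cw.1; have [c [k [c2 + rw]]] := candy_set_word cw.
case: k rw => // k rw _.
have fz := full_comm_fc_word fw rw.
apply/(weak_star_irreducibleP (@Btilde_alt_neq n) rw); split=> //.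
  exact: (candy_word_left_irr n3 c2 fz).
have e := candy_word_rev n3 k.+1 c2.
have fr : fc_word M (candy_word n (alternate c k.+1) k.+1).
  by apply: fc_word_ceq e _; apply/fc_word_rev.
move=> s t b rb st; apply: (fc_word_ceq (a := t :: candy_word n (alternate c k.+1) k.+1)).
  exact/ceq_cons/ceq_sym.
apply: (candy_word_left_irr n3 (alternate_lt2 _ c2) fr (s := s) (b := b)) => //.
by apply: ceq_trans rb; apply: ceq_sym.
Qed.

End CandySets.

(** * Irreducible zigzags *)

Lemma filter_head (P : pred nat) (x : seq nat) (i : nat) (y : seq nat) :
  ~~ has P x -> P i -> exists l, filter P (x ++ i :: y) = i :: l.
Proof.
by rewrite has_filter negbK filter_cat => /eqP-> /= ->; exists (filter P y).
Qed.

Section ZigzagWords.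
Variable n : nat.
Hypothesis n3 : 3 <= n.
Local Notation I := 'I_n.+2.
Local Notation M := (Btilde_mx n).
Local Notation W := (Btilde n).
Implicit Types (a b x y z p q : seq nat) (Z : seq I) (s t : I) (i j k h : nat) (w : W).

Lemma filter_iota_head i j y : i < j -> i <= n.+1 ->
  exists l, filter (pred2 i j) (iota 0 n.+2 ++ y) = i :: l.
Proof.
move=> ij ile; have -> : iota 0 n.+2 = iota 0 i ++ i :: iota i.+1 (n.+1 - i).
  have -> : n.+2 = i + (n.+1 - i).+1 by nlia.
  by rewrite iotaD.
rewrite -catA cat_cons; apply: filter_head; last by rewrite /= eqxx.
by apply/hasPn => r; rewrite mem_iota /= => ri; lia.
Qed.

Lemma filter_rev_iota_head i j y : j < i -> 2 <= i <= n.+1 ->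
  exists l, filter (pred2 i j) (rev (iota 2 n) ++ y) = i :: l.
Proof.
move=> ji ile; have -> : iota 2 n = iota 2 (i - 2) ++ i :: iota i.+1 (n.+1 - i).
  have {1}-> : n = (i - 2) + (n.+1 - i).+1 by nlia.
  by rewrite iotaD /= (_ : 2 + (i - 2) = i) //; nlia.
rewrite rev_cat rev_cons cat_rcons -catA cat_cons -cat_rcons.
rewrite cat_rcons; apply: filter_head; last by rewrite /= eqxx.
by apply/hasPn => r; rewrite mem_rev mem_iota /= => ri; lia.
Qed.

(** Vacuous: only 0 or 1 can come first, and 2 cannot come second because the other fork letter
    precedes it. *)
Lemma rising_left_irr Z y : vals Z = iota 0 n.+2 ++ y -> left_irr M Z.
Proof.
move=> Zy s t b /(ceq_teq n3) E; rewrite Btilde_ge3 // => st; exfalso.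
have sn := ltn_ord s.
have [s2|s2] : 2 <= s \/ s < 2 by nlia.
  have [i [il is_]] : exists i, i < s /\ adj n i s.
    have [->|s3] : s = 2 :> nat \/ 2 < s by nlia.
      by exists 0; rewrite /adj; nlia.
    by exists s.-1; rewrite /adj; nlia.
  have := E i s; rewrite is_ orbT => /(_ isT); rewrite Zy.
  have [||l ->] := @filter_iota_head i s y => //; first by nlia.
  by rewrite /= eqxx orbT => -[]; nlia.
have t2 : t = 2 :> nat by move: st; rewrite /adj; nlia.
have := E (1 - s) 2; rewrite {1}/adj => /(_ ltac:(nlia)); rewrite Zy.
have [||l ->] := @filter_iota_head (1 - s) 2 y; [by nlia|by nlia|].
rewrite /= t2 eqxx orbT (_ : (s == 1 - s :> nat) || (s == 2 :> nat) = false); last nlia.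
by case; nlia.
Qed.

(** Only n+1, n can come to the front as a bonded pair. Prepending n is harmless unless it completes
    the braid n, n+1, n, n+1; the condition on [y] says that after n+1, n the next of these two
    letters is not n+1. *)
Lemma falling_left_irr Z y : fc_word M Z -> vals Z = rev (iota 2 n) ++ y ->
  (forall q, filter (pred2 n n.+1) y <> n.+1 :: q) -> left_irr M Z.
Proof.
move=> fZ Zy yn s t b Zb; rewrite Btilde_ge3 // => st.
have head (r : I) (x : seq I) : ceq M Z (r :: x) -> r = n.+1 :> nat.
  move=> /(ceq_teq n3) E; apply/eqP; have := ltn_ord r; rewrite ltnS leq_eqVlt => /orP[//|rn].
  exfalso; have [i [il ir ile]] : exists i, [/\ r < i, adj n i r & 2 <= i <= n.+1].
    have [r2|r2] : r < 2 \/ 2 <= r by nlia.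
      by exists 2; rewrite /adj; split; nlia.
    by exists r.+1; rewrite /adj; split; nlia.
  have := E i r; rewrite ir orbT => /(_ isT); rewrite Zy.
  have [||l ->] := @filter_rev_iota_head i r y => //.
  by rewrite /= eqxx orbT => -[]; nlia.
have sE := head _ _ Zb.
have tn : t = n :> nat by have := ltn_ord t; move: st; rewrite /adj; nlia.
apply: contrapT => /(fc_word_insert fZ)[[x /head]|]; first by nlia.
move=> [u [x1 [x2 [+ tx ux /(ceq_teq n3) E]]]]; rewrite Btilde_ge3 // => tu.
have fE : filter (pred2 n n.+1) (vals Z) = [:: n.+1, n & filter (pred2 n n.+1) y].
  rewrite Zy filter_cat (_ : iota 2 n = iota 2 n.-2 ++ [:: n; n.+1]); last first.
    have {1}-> : n = n.-2 + 2 by nlia.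
    by rewrite iotaD (_ : 2 + n.-2 = n) //; nlia.
  rewrite rev_cat filter_cat /= !eqxx orbT /=.
  rewrite (_ : filter _ (rev _) = [::]) //.
  by apply/eqP; rewrite -[_ == _]negbK -has_filter; apply/hasPn => r; rewrite mem_rev mem_iota /=; lia.
move: E; move mE: (M t u) => m E.
have := E n n.+1; rewrite {1}/adj => /(_ ltac:(nlia)).
rewrite /= tn eqxx /= -/(vals Z) fE vals_cat filter_cat => EE.
have x1E : filter (pred2 n n.+1) (vals x1) = [::].
  have : n \notin filter (pred2 n n.+1) (vals x1).
    rewrite mem_filter negb_and; apply/orP; right.
    by move: tx; rewrite -mem_vals /= tn.
  by move: EE; case: (filter _ (vals x1)) => // r l [<- _]; rewrite mem_head.
move: EE; rewrite x1E /=.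
have un := ltn_ord u.
have [uE|uE] : u = n.-1 :> nat \/ u = n.+1 :> nat by move: tu; rewrite tn /adj; nlia.
  have -> : m = 3.
    rewrite -mE BtildeE // tu ifN; last by rewrite -val_eqE /= tn uE; nlia.
    by rewrite ifN // uE; nlia.
  rewrite /= tn uE eqxx /= (_ : (n.-1 == n) || (n.-1 == n.+1) = false); last nlia.
  by case; nlia.
rewrite -mE Btilde_n_n1 //= tn uE !eqxx !orbT.
by case => /yn.
Qed.

(** The two ways in which a complete zigzag can begin. Its reverse begins in one of them as well, so
    left and right irreducibility are treated alike. *)
Definition zig_start z : Prop := (exists y, z = iota 0 n.+2 ++ y) \/
  exists y, z = rev (iota 2 n) ++ y /\ (forall q, filter (pred2 n n.+1) y <> n.+1 :: q).

Lemma zig_start_left_irr Z : fc_word M Z -> zig_start (vals Z) -> left_irr M Z.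
Proof.
by move=> fZ [[y /rising_left_irr//]|[y [Zy yn]]]; apply: falling_left_irr Zy yn.
Qed.

Lemma filter_iota_n m y q : m <= n ->
  filter (pred2 n n.+1) (iota m (n.+1 - m) ++ y) <> n.+1 :: q.
Proof.
move=> mn; have -> : iota m (n.+1 - m) = iota m (n - m) ++ n :: [::].
  have -> : n.+1 - m = (n - m) + 1 by nlia.
  by rewrite iotaD /= (_ : m + (n - m) = n) //; nlia.
rewrite -catA cat_cons; case: (@filter_head (pred2 n n.+1) (iota m (n - m)) n ([::] ++ y)).
- by apply/hasPn => r; rewrite mem_iota /= => ri; lia.
- by rewrite /= eqxx.
by move=> l -> []; nlia.
Qed.

Lemma filter_zA_n y q : filter (pred2 n n.+1) (zA n ++ y) <> n.+1 :: q.
Proof.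
have -> : zA n = iota 2 (n.+1 - 2) ++ [:: n.+1].
  rewrite /zA; have {1}-> : n = (n.+1 - 2) + 1 by nlia.
  by rewrite iotaD (_ : 2 + (n.+1 - 2) = n.+1) //; nlia.
by rewrite -catA; apply: filter_iota_n; nlia.
Qed.

Lemma rev_zB : rev (zB n) = iota 0 n.+1.
Proof. by rewrite /zB revK. Qed.

Lemma iota_fork : iota 0 n.+2 = [:: 0; 1] ++ zA n.
Proof. by []. Qed.

Lemma filter_rev_zB_n y q : filter (pred2 n n.+1) (rev (zB n) ++ y) <> n.+1 :: q.
Proof. by rewrite rev_zB; have := @filter_iota_n 0 y q isT; rewrite subn0. Qed.

Lemma zB_fork : zB n = rev (iota 2 n.-1) ++ [:: 1; 0].
Proof. by rewrite /zB (_ : n.+1 = 2 + n.-1) ?iotaD ?rev_cat //; nlia. Qed.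

Lemma rev_zA : rev (zA n) = n.+1 :: rev (iota 2 n.-1).
Proof.
rewrite /zA; have {1}-> : n = n.-1 + 1 by nlia.
by rewrite iotaD rev_cat (_ : 2 + n.-1 = n.+1) //; nlia.
Qed.

Lemma zig_up_start_ends k h : h <= 1 -> 0 < k + h ->
  zig_start (zig_up n k h) /\ zig_start (rev (zig_up n k h)).
Proof.
move=> h1 kh; split.
  left; rewrite /zig_up iota_fork; case: k kh => [|k] kh.
    have -> : h = 1 by nlia.
    by exists [::]; rewrite /npow /= !cats0.
  by exists (zB n ++ npow (zA n ++ zB n) k ++ npow (zA n) h); rewrite /npow /= -!catA.
have [h0|hE] : h = 0 \/ h = 1 by nlia.
  case: k kh => [|k] kh; first by nlia.
  (* The prefix [iota 0 n.+2] takes its last letter n+1 from the adjoining block, hence [behead]. *)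
  left; exists (behead (rev (zA n)) ++ rev ([:: 0; 1] ++ npow (zA n ++ zB n) k)).
  rewrite /zig_up h0 cats0 npowSr !rev_cat rev_zB -(addn1 n.+1) iotaD -!catA.
  by rewrite rev_zA.
right; have -> : zig_up n k h = [:: 0, 1 & npow (zA n ++ zB n) k] ++ zA n.
  by rewrite /zig_up hE [npow _ 1]/npow /= cats0.
rewrite rev_cat.
exists (rev [:: 0, 1 & npow (zA n ++ zB n) k]); split=> // q.
case: k kh => [|k] _; first by rewrite /= !ifN //; nlia.
rewrite npowSr -!cat_cons !rev_cat -!catA; exact: filter_rev_zB_n.
Qed.

Lemma zig_down_start_ends k h : h <= 1 -> 0 < k + h ->
  zig_start (zig_down n k h) /\ zig_start (rev (zig_down n k h)).
Proof.
move=> h1 kh; split.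
  right; have zE y : n.+1 :: zB n ++ y = rev (iota 2 n) ++ [:: 1, 0 & y].
    rewrite zB_fork -catA; have -> : iota 2 n = iota 2 n.-1 ++ [:: n.+1].
      have {1}-> : n = n.-1 + 1 by nlia.
      by rewrite iotaD (_ : 2 + n.-1 = n.+1) //; nlia.
    by rewrite rev_cat.
  rewrite /zig_down; case: k kh => [|k] kh.
    have -> : h = 1 by nlia.
    rewrite /npow /= zE; exists [:: 1; 0]; split=> // q.
    by rewrite /= !ifN //; nlia.
  rewrite [npow _ _.+1]/npow /= -/(npow _ _) -!catA zE.
  set y := (X in [:: 1, 0 & X]); exists [:: 1, 0 & y]; split=> // q.
  by rewrite /= !ifN; [exact: filter_zA_n|nlia|nlia].
have [h0|hE] : h = 0 \/ h = 1 by nlia.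
  case: k kh => [|k] kh; first by nlia.
  right; rewrite /zig_down h0 cats0 npowSr -cat_cons !rev_cat -catA.
  exists (rev (zB n) ++ rev (n.+1 :: npow (zB n ++ zA n) k)); split=> //.
  by move=> q; apply: filter_rev_zB_n.
left; have -> : zig_down n k h = (n.+1 :: npow (zB n ++ zA n) k) ++ zB n.
  by rewrite /zig_down hE [npow _ 1]/npow /= cats0.
rewrite rev_cat rev_zB.
have iE : iota 0 n.+2 = iota 0 n.+1 ++ [:: n.+1] by rewrite -(addn1 n.+1) iotaD.
rewrite iE; case: k {kh} => [|k]; first by exists [::]; rewrite cats0.
exists (behead (rev (zA n)) ++ rev (n.+1 :: npow (zB n ++ zA n) k ++ zB n)).
by rewrite npowSr catA -cat_cons rev_cat rev_zA -!catA.
Qed.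

Definition zig_up_word k h : seq I :=
  [:: gen_idx n 0; gen_idx n 1] ++ wpow (zigA n ++ zigB n) k ++ wpow (zigA n) h.
Definition zig_down_word k h : seq I :=
  gen_idx n n.+1 :: wpow (zigB n ++ zigA n) k ++ wpow (zigB n) h.

Lemma vals_wpow Z k : vals (wpow Z k) = npow (vals Z) k.
Proof. by elim: k => //= k IH; rewrite /wpow /npow /= vals_cat IH. Qed.

Lemma vals_gen_idx (r : seq nat) : {in r, forall i, i <= n.+1} ->
  vals [seq gen_idx n i | i <- r] = r.
Proof.
by move=> rn; rewrite /vals -map_comp map_id_in // => i /rn /= ?; rewrite gen_idxK.
Qed.

Lemma vals_zigA : vals (zigA n) = zA n.
Proof. by apply: vals_gen_idx => i; rewrite mem_iota; lia. Qed.

Lemma vals_zigB : vals (zigB n) = zB n.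
Proof. by apply: vals_gen_idx => i; rewrite mem_rev mem_iota; lia. Qed.

Lemma vals_zig_up k h : vals (zig_up_word k h) = zig_up n k h.
Proof.
rewrite /zig_up_word vals_cat vals_cat !vals_wpow vals_cat vals_zigA vals_zigB.
by rewrite /= !gen_idxK.
Qed.

Lemma vals_zig_down k h : vals (zig_down_word k h) = zig_down n k h.
Proof.
rewrite -[zig_down_word k h]cat1s vals_cat vals_cat !vals_wpow vals_cat vals_zigA vals_zigB.
by rewrite /= !gen_idxK.
Qed.

Lemma CZ_word w : CZ n w -> fully_commutative w /\ exists2 Z, reduced_expr w Z &
  zig_start (vals Z) /\ zig_start (rev (vals Z)).
Proof.
case=> fw [k [h [h1 kh [rw|rw]]]]; split=> //.
  exists (zig_up_word k h) => //; rewrite vals_zig_up; exact: zig_up_start_ends.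
exists (zig_down_word k h) => //; rewrite vals_zig_down; exact: zig_down_start_ends.
Qed.

Lemma CZ_irreducible w : CZ n w -> Iw n w.
Proof.
move=> /CZ_word[fw [Z rw [Z1 Z2]]]; have fZ := full_comm_fc_word fw rw.
apply/(weak_star_irreducibleP (@Btilde_alt_neq n) rw); split=> //.
  exact: zig_start_left_irr.
by apply: zig_start_left_irr; [exact/fc_word_rev | rewrite /vals map_rev].
Qed.

Lemma CZ_of_swap01 w Z k h : fully_commutative w -> reduced_expr w Z ->
  h <= 1 -> 0 < k + h ->
  swap01 (vals Z) (zig_up n k h) \/ swap01 (vals Z) (zig_down n k h) -> CZ n w.
Proof.
move=> fw rw h1 kh ZE; split=> //; exists k, h; split=> //.
have zz (z : seq I) : swap01 (vals Z) (vals z) -> reduced_expr w z.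
  by move=> /(swap01_teq n3) /(teq_ceq n3); apply: reduced_ceq.
case: ZE => ZE; [left | right]; apply: zz.
  by rewrite -/(zig_up_word k h) vals_zig_up.
by rewrite -/(zig_down_word k h) vals_zig_down.
Qed.

End ZigzagWords.

(** * Weak completely commutative elements *)

Lemma left_irr_ceq (S : finType) (M : coxmatrix S) (a b : seq S) :
  ceq M a b -> left_irr M a -> left_irr M b.
Proof.
move=> ab ia s t c bc st; apply: (fc_word_ceq (a := t :: a)); first exact: ceq_cons.
by apply: (ia s t c) => //; apply: ceq_trans bc.
Qed.

Section WeakCommutative.
Variable n : nat.
Hypothesis n3 : 3 <= n.
Local Notation I := 'I_n.+2.
Local Notation M := (Btilde_mx n).
Local Notation W := (Btilde n).
Local Notation wp := (word_prod M).
Implicit Types (a b v x y : seq I) (s t u : I) (w : W).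

Definition top_pair s t : bool :=
  (s == n :> nat) && (t == n.+1 :> nat) || (s == n.+1 :> nat) && (t == n :> nat).
Definition light v : Prop := commuting_word M v /\ {in v, forall u, u < n.-1}.

Lemma top_pairC s t : top_pair s t = top_pair t s.
Proof. clear n3; by rewrite /top_pair; nlia. Qed.

Lemma top_pair_entry s t : top_pair s t -> M s t = 4.
Proof.
move=> /orP[] /andP[/eqP sE /eqP tE]; first exact: Btilde_n_n1.
by rewrite cox_sym; apply: Btilde_n_n1.
Qed.

Lemma light_cons s t v : top_pair s t -> light v -> commuting_word M (s :: v).
Proof.
move=> st [[uv cv] lv]; have sv r : r \in v -> r != s /\ adj n s r = false.
  move=> /lv rn; split; first by rewrite -val_eqE /=; move: st; rewrite /top_pair; nlia.
  by move: st; rewrite /top_pair /adj; nlia.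
split; first by rewrite /= uv andbT; apply/negP => /sv[]; rewrite eqxx.
have c r : r \in v -> M s r = 2.
  by move=> /sv[rs a]; apply/eqP; rewrite Btilde_eq2 // a eq_sym rs.
move=> r q; rewrite !inE => /orP[/eqP->|rv] /orP[/eqP->|qv]; rewrite ?eqxx // => rq.
- exact: c.
- by rewrite cox_sym; apply: c.
- exact: cv.
Qed.

(** Counting settles it: s occurs once, while every braid that begins with s, and the braid of s and
    t of length four, contain it twice. *)
Lemma light_top_fc s t v : top_pair s t -> light v ->
  fc_word M (s :: t :: v) /\ fc_word M (t :: s :: t :: v).
Proof.
move=> st lv; have ts : top_pair t s by rewrite top_pairC.
have [us _] := light_cons st lv; have [ut _] := light_cons ts lv.
have s_t : s != t by rewrite -val_eqE /=; move: st; rewrite /top_pair; nlia.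
have mv r : r \in v -> adj n t r = false.
  by case: lv => _ h /h; move: st; rewrite /top_pair /adj; nlia.
have st2 : fc_word M (s :: t :: v).
  apply: contrapT => /(fc_word_insert (commuting_fc_word (light_cons ts lv)))[[y]|].
    move=> /ceq_mem /(_ s); rewrite !inE eqxx (negPf s_t) /=.
    by move: us => /= /andP[/negPf->].
  move=> [u [x [y [su _ _ /ceq_perm /permP /(_ (pred1 s))]]]].
  have -> : count (pred1 s) (s :: t :: v) = 1.
    move: us => /= /andP[/count_memPn->].
    by rewrite eqxx eq_sym (negPf s_t).
  rewrite !count_cat; case: (M s u) su => [|[|[|m]]] //= _.
  by rewrite !eqxx; nlia.
split=> //; apply: contrapT => /(fc_word_insert st2)[[y]|].
  move=> /(ceq_proj (s := s) (t := t)); rewrite top_pair_entry // => /(_ isT).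
  by rewrite /proj /= !eqxx orbT => -[sE]; rewrite sE eqxx in s_t.
move=> [u [x [y [+ tx _ E]]]]; rewrite Btilde_ge3 // => tu.
have ut' : u != t by apply: contraTneq tu => ->; rewrite /adj; nlia.
have : u \in t :: s :: t :: v.
  rewrite (ceq_mem E) !mem_cat; apply/orP; right; apply/orP; left.
  have : 3 <= M t u by rewrite Btilde_ge3.
  by case: (M t u) => [|[|m]] //= _; rewrite !inE eqxx orbT.
rewrite !inE (negPf ut') /= => /orP[/eqP uE|/mv]; last by rewrite tu.
move: E; rewrite uE top_pair_entry // => /ceq_perm /permP /(_ (pred1 s)).
have -> : count (pred1 s) (t :: s :: t :: v) = 1.
  move: us => /= /andP[/count_memPn->].
  by rewrite eqxx eq_sym (negPf s_t).
by rewrite !count_cat /= !eqxx; nlia.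
Qed.

(** Only s and t fail to commute, and every equivalent word keeps them in this order; prepending t
    is allowed by [light_top_fc]. *)
Lemma light_top_left_irr s t v : top_pair s t -> light v -> left_irr M (s :: t :: v).
Proof.
move=> st lv s' t' b E; rewrite Btilde_ge3 // => a'.
have ts : top_pair t s by rewrite top_pairC.
have s_t : s != t by rewrite -val_eqE /=; move: st; rewrite /top_pair; nlia.
have [_ cs] := light_cons st lv; have [_ ct] := light_cons ts lv.
have sub r : r \in s :: t :: v -> r = s \/ r = t \/ r \in v.
  by rewrite !inE => /orP[/eqP->|/orP[/eqP->|->]]; [left|right; left|right; right].
have s'_t' : s' != t' by apply: contraTneq a' => ->; rewrite /adj; nlia.
have big : M s' t' <> 2.
  by move/eqP; rewrite Btilde_eq2 // s'_t' a'.
have /sub ms' : s' \in s :: t :: v by rewrite (ceq_mem E) mem_head.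
have /sub mt' : t' \in s :: t :: v by rewrite (ceq_mem E) !inE eqxx orbT.
have e : s' = s /\ t' = t \/ s' = t /\ t' = s.
  case: ms' mt' => [sE|[sE|sv]] [tE|[tE|tv]]; subst.
  - by rewrite eqxx in s'_t'.
  - by left.
  - by case: big; apply: cs; rewrite ?inE ?eqxx ?tv ?orbT.
  - by right.
  - by rewrite eqxx in s'_t'.
  - by case: big; apply: ct; rewrite ?inE ?eqxx ?tv ?orbT.
  - by case: big; apply: cs; rewrite ?inE ?eqxx ?sv ?orbT.
  - by case: big; apply: ct; rewrite ?inE ?eqxx ?sv ?orbT.
  - by case: big; apply: cs; rewrite ?inE ?sv ?tv ?orbT.
case: e => -[sE tE]; subst; first by case: (light_top_fc st lv).
move: E => /(ceq_proj (s := s) (t := t)); rewrite top_pair_entry // => /(_ isT).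
by rewrite /proj /= !eqxx orbT => -[sE]; rewrite sE eqxx in s_t.
Qed.

Lemma light_rev v : light v -> light (rev v).
Proof.
move=> [[uv cv] lv]; split; first split; first by rewrite rev_uniq.
  by move=> s t; rewrite !mem_rev; apply: cv.
by move=> u; rewrite mem_rev => /lv.
Qed.

Lemma light_top_rev s t v : top_pair s t -> light v ->
  ceq M (rev (s :: t :: v)) (t :: s :: rev v).
Proof.
move=> st lv; rewrite !rev_cons -!cats1 -catA /=.
have c r : top_pair s t -> r \in [:: s; t] -> commutes M r (rev v).
  move=> _; rewrite !inE => rE; have cr : commuting_word M (r :: v).
    case/orP: rE => /eqP->; first exact: (light_cons st).
    by apply: (light_cons (t := s)) => //; rewrite top_pairC.
  case: cr => /= /andP[rv _] cr; apply/allP => u; rewrite mem_rev => uv; apply/eqP.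
  rewrite cox_sym; apply: cr; rewrite ?mem_head // ?inE ?uv ?orbT //.
  by apply: contraNneq rv => ->.
apply: (ceq_trans (b := t :: rev v ++ [:: s])).
  by apply: ceq_move; apply: c => //; rewrite !inE eqxx orbT.
apply: ceq_cons; rewrite -[in X in ceq _ _ X](cats0 (rev v)).
by apply: ceq_move; apply: c => //; rewrite !inE eqxx.
Qed.

Lemma CCw_word w : CCw n w <->
  (exists2 a, reduced_expr w a & commuting_word M a) \/
  exists s t v, [/\ top_pair s t, light v & w = wp (s :: t :: v)].
Proof.
have altn := @Btilde_alt_neq n.
have idx : gen_idx n n = n :> nat /\ gen_idx n n.+1 = n.+1 :> nat by rewrite !gen_idxK.
split=> [[/(completely_commutative_word altn) h|]|]; first by left.
  move=> [v [cv v1 v2 v3] wE]; right.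
  have /(completely_commutative_word altn)[b rb cb] := cv.
  have sb := supp_reduced (proj1 cv) rb; rewrite !sb /= in v1 v2 v3.
  have lb : light b.
    split=> // u ub; have un := ltn_ord u.
    have h r : r <= n.+1 -> u = r :> nat -> u = gen_idx n r.
      by move=> rn ur; apply: val_inj; rewrite /= gen_idxK.
    have [e|[e|[e|//]]] : u = n.-1 :> nat \/ u = n :> nat \/ u = n.+1 :> nat \/ u < n.-1 by nlia.
    - by case: v1; rewrite -(h _ _ e) //; nlia.
    - by case: v2; rewrite -(h _ _ e).
    - by case: v3; rewrite -(h _ _ e).
  have vb : v = wp b by case: rb.
  case: wE => ->; [exists (gen_idx n n), (gen_idx n n.+1), b|
    exists (gen_idx n n.+1), (gen_idx n n), b]; split=> //;
    rewrite ?word_prod_cons ?vb ?mulgA // /top_pair !idx.1 !idx.2 !eqxx //.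
  by rewrite orbT.
case=> [h|[s [t [v [st lv wE]]]]].
  by left; apply/(completely_commutative_word altn).
right; have rv := fc_word_reduced_expr altn (commuting_fc_word lv.1).
have cv : CC n (wp v) by apply/(completely_commutative_word altn); exists v; [|case: lv].
exists (wp v).
  have sv := supp_reduced (proj1 cv) rv.
  by split=> //; rewrite sv /= => /(proj2 lv); rewrite gen_idxK; nlia.
rewrite wE !word_prod_cons mulgA; move: st => /orP[] /andP[/eqP sE /eqP tE]; [left|right].
  have -> : s = gen_idx n n by apply: val_inj; rewrite /= idx.1.
  by have -> : t = gen_idx n n.+1 by apply: val_inj; rewrite /= idx.2.
have -> : s = gen_idx n n.+1 by apply: val_inj; rewrite /= idx.2.
by have -> : t = gen_idx n n by apply: val_inj; rewrite /= idx.1.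
Qed.

Lemma CCw_irreducible w : CCw n w -> Iw n w.
Proof.
have altn := @Btilde_alt_neq n.
move=> /CCw_word[[a ra ca]|[s [t [v [st lv ->]]]]].
  apply/(weak_star_irreducibleP altn ra); split; last 2 first.
  - exact: commuting_left_irr.
  - apply: commuting_left_irr; case: ca => ua ca; split; first by rewrite rev_uniq.
    by move=> s t; rewrite !mem_rev; apply: ca.
  have -> : w = wp a by case: ra.
  by apply: (fc_word_full_comm altn); apply: commuting_fc_word.
have [fst_ _] := light_top_fc st lv.
apply/(weak_star_irreducibleP altn (fc_word_reduced_expr altn fst_)); split.
- exact: fc_word_full_comm.
- exact: light_top_left_irr.
apply: left_irr_ceq (ceq_sym (light_top_rev st lv)) _.
by apply: light_top_left_irr; [rewrite top_pairC | exact: light_rev].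
Qed.

Lemma CCw_sparse w a : reduced_expr w a -> uniq (vals a) ->
  {in vals a &, forall i j, adj n i j -> (n <= i) && (n <= j)} ->
  (n \in vals a -> n.-1 \notin vals a) -> CCw n w.
Proof.
move=> ra ua ad nn; apply/CCw_word.
have ua' : uniq a by move: ua; rewrite map_inj_uniq //; apply: val_inj.
have com s t : s \in a -> t \in a -> s != t -> ~~ top_pair s t -> M s t = 2.
  move=> sa ta st p; apply/eqP; rewrite Btilde_eq2 // st /=; apply/negP => ast.
  have := ad s t; rewrite -!mem_vals /= in sa ta; move=> /(_ sa ta ast).
  have := ltn_ord s; have := ltn_ord t; move: p st; rewrite /top_pair -val_eqE /=; nlia.
have [/existsP[s /existsP[t /and3P[sa ta st]]]|no] :=
  boolP [exists s, exists t, [&& s \in a, t \in a & top_pair s t]]; last first.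
  left; exists a => //; split=> // s t sa ta st; apply: com => //.
  apply: contraNN no => p; apply/existsP; exists s; apply/existsP; exists t.
  exact/and3P.
right.
(* The top pair may occur in either order, and [CCw] admits both. The other letters lie below n-1,
   commute with this pair and can be moved behind it. *)
have [s' [t' [x [y [z [aE st']]]]]] : exists s' t' x y z,
    a = x ++ s' :: y ++ t' :: z /\ top_pair s' t'.
  have s_t : s != t by rewrite -val_eqE /=; move: st; rewrite /top_pair; nlia.
  have [x [y [aE _]]] := split_first sa; move: ta; rewrite aE mem_cat inE eq_sym (negPf s_t) /=.
  case/orP => /split_first[p [q [E _]]].
    by exists t, s, p, q, y; rewrite E -catA top_pairC.
  by exists s, t, x, p, q; rewrite E.
set v := x ++ y ++ z; have av : perm_eq a [:: s', t' & v].
  rewrite aE; apply/permP => P; rewrite /v /= !count_cat /= !count_cat /=; clear; lia.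
have := ua'; rewrite (perm_uniq av) /= inE negb_or => /and3P[/andP[s_t sv] tv uv].
have [sa' ta'] : s' \in a /\ t' \in a by rewrite !(perm_mem av) !inE !eqxx orbT.
have va r : r \in v -> r \in a by rewrite (perm_mem av) !inE => ->; rewrite !orbT.
have lv r : r \in v -> r < n.-1.
  move=> rv; have rn := ltn_ord r.
  have na : n \in vals a.
    move: sa' ta'; rewrite -!mem_vals /=.
    by case/orP: st' => /andP[/eqP-> /eqP->].
  have r1 : (r : nat) != n.-1.
    by apply: contraNneq (nn na) => <-; rewrite -[nat_of_ord r]/(val r) mem_vals va.
  have : r != s' /\ r != t' by split; apply: contraTneq rv => ->.
  by rewrite -!val_eqE /= => -[]; case/orP: st' => /andP[/eqP -> /eqP ->]; nlia.
have ntop r q : r \in v -> ~~ top_pair r q by move=> /lv; rewrite /top_pair; nlia.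
have comv r q : r \in a -> r \notin v -> {subset q <= v} -> commutes M r q.
  move=> ra' rv qv; apply/allP => u /qv uv'; apply/eqP; apply: com; rewrite ?ntop //; first exact: va.
  by apply: contraNneq rv => <-.
exists s', t', v; split=> //.
  by split=> //; split=> // r q rv qv rq; apply: com; rewrite ?va ?ntop.
have -> : w = wp a by case: ra.
apply: ceq_wp; rewrite aE; apply: (ceq_trans (b := s' :: x ++ y ++ t' :: z)).
  by apply: ceq_move; apply: comv => // u ux; rewrite /v mem_cat ux.
apply: ceq_cons; rewrite /v !catA; apply: ceq_move; apply: comv => // u uxy.
by rewrite /v catA mem_cat uxy.
Qed.

End WeakCommutative.

(** * Classification *)

Section Classification.
Variable n : nat.
Hypothesis n3 : 3 <= n.
Local Notation I := 'I_n.+2.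
Local Notation M := (Btilde_mx n).
Local Notation W := (Btilde n).
Local Notation wp := (word_prod M).
Implicit Types (a b v x y : seq I) (s t u : I) (w : W).

Lemma K_Kw_candy w : (K n `|` Kw n) w <-> candy_set w.
Proof.
by rewrite K_E Kw_E; case: (odd n); split=> [[]|] //; [right | left].
Qed.

Lemma irreducible_cases w : Iw n w -> [\/ candy_set w, CZ n w | CCw n w].
Proof.
move=> iw; have [a ra] := reduced_exists w.
have /(weak_star_irreducibleP (@Btilde_alt_neq n) ra)[fw la la'] := iw.
have fa := full_comm_fc_word fw ra.
have {la}la := left_irr_local n3 fa la.
have fa' : fc_word M (rev a) by apply/fc_word_rev.
have {la'}la' : li_local n (rev (vals a)).
  by rewrite -map_rev; apply: left_irr_local.
have {fa fa'}fa := fc_word_local n3 fa.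
have [r|nr] := pselect (rises (vals a)).
  have [k [h [h1 kh e]]] := rises_zigzag n3 fa la la' r.
  by constructor 2; apply: (CZ_of_swap01 n3 fw ra h1 kh); left.
have [f|nf] := pselect (falls n (vals a)).
  have [k [h [h1 kh e]]] := falls_zigzag n3 fa la la' f.
  by constructor 2; apply: (CZ_of_swap01 n3 fw ra h1 kh); right.
have [full|[ua ad na]] := full_or_sparse n3 fa la la' nr nf; last first.
  by constructor 3; apply: (CCw_sparse n3 ra).
constructor 1; have [c c2 f3] := full_candy n3 fa la la' nr nf full.
have fo := full_alternating n3 fa la la' nr nf full.
apply: (candy_word_set n3 c2 (k := count_mem 2 (vals a))) => //.
  by rewrite -has_count has_pred1 full //; lia.
by apply: (reduced_ceq ra); apply: ceq_candy_word.
Qed.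

(* The classes are told apart by the projections of their reduced words onto pairs
   of adjacent letters, which determine the element. *)
Lemma candy_set_CZ w : candy_set w -> CZ n w -> False.
Proof.
move=> /(candy_set_word n3)[c [k [c2 k0 rw]]] /(CZ_word n3)[fw [Z rZ [+ _]]].
have /(ceq_teq n3) E := fw _ _ rw rZ.
case=> [[y ZE]|[y [ZE _]]].
  have := E (1 - c) 2; rewrite ZE /adj => /(_ ltac:(nlia)).
  have [||l ->] := @filter_iota_head n n3 (1 - c) 2 y; [by nlia | by nlia |].
  rewrite (filter_sub (vals (candy_word _ _ _)) (Q := fun i => i < 3)); last first.
    by move=> r /=; nlia.
  rewrite filter_candy_word3 //; case: k k0 {rw E} => // k _ /=.
  rewrite (_ : (c == 1 - c) || (c == 2) = false); last nlia.
  by rewrite orbT => -[]; nlia.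
have [on|en] := boolP (odd n).
  have := E n n.+1; rewrite ZE /adj => /(_ ltac:(nlia)).
  have := filter_candy_word n3 k c2 (i := n) ltac:(nlia).
  rewrite on /= => ->; rewrite (eq_filter (a2 := pred2 n.+1 n)); last first.
    by move=> r; apply: orbC.
  have [||l ->] := @filter_rev_iota_head n n3 n.+1 n y; [by nlia | by nlia |].
  by rewrite /altseq => -[]; nlia.
have := E n.-1 n; rewrite ZE /adj => /(_ ltac:(nlia)).
have := filter_candy_word n3 k c2 (i := n.-1) ltac:(nlia).
have -> : odd n.-1 by nlia.
rewrite prednK; last nlia.
move=> /= ->; rewrite (eq_filter (a2 := pred2 n n.-1)); last by move=> r; apply: orbC.
have [||l ->] := @filter_rev_iota_head n n3 n n.-1 y; [by nlia | by nlia |].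
by rewrite /altseq => -[]; nlia.
Qed.

(** Words of [CCw] have no repeated letter, whereas a candy with k >= 1 contains 3 at least
    twice. *)
Lemma candy_set_CCw w : candy_set w -> CCw n w -> False.
Proof.
move=> /(candy_set_word n3)[c [k [c2 k0 rw]]] /(CCw_word n3) h.
have fw : fully_commutative w by case: (CCw_irreducible n3 (proj2 (CCw_word n3 w) h)).
have [a [ra ua]] : exists a, reduced_expr w a /\ uniq a.
  case: h => [[a ra [ua _]]|[s [t [v [st lv wE]]]]]; first by exists a.
  exists [:: s, t & v]; split.
    by rewrite wE; apply: (fc_word_reduced_expr (@Btilde_alt_neq n)); case: (light_top_fc n3 st lv).
  have [/= us _] := light_cons n3 st lv.
  have [/= ut _] := light_cons n3 (etrans (top_pairC t s) st) lv.
  rewrite /= inE negb_or; move: us ut => /andP[-> _] ->; rewrite !andbT.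
  by rewrite -val_eqE /=; move: st; rewrite /top_pair; lia.
have cu : uniq (vals (candy_word n c k)).
  rewrite map_inj_uniq; last exact: val_inj.
  by rewrite (perm_uniq (ceq_perm (fw _ _ rw ra))).
have := filter_uniq (pred2 3 2) cu; have := filter_candy_word n3 k c2 (i := 2) ltac:(nlia).
by move=> /= ->; case: k k0 {rw cu} => // k _; rewrite /= !inE eqxx.
Qed.

(** A zigzag uses all letters from 2 to n+1. The adjacent letters 2 and 3 exclude a product of
    commuting generators, and n-1 excludes the words with a top pair. *)
Lemma CZ_CCw w : CZ n w -> CCw n w -> False.
Proof.
move=> /(CZ_word n3)[fw [Z rZ [+ _]]] h.
move=> zs; have full i : 2 <= i <= n.+1 -> i \in vals Z.
  by move=> ile; case: zs => [[y ->]|[y [-> _]]]; rewrite mem_cat ?mem_rev mem_iota; lia.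
have fullZ i : 2 <= i <= n.+1 -> gen_idx n i \in Z.
  by move=> ile; rewrite -mem_vals /= gen_idxK ?full; lia.
case: (proj1 (CCw_word n3 w) h) => [[a ra [_ ca]]|[s [t [v [st lv wE]]]]].
  have ea := ceq_mem (fw _ _ rZ ra).
  have i2 : gen_idx n 2 \in a by rewrite -ea fullZ; lia.
  have i3 : gen_idx n 3 \in a by rewrite -ea fullZ; lia.
  have : 3 <= M (gen_idx n 2) (gen_idx n 3).
    by rewrite Btilde_ge3 // !gen_idxK /adj; nlia.
  by rewrite ca // -val_eqE /= !gen_idxK; nlia.
have ra : reduced_expr w [:: s, t & v].
  by rewrite wE; apply: (fc_word_reduced_expr (@Btilde_alt_neq n)); case: (light_top_fc n3 st lv).
have : gen_idx n n.-1 \in [:: s, t & v].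
  by rewrite -(ceq_mem (fw _ _ rZ ra)) fullZ //; lia.
rewrite !inE -!val_eqE /= gen_idxK; last nlia.
case/or3P => [/eqP e|/eqP e|/(proj2 lv)].
- by move: st; rewrite /top_pair; nlia.
- by move: st; rewrite /top_pair; nlia.
- by rewrite gen_idxK; nlia.
Qed.

End Classification.

Theorem theorem3p14 (n : nat) (hn : (3 <= n)%N) :
  [/\ Iw n = K n `|` Kw n `|` CZ n `|` CCw n,
      [/\ K n `&` Kw n = set0, K n `&` CZ n = set0 & K n `&` CCw n = set0],
      [/\ Kw n `&` CZ n = set0, Kw n `&` CCw n = set0 & CZ n `&` CCw n = set0],
      odd n -> K n = set0
    & ~~ odd n -> Kw n = set0].
Proof.
have disj (A B : set (Btilde n)) : (forall w, A w -> B w -> False) -> A `&` B = set0.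
  by move=> h; apply/seteqP; split=> w // -[]; apply: h.
have Kc w : K n w -> candy_set w by move=> Kw; apply/K_Kw_candy; left.
have Kwc w : Kw n w -> candy_set w by move=> Kw; apply/K_Kw_candy; right.
split.
- apply/seteqP; split=> w.
    case/(irreducible_cases hn) => [/K_Kw_candy h|h|h]; [left; left | left; right | right]; exact: h.
  case=> [[/K_Kw_candy|]|].
  + exact: candy_set_irreducible.
  + exact: CZ_irreducible.
  + exact: CCw_irreducible.
- split; apply: disj => w.
  + by rewrite K_E Kw_E; case: ifP.
  + by move=> /Kc; apply: candy_set_CZ.
  + by move=> /Kc; apply: candy_set_CCw.
- split; apply: disj => w.
  + by move=> /Kwc; apply: candy_set_CZ.
  + by move=> /Kwc; apply: candy_set_CCw.
  + exact: CZ_CCw.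
- by move=> on; rewrite K_E on.
- by move=> /negPf en; rewrite Kw_E en.
Qed.
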